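(* Let $\mathfrak{g}$ be an $I$-central Gårding-Dirichlet polynomial of degree $N$ on $\mathcal{S}(n)$ with (open) Gårding cone $\Gamma$, and let $f\in C(\mathbb{R}^n)$ with $f\geq 0$. Let $\Omega\subset\mathbb{R}^n$ be open and bounded. If $h\in C^{1,1}(\Omega)\cap C(\overline{\Omega})$ is an admissible solution of $\mathfrak{g}(D^2h)=f$ on $\Omega$, then $$\operatorname{osc}_{\Omega}h\leq\operatorname{osc}_{\partial\Omega}h+\frac{\mathrm{diam}(\Omega)}{|B_1|^{1/n}\,\mathfrak{g}(I)^{1/N}}\,\|f^{1/N}\|_{L^n(E^{+}(-h))},$$ where $E^{+}(-h)=\Gamma^{+}(-h)\cap\mathrm{Diff}^2(-h)$ is the set of flat upper contact points of $-h$ at which $-h$ is twice differentiable.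
   Context: $\mathcal{S}(n)$ is the space of real symmetric $n\times n$ matrices with inner product $\langle A,B\rangle=\mathrm{tr}(AB)$. $|B_1|$ is the Lebesgue measure of the unit ball of $\mathbb{R}^n$; $\operatorname{osc}_E h:=\sup_E h-\inf_E h$. $h\in C^{1,1}(\Omega)$ is understood locally (equivalently, $h$ is both locally semiconvex and locally semiconcave on $\Omega$). $I$-central Gårding-Dirichlet polynomial: a real homogeneous polynomial $\mathfrak{g}$ of degree $N$ on $\mathcal{S}(n)$ such that (1) for each $A\in\mathcal{S}(n)$ the polynomial $t\mapsto\mathfrak{g}(tI+A)$ has only real roots, with the normalization $\mathfrak{g}(I)>0$; (2) the open Gårding cone $\Gamma$, defined as the connected component containing $I$ of $\{A\in\mathcal{S}(n):\mathfrak{g}(A)\neq0\}$, contains $\{A\in\mathcal{S}(n):A>0\}$; (3) there exists $k>0$ such that the gradient of $\mathfrak{g}$ at $I$ is $D_I\mathfrak{g}=kI$. For a function $u:\Omega\to\mathbb{R}$, the upper contact set $\Gamma^{+}(u)$ is the set of $x\in\Omega$ for which there is $p\in\mathbb{R}^n$ with $u(y)\leq u(x)+\langle p,y-x\rangle$ for all $y\in\Omega$. $\mathrm{Diff}^2(u)$ is the set of $x\in\Omega$ at which $u$ is twice differentiable in the Peano sense (i.e. $u$ has a second order Taylor expansion at $x$ with error $o(|y-x|^2)$). Upper/lower contact jets: $J^{2,+}_xu$ (resp. $J^{2,-}_xu$) is the set of all $(\varphi(x),D\varphi(x),D^2\varphi(x))$ where $\varphi$ is $C^2$ near $x$, $u\leq\varphi$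 (resp. $u\geq\varphi$) near $x$ and $u(x)=\varphi(x)$. $h\in C(\Omega)$ is an admissible solution of $\mathfrak{g}(D^2h)=f$ on $\Omega$ if for all $x\in\Omega$: (i) every $(r,p,A)\in J^{2,+}_xh$ satisfies $A\in\overline{\Gamma}$ and $\mathfrak{g}(A)\geq f(x)$; and (ii) every $(r,p,A)\in J^{2,-}_xh$ satisfies $A\notin\overline{\Gamma}$ or [$A\in\overline{\Gamma}$ and $\mathfrak{g}(A)\leq f(x)$]. *)

(* Defs.v *)
From HB Require Import structures.
From mathcomp Require Import all_boot all_order all_algebra.
From mathcomp Require Import complex.
From mathcomp Require Import (canonicals, coercions) mpoly.
From mathcomp Require Import all_classical all_reals all_analysis.
Import Order.TTheory GRing.Theory Num.Theory.
Import numFieldNormedType.Exports.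

Set Implicit Arguments.
Unset Strict Implicit.
Unset Printing Implicit Defensive.

Local Open Scope classical_set_scope.
Local Open Scope ring_scope.

(* Points of R^n are row vectors. The sigma-algebra on ['rV[R]_n] is generated by
   the coordinate projections, that is, it consists of the Borel sets. *)

Section measurable_rV.
Context {R : realType}.
Variable n : nat.

Let coors : 'I_n -> 'rV[R]_n -> measurableTypeR R := fun i x => x ord0 i.

Let rV_set0 : g_sigma_preimage coors set0.
Proof. exact: sigma_algebra0. Qed.

Let rV_setC A : g_sigma_preimage coors A -> g_sigma_preimage coors (~` A).
Proof. exact: sigma_algebraC. Qed.

Let rV_bigcup (F : _^nat) : (forall i, g_sigma_preimage coors (F i)) ->
  g_sigma_preimage coors (\bigcup_i (F i)).
Proof. exact: sigma_algebra_bigcup. Qed.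

HB.instance Definition _ := @isMeasurable.Build default_measure_display
  'rV[R]_n (g_sigma_preimage coors) rV_set0 rV_setC rV_bigcup.

End measurable_rV.

Section lebesgue_rV.
Context {R : realType}.
Local Notation RR := (measurableTypeR R).

Lemma measurable_coord n (i : 'I_n) :
  measurable_fun [set: 'rV[R]_n] (fun x : 'rV[R]_n => x ord0 i : RR).
Proof.
move=> _ Y mY; rewrite setTI; apply: sub_sigma_algebra => /=.
rewrite -bigcup_seq/=; exists i => /=; first by rewrite mem_index_enum.
by exists Y => //; rewrite setTI.
Qed.

Lemma measurable_fun_rVP d (T : measurableType d) n (f : T -> 'rV[R]_n) :
  measurable_fun [set: T] f <->
  forall i, measurable_fun [set: T] (fun t => f t ord0 i : RR).
Proof.
split=> [mf i|mf].
  exact: (measurableT_comp (measurable_coord i) mf).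
have : g_sigma_preimage (fun i t => f t ord0 i : RR) `<=` measurable.
  apply: smallest_sub; first exact: sigma_algebra_measurable.
  case: n f mf => [|n] f mf; first by rewrite big_ord0.
  rewrite -bigcup_mkord_ord; apply: bigcup_sub => i Ii.
  by move=> A [B mB <-]; exact: mf.
have -> : (fun i t => f t ord0 i : RR) =
    (fun i => (fun x : 'rV[R]_n => x ord0 i : RR) \o f) by [].
rewrite g_sigma_preimage_comp => sub _ Y mY.
by apply: sub; exists Y.
Qed.

Definition consrV n (p : RR * 'rV[R]_n) : 'rV[R]_(1 + n) := row_mx p.1%:M p.2.

Lemma measurable_consrV n : measurable_fun [set: RR * 'rV[R]_n] (@consrV n).
Proof.
apply/measurable_fun_rVP => i.
rewrite /consrV; case: (split_ordP i) => j ->.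
  rewrite (_ : (fun _ => _) = fst) //.
  by apply/funext => t; rewrite row_mxEl !mxE !ord1 eqxx mulr1n.
rewrite (_ : (fun _ => _) = (fun x : 'rV[R]_n => x ord0 j : RR) \o snd); last first.
  by apply/funext => t; rewrite row_mxEr.
exact: measurableT_comp (measurable_coord j) measurable_snd.
Qed.

Section step.
Variables (n : nat) (mu : {sigma_finite_measure set 'rV[R]_n -> \bar R}).

Definition leb_step : set 'rV[R]_(1 + n) -> \bar R :=
  pushforward ((@lebesgue_measure R) \x mu)%E (@consrV n).

Let leb_step0 : leb_step set0 = 0%E.
Proof. by rewrite /leb_step /pushforward preimage_set0 measure0. Qed.

Let leb_step_ge0 A : (0 <= leb_step A)%E.
Proof. by rewrite /leb_step /pushforward measure_ge0. Qed.

Let mpre (A : set 'rV[R]_(1 + n)) : measurable A -> measurable (@consrV n @^-1` A).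
Proof. by move=> mA; rewrite -[X in measurable X]setTI; exact: measurable_consrV. Qed.

Let leb_step_sigma_additive : semi_sigma_additive leb_step.
Proof.
move=> F mF tF mUF; rewrite /leb_step /pushforward preimage_bigcup.
apply: measure_semi_sigma_additive.
- by move=> k; exact: mpre.
- apply/trivIsetP => /= i j _ _ ij; rewrite -preimage_setI.
  by move/trivIsetP : tF => /(_ _ _ _ _ ij) ->//; rewrite preimage_set0.
- by rewrite -preimage_bigcup; exact: mpre.
Qed.

HB.instance Definition _ := isMeasure.Build _ _ _ leb_step
  leb_step0 leb_step_ge0 leb_step_sigma_additive.

Let unconsrV (x : 'rV[R]_(1 + n)) : RR * 'rV[R]_n := (lsubmx x ord0 ord0, rsubmx x).

Let measurable_unconsrV : measurable_fun setT unconsrV.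
Proof.
apply/measurable_fun_pairP; split.
  rewrite (_ : _ \o _ = fun x : 'rV[R]_(1 + n) => x ord0 (lshift n ord0) : RR).
    exact: measurable_coord.
  by apply/funext => x /=; rewrite mxE.
apply/measurable_fun_rVP => i.
rewrite (_ : (fun _ => _) = fun x : 'rV[R]_(1 + n) => x ord0 (rshift 1 i) : RR).
  exact: measurable_coord.
by apply/funext => x /=; rewrite mxE.
Qed.

Let consrVK : cancel (@consrV n) unconsrV.
Proof.
by case=> a v; rewrite /unconsrV /consrV row_mxKl row_mxKr mxE eqxx mulr1n.
Qed.

(* The library's canonical sigma-finite structure on [_ \x _] only fires for
   subprobabilities, hence this direct proof. *)
Let prod_sigma_finite : sigma_finite setT ((@lebesgue_measure R) \x mu)%E.
Proof.
have /sigma_finiteP[F [TF ndF Foo]] := sigma_finiteT (@lebesgue_measure R).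
have /sigma_finiteP[G [TG ndG Goo]] := sigma_finiteT mu.
exists (fun k => F k `*` G k).
  rewrite -setXTT TF TG predeqE => -[x y]; split.
    move=> [/= [i _ Fix_] [k _ Gky]]; exists (maxn i k) => //; split.
    - by move: x Fix_; exact/subsetPset/ndF/leq_maxl.
    - by move: y Gky; exact/subsetPset/ndG/leq_maxr.
  by move=> [k _ []/= ? ?]; split; exists k.
move=> k; have [? ?] := Foo k; have [? ?] := Goo k.
split; first exact: measurableX.
by rewrite product_measure1E// lte_mul_pinfty// ge0_fin_numE.
Qed.

Let leb_step_sigma_finite : sigma_finite setT leb_step.
Proof.
have [F TF Foo] := prod_sigma_finite.
exists (fun k => unconsrV @^-1` F k).
  by rewrite -preimage_bigcup -TF preimage_setT.
move=> k; have [mF Fk] := Foo k; split.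
  by rewrite -[X in measurable X]setTI; exact: measurable_unconsrV.
rewrite /leb_step /pushforward -comp_preimage.
by rewrite (_ : unconsrV \o _ = id) ?preimage_id//; apply/funext => p /=; rewrite consrVK.
Qed.

HB.instance Definition _ := Measure_isSigmaFinite.Build _ _ _ leb_step
  leb_step_sigma_finite.

End step.

(* n-dimensional Lebesgue measure, by iterating the product with the
   one-dimensional one. *)
Fixpoint leb (n : nat) : {sigma_finite_measure set 'rV[R]_n -> \bar R} :=
  if n is m.+1 then leb_step (leb m) else dirac (0 : 'rV[R]_0).

End lebesgue_rV.

Section euclidean.
Context {R : realType} {n : nat}.
Implicit Types (x y v : 'rV[R]_n) (E : set 'rV[R]_n).

Definition dotp x y : R := \sum_i x ord0 i * y ord0 i.

(* The library's norm on ['rV[R]_n] is the sup norm, which induces the same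
   topology. *)
Definition enorm x : R := Num.sqrt (dotp x x).

Definition diam E : R := sup [set enorm (x - y) | x in E & y in E].

Definition unit_ball : set 'rV[R]_n := [set x | enorm x < 1].

Definition bdry E : set 'rV[R]_n := closure E `\` interior E.

(* [sup] and [inf] are real-valued and only meaningful where [h] is bounded;
   this holds on a bounded [E] when [h] is continuous on [closure E]. *)
Definition osc E (h : 'rV[R]_n -> R) : R := sup (h @` E) - inf (h @` E).

Definition partial (i : 'I_n) (u : 'rV[R]_n -> R) : 'rV[R]_n -> R :=
  fun x => 'D_(delta_mx ord0 i) u x.

Definition grad (u : 'rV[R]_n -> R) x : 'rV[R]_n := \row_i partial i u x.

Definition hess (u : 'rV[R]_n -> R) x : 'M[R]_n :=
  \matrix_(i, j) partial i (partial j u) x.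

Definition quadf (A : 'M[R]_n) v : R := (v *m A *m v^T) ord0 ord0.

(* Local C^{1,1} regularity: differentiable with locally Lipschitz gradient. *)
Definition C11 (Omega : set 'rV[R]_n) (u : 'rV[R]_n -> R) : Prop :=
  (forall x, Omega x -> differentiable u x) /\
  (forall x, Omega x ->
     exists2 U, nbhs x U & [lipschitz grad u y | y in U]).

Definition C2_near (u : 'rV[R]_n -> R) x : Prop :=
  \forall y \near x,
    [/\ differentiable u y,
        forall i, differentiable (partial i u) y &
        forall i j, {for y, continuous (partial i (partial j u))}].

Definition upper_contact_set (Omega : set 'rV[R]_n) (u : 'rV[R]_n -> R)
    : set 'rV[R]_n :=
  [set x | Omega x /\ exists p : 'rV[R]_n,
     forall y, Omega y -> u y <= u x + dotp p (y - x)].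

Definition sym : set 'M[R]_n := [set A | A^T = A].

(* Second order Taylor expansion at [x] with error o(|y - x|^2); the values of
   [u] outside the open set [Omega] do not matter. *)
Definition Diff2 (Omega : set 'rV[R]_n) (u : 'rV[R]_n -> R) : set 'rV[R]_n :=
  [set x | Omega x /\ exists p : 'rV[R]_n, exists2 A, sym A &
     forall e : R, 0 < e -> \forall y \near x,
       `|u y - (u x + dotp p (y - x) + quadf A (y - x) / 2)|
         <= e * enorm (y - x) ^+ 2].

(* Since [Omega] is open, comparing [u] with [phi] on a neighbourhood of a point
   of [Omega] does not involve the values of [u] outside [Omega]. *)
Definition upper_jet (u : 'rV[R]_n -> R) x : set (R * 'rV[R]_n * 'M[R]_n) :=
  [set j | exists phi : 'rV[R]_n -> R,
     [/\ C2_near phi x, \forall y \near x, u y <= phi y, u x = phi x &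
         j = (phi x, grad phi x, hess phi x)]].

Definition lower_jet (u : 'rV[R]_n -> R) x : set (R * 'rV[R]_n * 'M[R]_n) :=
  [set j | exists phi : 'rV[R]_n -> R,
     [/\ C2_near phi x, \forall y \near x, phi y <= u y, u x = phi x &
         j = (phi x, grad phi x, hess phi x)]].

Definition posdef : set 'M[R]_n :=
  [set A | sym A /\ forall v, v != 0 -> 0 < quadf A v].

End euclidean.

(* A polynomial on S(n) is the restriction to symmetric matrices of a polynomial
   in the n * n entries; only its values on symmetric matrices are used. *)

Section garding.
Context {R : realType} {n : nat}.
Local Notation mpolyS := (mpoly.mpoly (n * n) R).
Implicit Types (g : mpolyS) (A B G : 'M[R]_n).

Definition evalS g A : R := mpoly.meval (fun k => mxvec A ord0 k) g.

(* The univariate polynomial [t |-> g(t I + A)]. *)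
Definition lineS g A : {poly R} :=
  mpoly.mmap polyC (fun k => mxvec ('X%:M + map_mx polyC A) ord0 k) g.

Lemma lineSE g A t : (lineS g A).[t] = evalS g (t%:M + A).
Proof.
rewrite /lineS /evalS /mpoly.meval /mpoly.mmap horner_sum; apply: eq_bigr => m _.
rewrite hornerM hornerC; congr (_ * _).
rewrite /mpoly.mmap1 horner_prod; apply: eq_bigr => k _.
rewrite horner_exp; congr (_ ^+ _).
by case/mxvec_indexP: k => i j; rewrite !mxvecE !mxE hornerD hornerC hornerMn hornerX.
Qed.

Definition only_real_roots (p : {poly R}) : Prop :=
  forall z : R[i],
    root (map_poly (real_complex R) p) z -> complex.Im z = 0.

(* Connectedness of a subset of S(n) does not depend on the ambient space, and
   S(n) is closed, so that components and closures may be taken in ['M[R]_n]. *)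
Definition garding_cone g : set 'M[R]_n :=
  connected_component [set A | sym A /\ evalS g A != 0] 1%:M.

(* [G] is the gradient of [g] at [A] in S(n) for the inner product
   [<A, B> = \tr (A *m B)]. *)
Definition is_gradient g A G : Prop :=
  sym G /\ forall B, sym B -> is_derive A B (evalS g) (\tr (G *m B)).

Record central_GD (N : nat) g : Prop := CentralGD {
  GD_homog : g \is mpoly.ishomog1 N (@mpoly.mdeg (n * n)) ;
  GD_real : forall A, sym A -> only_real_roots (lineS g A) ;
  GD_normalized : 0 < evalS g 1%:M ;
  GD_cone : posdef `<=` garding_cone g ;
  GD_central : exists2 k : R, 0 < k & is_gradient g 1%:M k%:M }.

Definition admissible_solution g (f : 'rV[R]_n -> R) (Omega : set 'rV[R]_n)
    (h : 'rV[R]_n -> R) : Prop :=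
  {in Omega, continuous h} /\
  forall x, Omega x ->
    (forall r p A, upper_jet h x (r, p, A) ->
       closure (garding_cone g) A /\ f x <= evalS g A) /\
    (forall r p A, lower_jet h x (r, p, A) ->
       ~ closure (garding_cone g) A \/
       (closure (garding_cone g) A /\ evalS g A <= f x)).

End garding.

(* Main.v *)
Require Import Defs.
From HB Require Import structures.
From mathcomp Require Import all_boot all_order all_algebra.
From mathcomp Require Import complex.
From mathcomp Require Import (canonicals, coercions) mpoly.
From mathcomp Require Import all_classical all_reals all_analysis.
From mathcomp Require Import measurable_realfun ring lra.
Import Order.TTheory GRing.Theory Num.Theory.
Import numFieldNormedType.Exports.

Local Open Scope classical_set_scope.
Local Open Scope ring_scope.

Set Implicit Arguments.
Unset Strict Implicit.
Unset Printing Implicit Defensive.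

(** The proof is the Aleksandrov-Bakelman-Pucci argument, with the Garding
    polynomial compared with the determinant.

    Upper part.  sup h is attained on the boundary ([maximum_principle]): at an
    interior maximum of h + e |x|^2 the negative multiple - 2 e I of the identity
    would be the Hessian of an upper jet, but no such matrix is in the closure
    of the Garding cone ([garding_cone_closure]).

    Lower part.  Let h be smaller at x0 than on the boundary, by an amount M0.  If
    |q| < M0 / diam Omega, then h - q . (x - x0) has an interior minimum, so that
    q is the gradient of h at a point where h lies above its tangent plane
    ([slope_attained]).  Hence the gradient map sends the compact set K of such
    points onto a set containing the ball of radius r, for each r < M0 / diam
    Omega.  The gradient is locally Lipschitz: at almost every point of K it is
    differentiable ([rademacher], [ae_derivative_mx]), its derivative A is
    symmetric ([derivative_mx_sym]) and nonnegative ([contact_psd]), and h has A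
    as its second order Taylor coefficient ([taylor2]), so that the point is in E.
    The area formula ([area_inequality]) bounds r^n |B_1| by the integral of det A
    over K.  Finally, if A > 0, quadratic forms slightly below A touch h from
    below, so that g(A) <= f by admissibility, and det A <= (f / g(I))^(n/N)
    by the inequality

        g(I) (det A)^(N/n) <= g(A)   for A > 0   ([garding_majorization]).

    The majorization is obtained in an orthonormal basis of eigenvectors of A.
    The restriction P of g to matrices diagonal in this basis is hyperbolic and
    positive on the open positive orthant.  Such a polynomial has nonnegative
    coefficients ([hyperbolic_coeff_ge0]): it does not vanish on the tube over the
    orthant ([tube_nonvanishing]), hence neither do its directional derivatives,
    which are therefore again hyperbolic and positive.  As D_I g is a
    multiple of the identity, the partial derivatives of P at (1, ..., 1) are
    equal, and the weighted arithmetic-geometric mean inequality with the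
    coefficients of P as weights gives the result.

    The two facts about the location of roots come from a single continuity
    argument, [root_confinement].  As E may fail to be measurable, the integral
    over E is compared with one over a Borel subset by monotonicity
    ([le_integralT]). *)

(** * Almost everywhere derivability of Lipschitz functions of one variable *)

(** Adding L x makes F nondecreasing, hence the distribution function of a
    Stieltjes measure.  That measure has at most 2 L times the length of
    intervals, so it has a density, and the fundamental theorem of calculus for
    Lebesgue integrals applies. *)
Lemma lipschitz_ae_derivable (R : realType) (F : R -> R) (L : R) :
  (forall x y, `|F x - F y| <= L * `|x - y|) ->
  {ae (@lebesgue_measure R), forall x, exists b : R, forall e : R, 0 < e ->
     exists2 d : R, 0 < d & forall t, `|t| < d ->
       `|F (x + t) - F x - b * t| <= e * `|t|}.
Proof.
move=> lipF.
have L0 : 0 <= L.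
  by have := lipF 1 0; rewrite subr0 normr1 mulr1; apply: le_trans.
pose G x := F x + L * x.
have G_incr x y : x <= y -> 0 <= G y - G x <= 2 * L * (y - x).
  move=> xy; have := lipF y x; rewrite (ger0_norm (_ : 0 <= y - x)) ?subr_ge0//.
  by rewrite ler_norml => /andP[]; rewrite /G; lra.
have G_nd : nondecreasing G by move=> x y /G_incr /andP[+ _]; rewrite subr_ge0.
have G_cont : continuous G.
  move=> x; apply: cvgD; last by apply: cvgM; [exact: cvg_cst|exact: cvg_id].
  apply/cvgrPdist_le => e e0; near=> y.
  rewrite (le_trans (lipF _ _))//.
  have : `|x - y| <= e / (L + 1).
    near: y; apply: (@cvgr_dist_le _ _ _ _ _ id) => //.
    by rewrite divr_gt0// ltr_pwDr.
  move=> /(ler_wpM2l L0) /le_trans; apply.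
  by rewrite mulrCA ger_pMr// ler_pdivrMr ?mul1r ?lerDl// ltr_pwDr.
have G_rc : right_continuous G.
  by move=> x; apply: cvg_within_filter; exact: G_cont.
pose GC : cumulative R R := HB.pack G (isCumulative.Build R _ R G G_nd G_rc).
pose nu := lebesgue_stieltjes_measure GC.
have nuE (a b : R) : a <= b -> nu `]a, b]%classic = (G b - G a)%:E.
  move=> ab; rewrite /nu /lebesgue_stieltjes_measure /measure_extension/=.
  have /= -> := @measurable_mu_extE _ _ _ (wlength GC) `]a, b]%classic (is_ocitv a b).
  by rewrite wlength_itv_bnd.
have nu_dom : nu `<< (@lebesgue_measure R).
  apply/null_content_dominatesP => A mA A0.
  apply/eqP; rewrite eq_le measure_ge0 andbT.
  apply/lee_addgt0Pr => e e0; rewrite add0e.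
  have L1 : 0 < 2 * L + 1 by rewrite ltr_wpDl// mulr_ge0.
  have : ((@lebesgue_measure R) A < (e / (2 * L + 1))%:E)%E.
    by rewrite A0 lte_fin divr_gt0.
  move=> /ereal_inf_lt[_ [B [mB AB] <-] sB].
  apply: (@le_trans _ _ (\sum_(k <oo) wlength GC (B k))%E).
    by apply: ereal_inf_lbound; exists B.
  have le_w X : ocitv X -> (wlength GC X <= (2 * L + 1)%:E * wlength idfun X)%E.
    case/ocitvP => [->|[[a b] /= ab ->]]; first by rewrite !wlength0 mule0.
    rewrite !wlength_itv_bnd ?(ltW ab)// -EFinM lee_fin.
    by have /andP[_] := G_incr _ _ (ltW ab); rewrite /idfun; move: (G b) (G a) => u v; lra.
  apply: (@le_trans _ _ (\sum_(k <oo) (2 * L + 1)%:E * wlength idfun (B k))%E).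
    apply: lee_nneseries => [k _ _|k _]; first exact: (wlength_ge0 GC).
    by apply: le_w; exact: mB.
  rewrite nneseriesZl; last by move=> k _; exact: (@wlength_ge0 R idfun).
  rewrite -lee_pdivlMl// -EFinM mulrC; exact: ltW.
(* Radon-Nikodym for the restriction of nu to a bounded interval *)
have main (k : R) : 0 < k ->
    {ae (@lebesgue_measure R), forall x, - k < x < k ->
     exists b : R, forall e : R, 0 < e ->
     exists2 d : R, 0 < d & forall t, `|t| < d ->
       `|F (x + t) - F x - b * t| <= e * `|t|}.
  move=> k0.
  have mk : measurable (`]- k, k]%classic : set (measurableTypeR R)).
    exact: (measurable_itv `]- k, k]).
  have fk : (nu `](- k)%R, k%R]%classic < +oo)%E.
    by rewrite nuE ?ltry//; lra.
  pose nuk : {finite_measure set (measurableTypeR R) -> \bar R} := mfrestr mk fk.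
  have nuk_dom : nuk `<< (@lebesgue_measure R).
    apply/null_content_dominatesP => A mA A0.
    move/null_content_dominatesP : nu_dom => /(_ (A `&` `]-k, k]%classic)).
    rewrite /nuk /= /mfrestr /mrestr; apply; first exact: measurableI.
    by apply: (subset_measure0 _ mA _ A0); [exact: measurableI|].
  have [g [g0 gfin gint gE]] := radon_nikodym_sigma_finite nuk_dom.
  pose g' := fine \o g.
  have g'E : EFin \o g' = g by apply/funext => x /=; rewrite fineK.
  have Gk x : -k <= x <= k ->
      (\int[lebesgue_measure]_(t in `]- k, x]) g' t)%R = G x - G (- k).
    move=> /andP[kx xk].
    rewrite /Rintegral.
    have -> : (fun t => (g' t)%:E) = g by rewrite -g'E.
    rewrite -gE; last exact: (measurable_itv `]- k, x]).
    rewrite /nuk /= /mfrestr /mrestr setIidl; first by rewrite -/nu nuE.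
    by move=> y /=; rewrite !in_itv/= => /andP[-> /le_trans]; apply.
  have gint' : (@lebesgue_measure R).-integrable setT (EFin \o g').
    by rewrite g'E.
  have intg y : (@lebesgue_measure R).-integrable
      [set` Interval (BRight (- k)) (BRight y)] (EFin \o g').
    by apply: integrableS gint' => //; exact: measurable_itv.
  have locg : locally_integrable [set: R] g'.
    exact: open_integrable_locally openT gint'.
  have := FTC1 intg locg.
  apply: (@filterS _ _ (ae_filter_ringOfSetsType lebesgue_measure)) => x /= + /andP[kx xk].
  rewrite lte_fin => /(_ kx)[].
  set Phi := (fun x0 => _) => dPhi _.
  exists ('D_1 Phi x - L) => e e0.
  move/cvgrPdist_le : dPhi => /(_ _ e0).
  move=> /nbhs_ballP[d /= d0 dP].
  exists (Num.min d (Num.min (x + k) (k - x))).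
    by rewrite !lt_min d0/=; apply/andP; split; lra.
  move=> t; rewrite !lt_min => /and3P[td tx tk].
  have [->|t0] := eqVneq t 0; first by rewrite addr0 mulr0 !subr0 subrr normr0 mulr0.
  have PhiE y : - k <= y <= k -> Phi y = G y - G (- k) by exact: Gk.
  have := dP t; rewrite /ball/= sub0r normrN => /(_ td t0).
  rewrite -[lim _]/('D_1 Phi x); move: ('D_1 Phi x) => D.
  rewrite !PhiE; first last.
  - by rewrite /GRing.scale/= mulr1; move: tx tk; rewrite !ltr_norml; lra.
  - by lra.
  rewrite /GRing.scale/= mulr1 (addrC t) /G => h.
  have t0' : 0 < `|t| by rewrite normr_gt0.
  have -> : F (x + t) - F x - (D - L) * t =
     - (D - t^-1 * (F (x + t) + L * (x + t) - (F (- k) + L * - k) -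
                  (F x + L * x - (F (- k) + L * - k)))) * t.
    by field.
  by rewrite normrM normrN ler_pM2r.
have : {ae (@lebesgue_measure R), forall x, forall n : nat, - n.+1%:R < x < n.+1%:R ->
     exists b : R, forall e : R, 0 < e ->
     exists2 d : R, 0 < d & forall t, `|t| < d ->
       `|F (x + t) - F x - b * t| <= e * `|t|}.
  by apply/ae_foralln => n; exact: main.
apply: (@filterS _ _ (ae_filter_ringOfSetsType lebesgue_measure)) => x.
move=> /(_ (Num.bound `|x|)); apply.
rewrite -ltr_norml; apply: (lt_trans (archi_boundP (normr_ge0 x))).
by rewrite ltr_nat.
Unshelve. all: by end_near. Qed.

(** * Lebesgue measure on row vectors *)

Local Notation RR R := (measurableTypeR R).

Lemma lebesgue_measure_affine (R : realType) (a c : R) (A : set (RR R)) :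
  0 < a -> measurable A ->
  (a%:E * (@lebesgue_measure R) [set s | A (a * s + c)%R] = lebesgue_measure A)%E.
Proof.
move=> a0 mA.
have mf : measurable_fun [set: RR R] (fun s : RR R => a * s + c : RR R).
  by apply: measurable_funD => //; exact: measurable_funM.
pose P : {measure set (RR R) -> \bar R} :=
  pushforward (@lebesgue_measure R) (fun s : RR R => a * s + c : RR R).
pose Q : {measure set (RR R) -> \bar R} := mscale (NngNum (ltW a0)) (P mf).
apply/esym; rewrite (lebesgue_measure_unique (mu := Q))// => X /ocitvP[->|].
  by rewrite !measure0.
move=> [[p q] /= pq ->].
rewrite /Q /= /mscale /= /P /pushforward.
have -> : (fun s => a * s + c) @^-1` `]p, q]%classic = `](p - c) / a, (q - c) / a]%classic.
  apply/seteqP; split => s /=; rewrite !in_itv/= ltr_pdivrMr// ler_pdivlMr//;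
    by rewrite ltrBlDr lerBrDr mulrC.
rewrite !lebesgue_measure_itv/= !lte_fin ltr_pM2r ?invr_gt0// ltrD2r pq.
by rewrite -!EFinB -EFinM; congr (_%:E); field; rewrite gt_eqF.
Qed.

Section Fubini.
Context {R : realType} {n : nat}.
Local Notation lambda := (@lebesgue_measure R).
Implicit Types (A : set 'rV[R]_(1 + n)).

Lemma measurable_consrV_preimage A : measurable A ->
  measurable ((@consrV R n) @^-1` A).
Proof. by move=> mA; rewrite -[X in measurable X]setTI; exact: measurable_consrV. Qed.

Lemma measurable_slice1 A (s : R) : measurable A ->
  measurable [set x : 'rV[R]_n | A (consrV (s : RR R, x))].
Proof.
move=> /measurable_consrV_preimage /(@measurable_xsection _ _ _ _ _ s).
by rewrite xsectionE.
Qed.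

Lemma measurable_slice2 A (x : 'rV[R]_n) : measurable A ->
  measurable [set s : RR R | A (consrV (s, x))].
Proof.
move=> /measurable_consrV_preimage /(@measurable_ysection _ _ _ _ _ x).
by rewrite ysectionE.
Qed.

Lemma measurable_fun_slice1 A : measurable A ->
  measurable_fun [set: RR R] (fun s => leb n [set x | A (consrV (s, x))]).
Proof.
move=> /measurable_consrV_preimage /(measurable_fun_xsection (leb n)).
by congr measurable_fun; apply/funext => s /=; rewrite xsectionE.
Qed.

Lemma measurable_fun_slice2 A : measurable A ->
  measurable_fun [set: 'rV[R]_n] (fun x => lambda [set s : RR R | A (consrV (s, x))]).
Proof.
move=> /measurable_consrV_preimage /(measurable_fun_ysection lambda).
by congr measurable_fun; apply/funext => s /=; rewrite ysectionE.
Qed.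

(** The measure being an iterated product, it can be sliced along the first
    coordinate or along the remaining ones; both orders of integration occur in
    the inductions on the dimension. *)
Lemma leb_slice1 A : measurable A ->
  leb (1 + n) A = (\int[lambda]_s leb n [set x | A (consrV (s, x))])%E.
Proof.
move=> mA; rewrite [LHS]/= /leb_step /pushforward /product_measure1 /=.
by apply: eq_integral => s _; rewrite /= xsectionE.
Qed.

Lemma leb_slice2 A : measurable A ->
  leb (1 + n) A = (\int[leb n]_x lambda [set s : RR R | A (consrV (s, x))])%E.
Proof.
move=> mA; rewrite [LHS]/= /leb_step /pushforward.
rewrite (product_measure_unique (m' := (lambda \x^ leb n)%E))//.
- by rewrite /product_measure2 /=; apply: eq_integral => s _; rewrite /= ysectionE.
- by move=> X Y mX mY; exact: product_measure2E.
- exact: measurable_consrV_preimage.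
Qed.

Lemma consrVD (s t : R) (x y : 'rV[R]_n) :
  consrV (s : RR R, x) + consrV (t : RR R, y) = consrV (s + t : RR R, x + y).
Proof. by rewrite /consrV add_row_mx raddfD. Qed.

End Fubini.

Lemma integral_affine (R : realType) (a c : R) (phi : RR R -> \bar R) :
  0 < a -> measurable_fun setT phi -> (forall s, 0 <= phi s)%E ->
  (a%:E * \int[@lebesgue_measure R]_s phi (a * s + c)%R =
   \int[@lebesgue_measure R]_s phi s)%E.
Proof.
move=> a0 mphi phi0.
have mf : measurable_fun [set: RR R] (fun s : RR R => a * s + c : RR R).
  by apply: measurable_funD => //; exact: measurable_funM.
pose P : {measure set (RR R) -> \bar R} :=
  pushforward (@lebesgue_measure R) (fun s : RR R => a * s + c : RR R).
pose Q : {measure set (RR R) -> \bar R} := mscale (NngNum (ltW a0)) (P mf).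
transitivity (\int[Q]_s phi s)%E.
  rewrite ge0_integral_mscale//=; congr (_ * _)%E.
  by rewrite /P ge0_integral_pushforward// preimage_setT.
apply: eq_measure_integral => A mA _.
by rewrite /Q /= /mscale /= /P /pushforward lebesgue_measure_affine.
Qed.

Section Lebesgue_rV.
Context {R : realType}.

Lemma consrV_surj n (x : 'rV[R]_(1 + n)) :
  x = consrV (lsubmx x ord0 ord0 : RR R, rsubmx x).
Proof.
by rewrite /consrV/= -[LHS]hsubmxK; congr row_mx; rewrite [LHS]mx11_scalar.
Qed.

Lemma measurable_affine n m (M : 'M[R]_(n, m)) (c : 'rV[R]_m) :
  measurable_fun setT (fun x : 'rV[R]_n => x *m M + c).
Proof.
apply/measurable_fun_rVP => i.
rewrite (_ : (fun _ => _) =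
    (fun x : 'rV[R]_n => \sum_j (x ord0 j * M j i) + c ord0 i : RR R)); last first.
  by apply/funext => x; rewrite !mxE.
apply: measurable_funD => //; apply: measurable_sum => j.
by apply: measurable_funM => //; exact: measurable_coord.
Qed.

Lemma measurable_affine_preimage n m (M : 'M[R]_(n, m)) (c : 'rV[R]_m)
    (A : set 'rV[R]_m) : measurable A -> measurable [set x | A (x *m M + c)].
Proof.
by move=> mA; rewrite -[X in measurable X]setTI; exact: measurable_affine.
Qed.

Lemma leb_translate n (c : 'rV[R]_n) (A : set 'rV[R]_n) : measurable A ->
  leb n [set x | A (x + c)] = leb n A.
Proof.
elim: n c A => [|n IHn] c A mA.
  by congr (leb 0 _); apply/seteqP; split => x /=; rewrite (thinmx0 (x + c)) (thinmx0 x).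
have mAc : measurable [set x | A (x + c)].
  have := measurable_affine_preimage 1%:M c mA.
  by congr measurable; apply/seteqP; split => x /=; rewrite mulmx1.
move: (mA) (mAc) => mA' mAc'.
rewrite -(addn1 n) addnC in c A mA mA' mAc mAc' *.
rewrite (leb_slice1 mAc) (leb_slice1 mA).
rewrite -[RHS](@integral_affine _ 1 (lsubmx c ord0 ord0)) ?mul1e//; last exact: measurable_fun_slice1.
apply: eq_integral => s _; rewrite mul1r.
rewrite -[RHS](IHn (rsubmx c)); last exact: measurable_slice1.
have cE (x : 'rV[R]_n) : consrV (s : RR R, x) + c =
    consrV (s + lsubmx c ord0 ord0 : RR R, x + rsubmx c).
  by rewrite -consrVD -consrV_surj.
by congr (leb n _); apply/seteqP; split => x /=; rewrite cE.
Qed.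

(** The three factors of the block LDL^T decomposition: unipotent ones preserve
    the measure, since they translate slices. *)
Lemma leb_shear_right n (r : 'rV[R]_n) (A : set 'rV[R]_(1 + n)) : measurable A ->
  leb (1 + n) [set x | A (x *m block_mx 1%:M r 0 1%:M)] = leb (1 + n) A.
Proof.
move=> mA.
have mA' : measurable [set x | A (x *m block_mx 1%:M r 0 1%:M)].
  have := measurable_affine_preimage (block_mx 1%:M r 0 1%:M) 0 mA.
  by congr measurable; apply/seteqP; split => x /=; rewrite addr0.
rewrite (leb_slice1 mA) (leb_slice1 mA').
apply: eq_integral => s _.
rewrite -[RHS](leb_translate (s *: r)); last exact: measurable_slice1.
congr (leb n _); apply/seteqP; split => x /=;
 by rewrite /consrV mul_row_block/= mulmx0 mulmx1 addr0 mul_scalar_mx mulmx1 addrC.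
Qed.

Lemma leb_shear_left n (r : 'cV[R]_n) (A : set 'rV[R]_(1 + n)) : measurable A ->
  leb (1 + n) [set x | A (x *m block_mx 1%:M 0 r 1%:M)] = leb (1 + n) A.
Proof.
move=> mA.
have mA' : measurable [set x | A (x *m block_mx 1%:M 0 r 1%:M)].
  have := measurable_affine_preimage (block_mx 1%:M 0 r 1%:M) 0 mA.
  by congr measurable; apply/seteqP; split => x /=; rewrite addr0.
rewrite (leb_slice2 mA) (leb_slice2 mA').
apply: eq_integral => x _.
have := @lebesgue_measure_affine R 1 ((x *m r) ord0 ord0) _ ltr01 (measurable_slice2 x mA).
rewrite mul1e => <-.
have E (s : RR R) : consrV (s, x) *m block_mx 1%:M 0 r 1%:M =
    consrV (s + (x *m r) ord0 ord0 : RR R, x).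
  rewrite /consrV mul_row_block/= mulmx0 !mulmx1 add0r.
  by rewrite [in LHS](mx11_scalar (x *m r)) -raddfD.
by congr (lebesgue_measure _); apply/seteqP; split => s /=; rewrite E mul1r.
Qed.

Lemma leb_block_diag n (a : R) (S : 'M[R]_n) (A : set 'rV[R]_(1 + n)) (k : R) : 0 < a -> 0 < k ->
  (forall B : set 'rV[R]_n, measurable B -> (k%:E * leb n [set x | B (x *m S)] = leb n B)%E) ->
  measurable A ->
  ((a * k)%:E * leb (1 + n) [set x | A (x *m block_mx a%:M 0 0 S)] = leb (1 + n) A)%E.
Proof.
move=> a0 k0 HS mA.
have mA' : measurable [set x | A (x *m block_mx a%:M 0 0 S)].
  have := measurable_affine_preimage (block_mx a%:M 0 0 S) 0 mA.
  by congr measurable; apply/seteqP; split => x /=; rewrite addr0.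
rewrite (leb_slice1 mA) (leb_slice1 mA').
rewrite -[RHS](@integral_affine _ a 0)//; last exact: measurable_fun_slice1.
rewrite EFinM -muleA; congr (_ * _)%E.
rewrite -ge0_integralZl//; first last.
- by rewrite lee_fin ltW.
- exact: measurable_fun_slice1.
apply: eq_integral => s _.
rewrite -[RHS]HS; last exact: measurable_slice1.
have E x : consrV (s : RR R, x) *m block_mx a%:M 0 0 S =
    consrV (a * s + 0 : RR R, x *m S).
  by rewrite /consrV mul_row_block/= !mulmx0 addr0 add0r -scalar_mxM mulrC addr0.
by congr (_ * leb n _)%E; apply/seteqP; split => x /=; rewrite E.
Qed.

(** S is the Schur complement of the first diagonal entry. *)
Lemma posdef_block n (A : 'M[R]_(1 + n)) : posdef A ->
  exists (a : R) (b : 'rV[R]_n) (S : 'M[R]_n),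
    [/\ 0 < a, posdef S &
      A = block_mx 1%:M 0 b^T 1%:M *m block_mx a%:M 0 0 S *m block_mx 1%:M b 0 1%:M].
Proof.
move=> [symA posA].
pose a := A (lshift n ord0) (lshift n ord0).
have aE : ulsubmx A = a%:M by rewrite [LHS]mx11_scalar !mxE.
have bE : dlsubmx A = (ursubmx A)^T by rewrite trmx_ursub symA.
have symD : (drsubmx A)^T = drsubmx A by rewrite trmx_drsub symA.
have AE0 : A = block_mx a%:M (ursubmx A) (ursubmx A)^T (drsubmx A).
  by rewrite -aE -bE submxK.
have a0 : 0 < a.
  have := posA (row_mx 1%:M 0).
  have -> : row_mx 1%:M 0 != 0 :> 'rV[R]_(1 + n).
    by apply/eqP => /rowP /(_ (lshift n ord0)); rewrite row_mxEl !mxE eqxx => /eqP; rewrite oner_eq0.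
  move=> /(_ isT); rewrite AE0 /quadf.
  rewrite mul_row_block tr_row_mx mul_row_col !mul0mx !addr0 trmx0 mulmx0 addr0.
  by rewrite mul1mx trmx1 mulmx1 mxE eqxx.
pose b := a^-1 *: ursubmx A; pose S := drsubmx A - a *: (b^T *m b).
have AE : A = block_mx 1%:M 0 b^T 1%:M *m block_mx a%:M 0 0 S *m block_mx 1%:M b 0 1%:M.
  rewrite !mulmx_block !mul1mx !mul0mx !mulmx0 !mulmx1 !addr0 !add0r.
  rewrite [LHS]AE0 mul_scalar_mx mul_mx_scalar.
  have -> : a *: b = ursubmx A by rewrite scalerA divff ?gt_eqF// scale1r.
  have -> : a *: b^T = (ursubmx A)^T.
    by rewrite /b linearZ/= scalerA divff ?gt_eqF// scale1r.
  congr block_mx.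
  rewrite /S addrC -[(ursubmx A)^T](_ : a *: b^T = _).
    by rewrite -scalemxAl subrK.
  by rewrite /b linearZ/= scalerA divff ?gt_eqF// scale1r.
exists a, b, S; split=> //; split.
  rewrite /sym/= /S linearB/= linearZ/= trmx_mul trmxK.
  by rewrite symD.
move=> v v0.
have := posA (row_mx (- (v *m b^T)) v).
have -> : row_mx (- (v *m b^T)) v != 0 :> 'rV[R]_(1 + n).
  apply: contra v0 => /eqP/rowP h; apply/eqP/rowP => i.
  by have := h (rshift 1 i); rewrite row_mxEr !mxE.
move=> /(_ isT); rewrite /quadf AE.
have -> : row_mx (- (v *m b^T)) v *m
  (block_mx 1%:M 0 b^T 1%:M *m block_mx a%:M 0 0 S *m block_mx 1%:M b 0 1%:M) =
  row_mx 0 (v *m S).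
  rewrite !mulmxA mul_row_block !mulmx1 mulmx0 addNr add0r mul_row_block.
  by rewrite !mul0mx mulmx0 !add0r mul_row_block !mul0mx mulmx0 mulmx1 !add0r.
by rewrite tr_row_mx mul_row_col mul0mx add0r.
Qed.

(** Change of variables for positive definite matrices, by induction on the
    dimension through the block LDL^T decomposition; it also yields det A > 0. *)
Lemma leb_posdef n (A : 'M[R]_n) : posdef A ->
  0 < \det A /\ forall B : set 'rV[R]_n, measurable B ->
    ((\det A)%:E * leb n [set x | B (x *m A)] = leb n B)%E.
Proof.
elim: n A => [|n IHn] A posA.
  rewrite det_mx00; split => // B mB; rewrite mul1e.
  by congr (leb 0 _); apply/seteqP; split => x /=; rewrite (thinmx0 (x *m A)) (thinmx0 x).
rewrite -(add1n n) in A posA *.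
have [a [b [S [a0 /IHn[S0 HS] AE]]]] := posdef_block posA.
have dA : \det A = a * \det S.
  by rewrite AE !det_mulmx !det_lblock !det_ublock !det1 det_scalar1; ring.
split=> [|B mB]; first by rewrite dA mulr_gt0.
rewrite dA.
pose B1 : set 'rV[R]_(1 + n) := [set x | B (x *m block_mx 1%:M b 0 1%:M)].
have mB1 : measurable B1.
  have := measurable_affine_preimage (block_mx 1%:M b 0 1%:M) 0 mB.
  by congr measurable; apply/seteqP; split => x /=; rewrite addr0.
pose B2 : set 'rV[R]_(1 + n) := [set x | B1 (x *m block_mx a%:M 0 0 S)].
have mB2 : measurable B2.
  have := measurable_affine_preimage (block_mx a%:M 0 0 S) 0 mB1.
  by congr measurable; apply/seteqP; split => x /=; rewrite addr0.
rewrite -(leb_shear_right b mB) -/B1 -(leb_block_diag a0 S0 HS mB1) -/B2.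
rewrite -(leb_shear_left b^T mB2); congr (_ * leb (1 + n) _)%E.
by apply/seteqP; split => x /=; rewrite AE !mulmxA.
Qed.

Lemma ball_rVP n (x y : 'rV[R]_n) (e : R) : 0 < e ->
  ball x e y <-> forall i, `|x ord0 i - y ord0 i| < e.
Proof.
move=> e0; split=> [[_ h] i|h]; first exact: h.
by split=> // i j; rewrite (ord1 i); exact: h.
Qed.

Lemma norm_rV_lt n (x : 'rV[R]_n) (e : R) : 0 < e ->
  `|x| < e <-> forall i, `|x ord0 i| < e.
Proof.
move=> e0; have := ball_rVP 0 x e0; rewrite -ball_normE /= sub0r normrN => ->.
by split=> h i; have := h i; rewrite !mxE sub0r normrN.
Qed.

Lemma norm_rV_le n (x : 'rV[R]_n) (e : R) : 0 <= e ->
  `|x| <= e <-> forall i, `|x ord0 i| <= e.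
Proof.
move=> e0; split=> [xe i|xe].
  apply/ler_addgt0Pr => d d0; apply/ltW; move: i; apply/norm_rV_lt.
    by rewrite ltr_wpDl.
  by rewrite (le_lt_trans xe)// ltrDl.
apply/ler_addgt0Pr => d d0; apply/ltW/norm_rV_lt; first by rewrite ltr_wpDl.
by move=> i; rewrite (le_lt_trans (xe i))// ltrDl.
Qed.

Lemma norm_coord_le n (x : 'rV[R]_n) i : `|x ord0 i| <= `|x|.
Proof. by move: i; apply/norm_rV_le. Qed.

Lemma measurable_ball_rV n (c : 'rV[R]_n) (r : R) : measurable (ball c r).
Proof.
have [r0|r0] := leP r 0; first (rewrite (_ : ball c r = set0)//;
  by apply/seteqP; split=> // x []; rewrite ltNge r0).
have -> : ball c r = \bigcap_(i in [set: 'I_n])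
    [set x : 'rV[R]_n | (`](c ord0 i - r), (c ord0 i + r)[%classic : set (RR R)) (x ord0 i)].
  apply/seteqP; split=> x.
    by move=> /(ball_rVP _ _ r0) h i _ /=; have := h i; rewrite in_itv/= distrC ltr_distl.
  by move=> h; apply/ball_rVP => // i; have := h i I; rewrite /= in_itv/= distrC ltr_distl.
apply: fin_bigcap_measurable => // i _.
rewrite -[X in measurable X]setTI; exact: measurable_coord.
Qed.

(** An open set is the countable union of the rational balls that it contains. *)
Lemma open_measurable_rV n (U : set 'rV[R]_n) : open U -> measurable U.
Proof.
move=> oU.
pose B (p : 'rV[rat]_n * nat) : set 'rV[R]_n :=
  if pselect (ball (map_mx ratr p.1 : 'rV[R]_n) (p.2.+1%:R^-1 : R) `<=` U)
  then ball (map_mx ratr p.1 : 'rV[R]_n) (p.2.+1%:R^-1) else set0.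
have -> : U = \bigcup_p B p.
  apply/seteqP; split=> [x Ux|x [p _]]; last first.
    by rewrite /B; case: pselect => // sub /sub.
  have /nbhs_ballP[e /= e0 xe] : nbhs x U by exact: open_nbhs_nbhs.
  have [k ke] : exists k : nat, (k.+1%:R^-1 : R) < e / 2.
    exists (Num.bound (e / 2)^-1).
    rewrite invf_plt ?posrE ?divr_gt0//.
    by rewrite (lt_trans (archi_boundP _))// ?ltr_nat// invr_ge0 divr_ge0// ltW.
  have k0 : 0 < (k.+1%:R^-1 : R) by rewrite invr_gt0.
  have /choice[q qP] : forall i, exists q : rat, `|ratr q - x ord0 i| < k.+1%:R^-1 :> R.
    move=> i; have := @rat_in_itvoo R (x ord0 i - k.+1%:R^-1) (x ord0 i + k.+1%:R^-1).
    rewrite ltrD2l gtrN// => /(_ isT)[q]; rewrite in_itv/= => qx; exists q.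
    by rewrite ltr_distl.
  exists (\row_i q i, k) => //; rewrite /B.
  have xB : ball (map_mx ratr (\row_i q i) : 'rV[R]_n) (k.+1%:R^-1 : R) x.
    by apply/ball_rVP => // i; rewrite !mxE.
  case: pselect => // -[] y /= yB; apply: xe.
  have := ball_triangle (ball_sym xB) yB; apply: le_ball.
  by move: (k.+1%:R^-1 : R) ke => z; lra.
apply: countable_bigcupT_measurable; first exact: countableP.
by move=> p; rewrite /B; case: pselect => [_|?] //=; exact: measurable_ball_rV.
Qed.

Lemma closed_measurable_rV n (F : set 'rV[R]_n) : closed F -> measurable F.
Proof. by move=> cF; rewrite -[F]setCK; apply: measurableC; apply: open_measurable_rV; exact: closed_openC. Qed.

Lemma compact_measurable_rV n (K : set 'rV[R]_n) : compact K -> measurable K.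
Proof. by move=> cK; apply: closed_measurable_rV; apply: compact_closed => //; exact: norm_hausdorff. Qed.

Lemma leb_ball n (c : 'rV[R]_n) (r : R) : 0 < r ->
  leb n (ball c r) = ((2 * r) ^+ n)%:E.
Proof.
move=> r0; elim: n c => [|n IHn] c.
  rewrite expr0 /= diracE (_ : _ \in _ = true)//.
  by apply/mem_set/ball_rVP => // -[].
rewrite -(add1n n) in c *.
rewrite [LHS]/= /leb_step /pushforward.
have -> : @consrV R n @^-1` ball c r =
    (ball (lsubmx c ord0 ord0) r : set (RR R)) `*` ball (rsubmx c) r.
  apply/seteqP; split=> -[s x] /=.
    move/(ball_rVP _ _ r0) => h; split=> /=.
      by have := h (lshift n ord0); rewrite /consrV row_mxEl !mxE/= mulr1n.
    by apply/ball_rVP => // i; have := h (rshift 1 i); rewrite /consrV row_mxEr !mxE.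
  move=> [h1 /(ball_rVP _ _ r0) h2]; apply/ball_rVP => // i.
  rewrite /consrV; case: (split_ordP i) => j ->.
    by rewrite row_mxEl (ord1 j); move: h1; rewrite !mxE/= mulr1n.
  by rewrite row_mxEr; have := h2 j; rewrite !mxE.
rewrite (product_measure1E _ _ _ _)//; last 2 first.
- exact: measurable_ball.
- exact: measurable_ball_rV.
have /= -> := IHn (rsubmx c).
rewrite lebesgue_measure_ball ?ltW// -EFinM; congr (_%:E).
by rewrite exprS mulr_natl.
Qed.

End Lebesgue_rV.

(** * Rademacher's theorem *)

Definition near_affine (R : realType) n (F : 'rV[R]_n -> R) (a x : 'rV[R]_n) (e d : R) :=
  forall y, `|y| < d -> `|F (x + y) - F x - dotp a y| <= e * `|y|.

(** Approximability to precision e by a rational linear form, with an explicit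
    radius: a countable union of closed sets, hence measurable. *)
Definition near_affine_pts (R : realType) n (F : 'rV[R]_n -> R) (e : R) : set 'rV[R]_n :=
  \bigcup_(p in [set: 'rV[rat]_n * nat])
    [set x | near_affine F (map_mx ratr p.1) x e p.2.+1%:R^-1].

Lemma lipschitz_continuous (R : realType) n (F : 'rV[R]_n -> R) (L : R) :
  (forall x y, `|F x - F y| <= L * `|x - y|) -> continuous F.
Proof.
move=> lipF x; apply: (@cvgrPdist_le _ _ _ (nbhs x) (nbhs_filter x) _ _).2 => e e0.
have L1 : 0 < `|L| + 1 by rewrite ltr_wpDl.
apply/nbhs_ballP; exists (e / (`|L| + 1)) => /=; first by rewrite divr_gt0.
move=> y; rewrite -ball_normE /= ltr_pdivlMr// => xy.
rewrite (le_trans (lipF _ _))// (le_trans _ (ltW xy))// mulrC ler_wpM2l//.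
by rewrite (le_trans (ler_norm _))// lerDl.
Qed.

Lemma closed_near_affine (R : realType) n (F : 'rV[R]_n -> R) m (f : 'rV[R]_m -> 'rV[R]_n) a e d :
  continuous F ->
  closed [set x | forall y, `|y| < d -> `|F (x + f y) - F x - dotp a y| <= e * `|y|].
Proof.
move=> cF.
rewrite (_ : mkset _ = \bigcap_(y in [set y | `|y| < d])
    ((fun x => `|F (x + f y) - F x - dotp a y|) @^-1` [set t | t <= e * `|y|])); last first.
  by apply/seteqP; split=> x h y /h.
apply: closed_bigI => y _.
have cFy : continuous (fun x : 'rV[R]_n => `|F (x + f y) - F x - dotp a y|).
  move=> x; have FF : Filter (nbhs x) by exact: nbhs_filter.
  apply: cvg_norm; apply: cvgB; last exact: cvg_cst.
  apply: cvgB; last exact: cF.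
  apply: continuous_comp; last exact: cF.
  by apply: cvgD; [exact: cvg_id|exact: cvg_cst].
by move/continuous_closedP : cFy; apply; exact: closed_le.
Qed.

Lemma measurable_near_affine_pts (R : realType) n (F : 'rV[R]_n -> R) e :
  continuous F -> measurable (near_affine_pts F e).
Proof.
move=> cF; apply: countable_bigcupT_measurable; first exact: countableP.
move=> p; apply: closed_measurable_rV.
exact: (@closed_near_affine _ _ F _ id (map_mx ratr p.1) e p.2.+1%:R^-1 cF).
Qed.

(** Otherwise an interval around s + t, of length comparable to t, would miss A. *)
Lemma density_close_point (R : realType) (A : set (RR R)) (s e : R) :
  measurable A -> 0 < e -> e <= 1 ->
  ((@lebesgue_measure R) (A `&` ball s r) * ((@lebesgue_measure R) (ball s r))^-1
     @[r --> 0^'+] --> 1)%E ->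
  exists2 d : R, 0 < d & forall t : R, `|t| < d -> t != 0 ->
    exists2 u, A u & `|u - (s + t)| <= e * `|t|.
Proof.
move=> mA e0 e1 dens.
have /fine_cvgP[_ /cvgrPdist_lt] := dens.
have e20 : 0 < e / 2 by rewrite divr_gt0.
move=> /(_ _ e20) /nbhs_ballP[d /= d0 dP].
exists (d / 2); first by rewrite divr_gt0.
move=> t td t0.
have t0' : 0 < `|t| by rewrite normr_gt0.
apply: contrapT => noU.
have sub : A `&` ball s (2 * `|t|) `<=` ball s (2 * `|t|) `\` ball (s + t) (e * `|t|).
  move=> u [Au su]; split=> // stu; apply: noU; exists u => //.
  by move: stu; rewrite /ball/= distrC => /ltW.
have := dP (2 * `|t|).
rewrite /ball/= sub0r normrN normrM normr_nat normr_id.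
rewrite mulr_gt0// => /(_ _ isT).
have -> : 2 * `|t| < d by lra.
move=> /(_ isT).
rewrite lebesgue_measure_ball; last by rewrite mulr_ge0.
have B0 : 0 < (2 * `|t|) *+ 2 by rewrite mulrn_wgt0// mulr_gt0.
rewrite inver gt_eqF//.
pose la : {measure set (RR R) -> \bar R} := @lebesgue_measure R.
have laB (x r : R) : 0 <= r -> la (ball x r : set (RR R)) = (r *+ 2)%:E.
  exact: lebesgue_measure_ball.
have mB (x r : R) : measurable (ball x r : set (RR R)) by exact: measurable_ball.
pose B1 : set (RR R) := ball s (2 * `|t|); pose B2 : set (RR R) := ball (s + t) (e * `|t|).
have mB1 : measurable B1 by exact: mB.
have mB2 : measurable B2 by exact: mB.
have laB1 : la B1 = ((2 * `|t|) *+ 2)%:E by apply: laB; rewrite mulr_ge0.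
have laB2 : la B2 = ((e * `|t|) *+ 2)%:E by apply: laB; rewrite mulr_ge0// ltW.
have mle : (la (A `&` B1) <= ((4 - 2 * e) * `|t|)%:E)%E.
  apply: (@le_trans _ _ (la (B1 `\` B2))).
    by apply: le_measure => //; rewrite inE;
      [exact: measurableI|exact: measurableD].
  have laD : (la (B1 `\` B2) = la B1 - la (B1 `&` B2))%E.
    by apply: measureD => //; have := ltry (2 * `|t| *+ 2); rewrite -laB1.
  rewrite laD setIidr.
    by rewrite laB1 laB2 -EFinB lee_fin !mulr2n; lra.
  move=> u; rewrite /B1 /B2 /ball/= => h.
  have -> : s - u = (s + t - u) - t by ring.
  rewrite (le_lt_trans (ler_normB _ _))//.
  have : e * `|t| <= `|t| by rewrite ler_piMl.
  lra.
have mfin : la (A `&` B1) \is a fin_num.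
  by rewrite ge0_fin_numE// (le_lt_trans mle)// ltry.
rewrite -[lebesgue_measure _]/(la (A `&` B1)) fineM//= => h.
have : fine (la (A `&` B1)) <= (4 - 2 * e) * `|t|.
  by rewrite -lee_fin fineK.
move: (fine _) h => m h mle'.
suff : m * ((2 * `|t|) *+ 2)^-1 <= 1 - e / 2.
  by move: h; rewrite ltr_norml; lra.
rewrite ler_pdivrMr//; apply: (le_trans mle'); rewrite le_eqVlt; apply/orP; left.
by apply/eqP; rewrite mulr2n; field.
Qed.

Section Rademacher.
Context {R : realType}.
Local Notation lambda := (@lebesgue_measure R).

Lemma dotp_consrV n (b t : R) (a y : 'rV[R]_n) :
  dotp (consrV (b : RR R, a)) (consrV (t : RR R, y)) = b * t + dotp a y.
Proof.
rewrite /dotp big_split_ord/= big_ord1; congr (_ + _).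
  by rewrite /consrV !row_mxEl !mxE eqxx !mulr1n.
by apply: eq_bigr => i _; rewrite /consrV !row_mxEr.
Qed.

Lemma norm_consrV_l n (t : R) (y : 'rV[R]_n) : `|t| <= `|consrV (t : RR R, y)|.
Proof.
have := norm_coord_le (consrV (t : RR R, y)) (lshift n ord0).
by rewrite /consrV row_mxEl !mxE eqxx mulr1n.
Qed.

Lemma norm_consrV_r n (t : R) (y : 'rV[R]_n) : `|y| <= `|consrV (t : RR R, y)|.
Proof.
apply/norm_rV_le => // i.
by have := norm_coord_le (consrV (t : RR R, y)) (rshift 1 i); rewrite /consrV row_mxEr.
Qed.

Lemma norm_consrV0 n (t : R) : `|consrV (t : RR R, 0 : 'rV[R]_n)| = `|t|.
Proof.
apply/eqP; rewrite eq_le norm_consrV_l andbT; apply/norm_rV_le => // i.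
rewrite /consrV; case: (split_ordP i) => j ->.
  by rewrite row_mxEl (ord1 j) !mxE eqxx mulr1n.
by rewrite row_mxEr mxE normr0.
Qed.

Lemma consrVB n (s t : R) (x y : 'rV[R]_n) :
  consrV (s : RR R, x) - consrV (t : RR R, y) = consrV (s - t : RR R, x - y).
Proof.
by apply/eqP; rewrite subr_eq consrVD !subrK.
Qed.

(** Going from (s, x) to (s + t, x + y): move in the first coordinate to s + t at
    x, then to the nearby slice u, on which the affine approximation in y is
    available with the same constants as on the slice s, and back to s + t. *)
Lemma near_affine_join n (F : 'rV[R]_(1 + n) -> R) (L e s b b' d1 : R)
    (x a : 'rV[R]_n) :
  (forall x y, `|F x - F y| <= L * `|x - y|) -> 0 < e -> 0 < d1 ->
  (exists2 d : R, 0 < d & forall t, `|t| < d -> t != 0 -> exists2 u : R,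
     near_affine (fun y => F (consrV (u : RR R, y))) a x e d1 &
     `|u - (s + t)| <= e * `|t|) ->
  near_affine (fun y => F (consrV (s : RR R, y))) a x e d1 ->
  (exists2 d : R, 0 < d & forall t, `|t| < d ->
    `|F (consrV (s + t : RR R, x)) - F (consrV (s : RR R, x)) - b * t| <= e * `|t|) ->
  `|b - b'| <= e ->
  exists2 d : R, 0 < d &
    near_affine F (consrV (b' : RR R, a)) (consrV (s : RR R, x)) ((2 * L + 3) * e) d.
Proof.
move=> lipF e0 d10 [d2 d20 close] aff [d3 d30 der] bb'.
have L0 : 0 <= L.
  have := lipF (consrV (1 : RR R, 0)) (consrV (0 : RR R, 0)).
  by rewrite consrVB !subr0 norm_consrV0 normr1 mulr1; apply: le_trans.
exists (Num.min d1 (Num.min d2 d3)); first by rewrite !lt_min d10 d20 d30.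
move=> z; rewrite (consrV_surj z); move: (lsubmx _ _ _) (rsubmx _) => t y {z}.
set z := consrV _; rewrite !lt_min => /and3P[z1 z2 z3].
have tz : `|t| <= `|z| := norm_consrV_l t y.
have yz : `|y| <= `|z| := norm_consrV_r t y.
rewrite /z consrVD dotp_consrV -/z.
have [u uaff ut] : exists2 u : R,
     near_affine (fun y => F (consrV (u : RR R, y))) a x e d1 &
     `|u - (s + t)| <= e * `|t|.
  have [->|t0] := eqVneq t 0.
    by exists s => //; rewrite addr0 subrr !normr0 mulr0.
  by apply: close => //; exact: le_lt_trans z2.
have T (w : 'rV[R]_n) : `|F (consrV (s + t : RR R, w)) - F (consrV (u : RR R, w))| <= L * (e * `|t|).
  rewrite (le_trans (lipF _ _))// ler_wpM2l// consrVB subrr norm_consrV0.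
  by rewrite distrC.
have T2 := uaff y (le_lt_trans yz z1); rewrite /= in T2.
have T4 := der t (le_lt_trans tz z3).
have T5 : `|(b - b') * t| <= e * `|t| by rewrite normrM ler_wpM2r.
have et : e * `|t| <= e * `|z| by rewrite ler_pM2l.
have ey : e * `|y| <= e * `|z| by rewrite ler_pM2l.
have Let : L * (e * `|t|) <= L * (e * `|z|) by rewrite ler_wpM2l.
have := T (x + y); have := T x.
move: T2 T4 T5.
move: (F _) (F _) (F _) (F _) (F _) => f1 f2 f3 f4 f5.
rewrite !ler_norml => /andP[? ?] /andP[? ?] /andP[? ?] /andP[? ?] /andP[? ?].
apply/andP; split; lra.
Qed.

Lemma norm_consrV_le n (r t : R) (y : 'rV[R]_n) : `|t| <= r -> `|y| <= r ->
  `|consrV (t : RR R, y)| <= r.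
Proof.
move=> tr yr; apply/norm_rV_le => [|i]; first exact: le_trans tr.
rewrite /consrV; case: (split_ordP i) => j ->.
  by rewrite row_mxEl (ord1 j) !mxE eqxx mulr1n.
by rewrite row_mxEr (le_trans (norm_coord_le _ _)).
Qed.

(** Induction on the dimension.  On almost every slice s the function of the
    remaining variables is nearly affine at almost every x; for almost every x,
    almost every s is both a density point of the set of slices on which the
    same form and radius work at x, and a point of derivability in the first
    coordinate.  At such points the two approximations can be joined. *)
Lemma near_affine_ae n (F : 'rV[R]_n -> R) (L e : R) :
  (forall x y, `|F x - F y| <= L * `|x - y|) -> 0 < e ->
  leb n (~` near_affine_pts F e) = 0%E.
Proof.
elim: n F e => [|n IHn] F e lipF e0.
  rewrite (_ : ~` _ = set0) ?measure0//; apply/seteqP; split=> // x; apply.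
  exists (0, 0%N) => // y _.
  by rewrite (thinmx0 (x + y)) (thinmx0 x) subrr sub0r normrN /dotp big_ord0 normr0 mulr_ge0// ltW.
rewrite -(add1n n) in F lipF *.
have L0 : 0 <= L.
  have := lipF (consrV (1 : RR R, 0)) (consrV (0 : RR R, 0)).
  by rewrite consrVB !subr0 norm_consrV0 normr1 mulr1; apply: le_trans.
have L3 : 0 < 2 * L + 3 by rewrite ltr_wpDl// mulr_ge0.
pose e1 := Num.min (e / (2 * L + 3)) 1.
have e10 : 0 < e1 by rewrite lt_min ltr01 divr_gt0.
have e11 : e1 <= 1 by rewrite ge_min lexx orbT.
have e1e : (2 * L + 3) * e1 <= e.
  by rewrite mulrC -ler_pdivlMr// ge_min lexx.
have cF := lipschitz_continuous lipF.
pose Fs (s : R) y := F (consrV (s : RR R, y)).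
have lipFs s x y : `|Fs s x - Fs s y| <= L * `|x - y|.
  rewrite (le_trans (lipF _ _))// ler_wpM2l// consrVB subrr.
  by apply: norm_consrV_le => //; rewrite normr0.
pose W (p : 'rV[rat]_n * nat) := [set z : 'rV[R]_(1 + n) | forall y : 'rV[R]_n,
  `|y| < p.2.+1%:R^-1 -> `|F (z + consrV (0 : RR R, y)) - F z - dotp (map_mx ratr p.1) y| <= e1 * `|y|].
have WE p s x : W p (consrV (s : RR R, x)) <-> near_affine (Fs s) (map_mx ratr p.1) x e1 p.2.+1%:R^-1.
  by split=> h y /h; rewrite /Fs consrVD addr0.
have mW p : measurable (W p).
  by apply: closed_measurable_rV; exact: (@closed_near_affine _ _ F _ (fun y => consrV (0 : RR R, y)) _ e1 _ cF).
pose WW := \bigcup_p W p.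
have mWW : measurable WW.
  by apply: countable_bigcupT_measurable => //; exact: countableP.
have mWC : measurable (~` WW) by exact: measurableC.
have WW0 : leb (1 + n) (~` WW) = 0%E.
  rewrite (leb_slice1 mWC); apply: integral0_eq => s _.
  rewrite -(IHn (Fs s) e1)//; congr (leb n _); apply/seteqP; split=> x /= nW.
    by move=> [p _ h]; apply: nW; exists p => //; apply/WE.
  by move=> [p _ /WE h]; apply: nW; exists p.
pose Bad := ~` near_affine_pts F e.
have mBad : measurable Bad by apply: measurableC; exact: measurable_near_affine_pts.
rewrite (leb_slice2 mBad).
transitivity (\int[leb n]_x (cst (0 : \bar R) x))%E; last by rewrite integral0.
apply: ae_eq_integral => //; first exact: measurable_fun_slice2.
have : ae_eq (leb n) setT (fun x => lambda [set s : RR R | (~` WW) (consrV (s, x))]) (cst (0%E : \bar R)).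
  apply: (ae_eq_integral_abs (leb n) measurableT (measurable_fun_slice2 mWC)).1.
  rewrite -WW0 (leb_slice2 mWC); apply: eq_integral => x _.
  by rewrite gee0_abs.
apply: (@filterS _ _ (ae_filter_ringOfSetsType (leb n))) => x /(_ I) Wx0 _.
pose A p : set (RR R) := [set s : RR R | W p (consrV (s, x))].
have mA p : measurable (A p) by exact: measurable_slice2.
have ae1 : {ae lambda, forall s, WW (consrV (s : RR R, x))}.
  exists [set s : RR R | (~` WW) (consrV (s, x))]; split => //.
  exact: measurable_slice2.
pose A' k := if unpickle k is Some p then A p else set0.
have ae2 : {ae lambda, forall s, forall k,
  ((lambda (A' k `&` ball s r) * (lambda (ball s r))^-1) @[r --> (0:R)^'+] --> (\1_(A' k) s)%:E)%E}.
  apply/ae_foralln => k; apply: lebesgue_density; rewrite /A'.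
  by case: (unpickle k).
have lip1 s t : `|F (consrV (s : RR R, x)) - F (consrV (t : RR R, x))| <= L * `|s - t|.
  by rewrite (le_trans (lipF _ _))// ler_wpM2l// consrVB subrr norm_consrV0.
have ae3 := lipschitz_ae_derivable lip1.
suff : {ae lambda, forall s, ~ Bad (consrV (s : RR R, x))}.
  move=> [N [mN N0 sub]]; apply/eqP; rewrite eq_le measure_ge0 andbT -N0.
  apply: le_measure; rewrite ?inE//; first exact: measurable_slice2.
  by move=> s /= bs; apply: sub => /= /(_ bs).
move: ae1 ae2 ae3; apply: (@filterS3 _ _ (ae_filter_ringOfSetsType lambda)).
move=> s [p _ Wp] dens [b der]; rewrite /Bad /setC/=; apply.
have As : A p s by [].
have k0 : 0 < (p.2.+1%:R^-1 : R) by rewrite invr_gt0.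
have dp : ((lambda (A p `&` ball s r) * (lambda (ball s r))^-1) @[r --> (0:R)^'+] --> 1)%E.
  have := dens (pickle p); rewrite /A' pickleK indicE mem_set//.
have close := density_close_point (mA p) e10 e11 dp.
have [b' bb'] : exists b' : rat, `|b - ratr b'| <= e1.
  have := @rat_in_itvoo R (b - e1) (b + e1); rewrite ltrD2l gtrN// => /(_ isT)[b'].
  by rewrite in_itv/= => bb'; exists b'; rewrite distrC ltW// ltr_distl.
have [|d d0 aff] := near_affine_join lipF e10 k0 _ ((WE _ _ _).1 Wp) (der _ e10) bb'.
  case: close => d d0 h; exists d => // t td t0.
  by have [u Au ut] := h _ td t0; exists u => //; exact/WE.
exists (row_mx b'%:M p.1, Num.bound d^-1) => //= y yk.
have -> : map_mx ratr (row_mx b'%:M p.1) = consrV (ratr b' : RR R, map_mx ratr p.1 : 'rV[R]_n).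
  rewrite /consrV map_row_mx/=; congr row_mx.
  by apply/rowP => i; rewrite !mxE ord1 eqxx !mulr1n.
rewrite (le_trans (aff y _))//; last by rewrite ler_wpM2r.
rewrite (lt_trans yk)// invf_plt ?posrE//.
by rewrite (lt_trans (archi_boundP _))// ?ltr_nat// invr_ge0 ltW.
Qed.

Lemma dotp_norm_le n (a y : 'rV[R]_n) (c : R) : 0 <= c ->
  (forall i, `|a ord0 i| <= c) -> `|dotp a y| <= n%:R * c * `|y|.
Proof.
move=> c0 ac; rewrite /dotp (le_trans (ler_norm_sum _ _ _))//.
apply: (@le_trans _ _ (\sum_(i < n) c * `|y|)).
  by apply: ler_sum => i _; rewrite normrM ler_pM// norm_coord_le.
by rewrite sumr_const card_ord -mulrA mulr_natl.
Qed.

Lemma dotp_delta n (a : 'rV[R]_n) (t : R) i : dotp a (t *: delta_mx ord0 i) = a ord0 i * t.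
Proof.
rewrite /dotp (bigD1 i)//= big1 ?addr0; first by rewrite !mxE !eqxx mulr1.
by move=> j ji; rewrite !mxE eqxx (negbTE ji) !mulr0.
Qed.

(** The approximating vectors for e = 1/(k+1) converge, so that they can be
    replaced by their limit. *)
Lemma near_affine_limit n (F : 'rV[R]_n -> R) (x : 'rV[R]_n) :
  (forall k : nat, exists a, exists2 d, 0 < d & near_affine F a x k.+1%:R^-1 d) ->
  exists a, forall e : R, 0 < e -> exists2 d, 0 < d & near_affine F a x e d.
Proof.
move=> /choice[a aP].
have a_close k j i : `|a k ord0 i - a j ord0 i| <= k.+1%:R^-1 + j.+1%:R^-1.
  have [d d0 dP] := aP k; have [d' d'0 d'P] := aP j.
  pose t := Num.min d d' / 2.
  have m0 : 0 < Num.min d d' by rewrite lt_min d0 d'0.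
  have t0 : 0 < t by rewrite divr_gt0.
  have tm : t < Num.min d d' by rewrite /t ltr_pdivrMr// mulr_natr mulr2n ltrDl.
  have td : t < d by rewrite (lt_le_trans tm)// ge_min lexx.
  have td' : t < d' by rewrite (lt_le_trans tm)// ge_min lexx orbT.
  pose y : 'rV[R]_n := t *: delta_mx ord0 i.
  have yt : `|y| <= t.
    apply/norm_rV_le => [|l]; first exact: ltW.
    rewrite !mxE eqxx/=; case: (l == i); first by rewrite mulr1 gtr0_norm.
    by rewrite mulr0 normr0 ltW.
  have := dP y (le_lt_trans yt td); have := d'P y (le_lt_trans yt td').
  rewrite !dotp_delta; move: (F _) (F _) => f1 f2 h1 h2.
  have i0 (m : nat) : 0 <= (m.+1%:R^-1 : R) by rewrite invr_ge0.
  have g1 := le_trans h1 (ler_wpM2l (i0 _) yt); have g2 := le_trans h2 (ler_wpM2l (i0 _) yt).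
  rewrite -(ler_pM2r t0) -[X in _ * X <= _](gtr0_norm t0) -normrM.
  move: (k.+1%:R^-1 : R) (j.+1%:R^-1 : R) (a k _ _) (a j _ _) g1 g2 => u v w z.
  by rewrite !ler_norml => /andP[? ?] /andP[? ?]; apply/andP; split; lra.
pose l := \row_i sup (range (fun k => a k ord0 i - k.+1%:R^-1)).
have l_close k i : `|l ord0 i - a k ord0 i| <= k.+1%:R^-1.
  rewrite /l mxE ler_distl; apply/andP; split.
    apply: ub_le_sup; last by exists k.
    exists (a 0%N ord0 i + 1) => _ [j _ <-].
    have := a_close j 0%N i; rewrite invr1 ler_norml => /andP[_].
    by move: (j.+1%:R^-1 : R) => v; lra.
  apply: ge_sup; first by exists (a 0%N ord0 i - 1^-1), 0%N.
  move=> _ [j _ <-]; have := a_close j k i; rewrite ler_norml => /andP[_].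
  by move: (k.+1%:R^-1 : R) (j.+1%:R^-1 : R) => u v; lra.
exists l => e e0.
have n1 : 0 < (n%:R + 1 : R) by rewrite ltr_wpDl.
pose k := Num.bound (e / (n%:R + 1))^-1.
have ke : k.+1%:R^-1 <= e / (n%:R + 1).
  rewrite ltW// invf_plt ?posrE ?divr_gt0//.
  by rewrite (lt_trans (archi_boundP _))// ?ltr_nat// invr_ge0 divr_ge0// ltW.
have [d d0 dP] := aP k; exists d => // y yd.
have -> : F (x + y) - F x - dotp l y = (F (x + y) - F x - dotp (a k) y) - dotp (l - a k) y.
  rewrite (_ : dotp (l - a k) y = dotp l y - dotp (a k) y); first by ring.
  by rewrite /dotp -sumrB; apply: eq_bigr => i _; rewrite !mxE mulrBl.
rewrite (le_trans (ler_normB _ _))//.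
have h1 := dP y yd.
have h2 : `|dotp (l - a k) y| <= n%:R * k.+1%:R^-1 * `|y|.
  by apply: dotp_norm_le => // i; rewrite !mxE; have := l_close k i; rewrite !mxE.
rewrite (le_trans (lerD h1 h2))// -mulrDl ler_wpM2r//.
move: ke; rewrite ler_pdivlMr//; move: (k.+1%:R^-1 : R) => z; lra.
Qed.

Theorem rademacher n (F : 'rV[R]_n -> R) (L : R) :
  (forall x y, `|F x - F y| <= L * `|x - y|) ->
  {ae leb n, forall x, exists a, forall e : R, 0 < e ->
     exists2 d, 0 < d & near_affine F a x e d}.
Proof.
move=> lipF.
have : {ae leb n, forall x, forall k : nat, near_affine_pts F k.+1%:R^-1 x}.
  apply/ae_foralln => k; exists (~` near_affine_pts F k.+1%:R^-1); split => //.
    apply: measurableC; apply: measurable_near_affine_pts.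
    exact: lipschitz_continuous lipF.
  by apply: (near_affine_ae lipF); rewrite invr_gt0.
apply: (@filterS _ _ (ae_filter_ringOfSetsType (leb n))) => x h.
apply: near_affine_limit => k; have [p _ hp] := h k.
by exists (map_mx ratr p.1), p.2.+1%:R^-1 => //; rewrite invr_gt0.
Qed.

End Rademacher.

(** * The area inequality *)

Section Area.
Context {R : realType} {n : nat}.
Local Notation V := 'rV[R]_n.
Local Notation leb_outer := ((leb n)^*)%mu.
Implicit Types (S K : set V) (G : V -> V) (J : V -> R).

Let outer_ge0 S : (0 <= leb_outer S)%E.
Proof. exact: (mu_ext_ge0 (measure_ge0 (leb n))). Qed.

Let outer_sub (F : (set V)^nat) : (leb_outer (\bigcup_k F k) <= \sum_(k <oo) leb_outer (F k))%E.
Proof. exact: (mu_ext_sigma_subadditive (measure_ge0 (leb n))). Qed.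

Let outer0 : leb_outer set0 = (0%R : R)%:E.
Proof. exact: (mu_ext0 (measure0 (leb n)) (measure_ge0 (leb n))). Qed.

(** A one-sided bound at scale d on the Jacobian of G at x.  It is asked for all
    small balls containing x, centred at x or not, so that it can be used on the
    cells of a grid.  Images need not be measurable, whence the outer measure. *)
Definition image_bound G K (x : V) (a d : R) := forall (c : V) (s : R),
  0 < s < d -> ball c s x -> (leb_outer (G @` (K `&` ball c s)) <= (a * (2 * s) ^+ n)%:E)%E.

Definition thickening S (r : R) : set V := \bigcup_(x in S) ball x r.

Lemma measurable_thickening S r : measurable (thickening S r).
Proof. by apply: open_measurable_rV; apply: bigcup_open => x _; exact: ball_open. Qed.

Lemma leb_bounded_fin S : bounded_set S -> exists M : R, forall T, T `<=` S ->
  measurable T -> (leb n T <= M%:E)%E.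
Proof.
move=> [M [Mr MS]].
pose r := Num.max (M + 1) 1.
have r0 : 0 < r by rewrite lt_max ltr01 orbT.
have Mlt : M < r by rewrite lt_max ltrDl ltr01.
have r20 : 0 < r + 1 by rewrite ltr_wpDl ?ltW.
exists ((2 * (r + 1)) ^+ n) => T TS mT.
rewrite -(leb_ball 0 r20); apply: le_measure; rewrite ?inE//.
  exact: measurable_ball_rV.
move=> x /TS Sx; rewrite -ball_normE /= sub0r normrN.
by rewrite (le_lt_trans (MS _ Mlt x Sx))// ltrDl.
Qed.

Lemma bounded_thickening S r : bounded_set S -> bounded_set (thickening S r).
Proof.
move=> [M [Mr MS]]; exists (M + 1 + r); split; first by rewrite num_real.
move=> x xM y [z Sz]; rewrite -ball_normE /= => zy.
have := MS (M + 1); rewrite ltrDl => /(_ ltr01 z Sz) /= zM.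
rewrite -(subrK z y) (le_trans (ler_normD _ _))//.
by rewrite (le_trans _ (ltW xM))// addrC lerD// distrC ltW.
Qed.

(** A compact set is the decreasing intersection of its thickenings. *)
Lemma leb_thickening_cvg S : compact S -> forall e : R, 0 < e ->
  exists2 r : R, 0 < r & (leb n (thickening S r `\` S) <= e%:E)%E.
Proof.
move=> cS e e0.
have mS := compact_measurable_rV cS.
pose D k := thickening S k.+1%:R^-1 `\` S.
have mD k : measurable (D k) by apply: measurableD => //; exact: measurable_thickening.
have kV (k : nat) : 0 < (k.+1%:R^-1 : R) by rewrite invr_gt0.
have D0 : \bigcap_k D k = set0.
  apply/seteqP; split=> // x Dx.
  have Sx : ~ S x by have [] := Dx 0%N I.
  have : closure S x.
    move=> B /nbhs_ballP[r /= r0 rB].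
    have kr : (Num.bound r^-1).+1%:R^-1 < r.
      rewrite invf_plt ?posrE//.
      by rewrite (lt_trans (archi_boundP _))// ?ltr_nat// invr_ge0 ltW.
    have [[y Sy yx] _] := Dx (Num.bound r^-1) I.
    exists y; split=> //; apply: rB; apply: ball_sym.
    by apply: le_ball yx; exact: ltW.
  by move/(closure_id S).1 : (compact_closed (@norm_hausdorff _ _) cS) => <-.
have D_cvg : leb n (D k) @[k --> \oo] --> 0%E.
  rewrite -(measure0 (leb n)) -D0; apply: nonincreasing_cvg_mu => //.
  - have [M MP] := leb_bounded_fin (bounded_thickening 0.+1%:R^-1 (compact_bounded cS)).
    apply: (le_lt_trans (MP (D 0%N) _ (mD _))); last by rewrite ltry.
    exact: subDsetl.
  - by rewrite D0.
  - move=> k l kl; apply/subsetPset => x [[y Sy yx] Sx]; split=> //; exists y => //.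
    by apply: le_ball yx; rewrite lef_pV2 ?posrE// ler_nat.
have /fine_cvgP[fin /cvgrPdist_le/(_ _ e0)] := D_cvg.
move=> H; have [k _ /= Hk] := filterI fin H.
have [fk] := Hk k (leqnn k); rewrite /= sub0r normrN => ek.
exists k.+1%:R^-1; first exact: kV.
rewrite -(fineK fk) lee_fin (le_trans _ ek)//; exact: ler_norm.
Qed.

Lemma image_bound_le G K x a b d : a <= b -> image_bound G K x a d -> image_bound G K x b d.
Proof.
move=> ab H c s sd xc; rewrite (le_trans (H c s sd xc))// lee_fin ler_wpM2r//.
by move: sd => /andP[s0 _]; rewrite exprn_ge0// mulr_ge0// ltW.
Qed.

(** Lets the radius of a ball containing a cube decrease to half its side. *)
Lemma le_mul_expr_limit (X : \bar R) (a h t0 : R) (m : nat) : 0 < t0 ->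
  (forall t : R, 0 < t < t0 -> (X <= (a * (h + t) ^+ m)%:E)%E) -> (X <= (a * h ^+ m)%:E)%E.
Proof.
move=> t00 H; apply/lee_addgt0Pr => e e0.
have cp : (fun t : R => a * (h + t) ^+ m) @ 0 --> a * (h + 0) ^+ m.
  apply: cvgM; first exact: cvg_cst.
  apply: (@continuous_comp _ _ _ (fun t => h + t) (fun t => t ^+ m)).
    by apply: cvgD; [exact: cvg_cst|exact: cvg_id].
  exact: exprn_continuous.
have /cvgrPdist_le/(_ _ e0)/nbhs_ballP[d /= d0 dP] := cp.
pose t := Num.min (d / 2) (t0 / 2).
have tt : 0 < t by rewrite lt_min !divr_gt0.
have td : t < d by rewrite gt_min ltr_pdivrMr// mulr_natr mulr2n ltrDl d0.
have tt0 : t < t0 by rewrite gt_min orbC ltr_pdivrMr// mulr_natr mulr2n ltrDl t00.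
rewrite (le_trans (H t _)) ?tt// -EFinD lee_fin.
have := dP t; rewrite /ball/= sub0r normrN gtr0_norm// => /(_ td).
by rewrite addr0 ler_norml => /andP[+ _]; lra.
Qed.

Section grid.
Variables (h : R) (h0 : 0 < h).

(** The half-open cubes of side h of a grid, numbered by pickling their corners.
    A cell lies between a ball of the sup norm and its closure, so that the
    volumes of balls suffice. *)
Definition cell (x : V) : 'rV[int]_n := \row_i Num.floor (x ord0 i / h).
Definition cell_set (k : nat) : set V := [set x | pickle (cell x) = k].
Definition cell_center (z : 'rV[int]_n) : V := \row_i ((z ord0 i)%:~R * h + h / 2).

Lemma cell_centerE z i : cell_center z ord0 i = (z ord0 i)%:~R * h + h / 2.
Proof. by rewrite mxE. Qed.

Lemma cellP (z : 'rV[int]_n) (x : V) : cell x = z <->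
  forall i, (z ord0 i)%:~R * h <= x ord0 i < (z ord0 i)%:~R * h + h.
Proof.
split=> [<- i|H].
  rewrite mxE -ler_pdivlMr// Num.Theory.ge_floor/=.
  have -> (a : R) : a * h + h = (a + 1) * h by ring.
  by rewrite -ltr_pdivrMr// -intrD1 Num.Theory.floorD1_gt.
apply/rowP => i; rewrite mxE; apply/Num.Theory.floor_def.
have /andP[l u] := H i; rewrite ler_pdivlMr// l/= ltr_pdivrMr//.
by rewrite intrD mulrDl mul1r.
Qed.

Lemma cell_set_eq (x y : V) k : cell_set k x -> cell_set k y -> cell y = cell x.
Proof. by move=> /= xk yk; apply: (pcan_inj pickleK); rewrite xk yk. Qed.

Lemma measurable_cell_set k : measurable (cell_set k).
Proof.
have [[x kx]|ne] := pselect (exists x, cell_set k x); last first.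
  rewrite (_ : cell_set k = set0)//; apply/seteqP; split=> // x kx.
  by apply: ne; exists x.
rewrite (_ : cell_set k = \bigcap_(i in [set: 'I_n]) [set y : V |
    (`[(cell x ord0 i)%:~R * h, (cell x ord0 i)%:~R * h + h[%classic : set (measurableTypeR R)) (y ord0 i)]).
  apply: fin_bigcap_measurable => // i _.
  by rewrite -[X in measurable X]setTI; exact: measurable_coord.
apply/seteqP; split=> y.
  by move=> /(cell_set_eq kx)/cellP H i _ /=; rewrite in_itv/=; exact: H.
move=> H; rewrite /cell_set/= -[RHS]kx; congr pickle; apply/cellP => i.
by have := H i I; rewrite /= in_itv.
Qed.

Lemma cell_sub_ball k x (t : R) : 0 < t -> cell_set k x ->
  cell_set k `<=` ball (cell_center (cell x)) (h / 2 + t).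
Proof.
move=> t0 kx y /(cell_set_eq kx)/cellP H.
apply/ball_rVP => [|i]; first by rewrite addr_gt0// divr_gt0.
have /andP[] := H i; rewrite cell_centerE ltr_norml.
by move: ((cell x ord0 i)%:~R : R) => w ? ?; apply/andP; split; lra.
Qed.

Lemma ball_sub_cell k x : cell_set k x ->
  ball (cell_center (cell x)) (h / 2) `<=` cell_set k.
Proof.
move=> kx y /ball_rVP => /(_ (divr_gt0 h0 (ltr0Sn _ _))) H.
rewrite /cell_set/= -[RHS]kx; congr pickle; apply/cellP => i.
have := H i; rewrite cell_centerE ltr_norml.
by move: ((cell x ord0 i)%:~R : R) => w /andP[? ?]; apply/andP; split; lra.
Qed.

Lemma cell_near k x : cell_set k x -> cell_set k `<=` ball x h.
Proof.
move=> kx y /(cell_set_eq kx)/cellP H; apply/ball_rVP => // i.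
have := H i; have := (cellP (cell x) x).1 erefl i.
move: ((cell x ord0 i)%:~R : R) => w /andP[? ?] /andP[? ?].
by rewrite ltr_norml; apply/andP; split; lra.
Qed.

End grid.

(** Riemann sums: with J bounded below by the local constant a on each cell, sum
    the bounds over the cells that meet S; those cells fill a small thickening of
    S, which has almost the measure of S. *)
Lemma area_riemann S G J (M d : R) : compact S -> measurable_fun setT J ->
  (forall x, 0 <= J x <= M) -> 0 < d ->
  (forall x, S x -> exists a, [/\ 0 <= a, image_bound G S x a d &
     forall y, ball x d y -> a <= J y]) ->
  (leb_outer (G @` S) <= \int[leb n]_(x in S) (J x)%:E)%E.
Proof.
move=> cS mJ JM d0 HS; apply/lee_addgt0Pr => e e0.
have M0 : 0 <= M by have /andP[a b] := JM 0; exact: le_trans b.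
have M1 : 0 < M + 1 by rewrite ltr_wpDl.
have [r r0 rP] := leb_thickening_cvg cS (divr_gt0 e0 M1).
pose h := Num.min r d / 2.
have m0 : 0 < Num.min r d by rewrite lt_min r0.
have h0 : 0 < h by rewrite divr_gt0.
have hr : h < r.
  rewrite (@lt_le_trans _ _ (Num.min r d))// ?ge_min ?lexx//.
  by rewrite /h ltr_pdivrMr// mulr_natr mulr2n ltrDl.
have hd : h < d.
  rewrite (@lt_le_trans _ _ (Num.min r d))// ?ge_min ?lexx ?orbT//.
  by rewrite /h ltr_pdivrMr// mulr_natr mulr2n ltrDl.
pose T k := if pselect (exists x, S x /\ cell_set h k x) then cell_set h k else set0.
have mT k : measurable (T k).
  by rewrite /T; case: pselect => _ //=; exact: measurable_cell_set.
have tT : trivIset setT T.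
  apply/trivIsetP => i j _ _ ij; apply/seteqP; split=> // x [].
  rewrite /T; case: pselect => _ //=; case: pselect => _ //= xi xj.
  by move: ij; rewrite -xi -xj eqxx.
have mJ' (D : set V) : measurable D -> measurable_fun D (EFin \o J).
  by move=> mD; apply/measurable_EFinP; exact: measurable_funTS.
have J0 x : (0 <= (J x)%:E)%E by have /andP[] := JM x; rewrite lee_fin.
have TJ k : (leb_outer (G @` (S `&` cell_set h k)) <= \int[leb n]_(x in T k) (J x)%:E)%E.
  rewrite /T; case: pselect => [[x [Sx kx]]|ne] /=; last first.
    rewrite (_ : S `&` _ = set0); last first.
      by apply/seteqP; split=> // x [Sx kx]; apply: ne; exists x.
    by rewrite image_set0 outer0 integral_set0.
  have [a [a0 ab aJ]] := HS x Sx.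
  apply: (@le_trans _ _ (a * h ^+ n)%:E).
    apply: (@le_mul_expr_limit _ _ _ h) => // t /andP[t0 th].
    have -> : h + t = 2 * (h / 2 + t / 2) by field.
    apply: le_trans (ab (cell_center h (cell h x)) _ _ _).
    - apply: le_mu_ext; apply: image_subset; apply: setIS.
      by apply: cell_sub_ball => //; rewrite divr_gt0.
    - by apply/andP; split; lra.
    - by apply: (@cell_sub_ball _ h0 k x) => //; rewrite divr_gt0.
  have mk := measurable_cell_set h0 k.
  apply: (@le_trans _ _ (\int[leb n]_(x in cell_set h k) a%:E)%E).
    rewrite integral_cst// EFinM lee_pmul//.
    - by rewrite lee_fin exprn_ge0// ltW.
    - have h20 : 0 < h / 2 by rewrite divr_gt0.
      have := leb_ball (cell_center h (cell h x)) h20.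
      rewrite (_ : 2 * (h / 2) = h); last by field.
      move=> <-; apply: le_measure; rewrite ?inE//; first exact: measurable_ball_rV.
      exact: ball_sub_cell.
  apply: ge0_le_integral => //; [exact: mJ'|].
  move=> y ky; rewrite lee_fin aJ//.
  by apply: le_ball (cell_near h0 kx ky); exact: ltW.
apply: (@le_trans _ _ (\int[leb n]_(x in \bigcup_k T k) (J x)%:E)%E).
  rewrite ge0_integral_bigcup//; last by apply: mJ'; exact: bigcupT_measurable.
  apply: (@le_trans _ _ (\sum_(k <oo) leb_outer (G @` (S `&` cell_set h k)))%E); last first.
    by apply: lee_nneseries => k _.
  apply: le_trans (outer_sub _).
  apply: le_mu_ext => _ [x Sx <-]; exists (pickle (cell h x)) => //.
  by exists x.
have mSr := measurable_thickening S r.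
have mS := compact_measurable_rV cS.
apply: (@le_trans _ _ (\int[leb n]_(x in thickening S r) (J x)%:E)%E).
  apply: ge0_subset_integral => //.
  - exact: bigcupT_measurable.
  - exact: mJ'.
  - move=> y [k _]; rewrite /T; case: pselect => //= -[x [Sx kx]] ky.
    by exists x => //; apply: le_ball (cell_near h0 kx ky); exact: ltW.
have SE : thickening S r = S `|` (thickening S r `\` S).
  by rewrite setDUK// => x Sx; exists x => //; exact: ballxx.
have mD : measurable (thickening S r `\` S) by exact: measurableD.
rewrite SE ge0_integral_setU//; last 2 first.
- by apply: mJ'; exact: measurableU.
- by apply/disj_set2P; rewrite setDE setICA setICr setI0.
rewrite leeD2l//.
apply: (@le_trans _ _ (\int[leb n]_(x in thickening S r `\` S) M%:E)%E).
  apply: ge0_le_integral => //; first exact: mJ'.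
  by move=> y _; have /andP[_] := JM y; rewrite lee_fin.
rewrite integral_cst//.
apply: (@le_trans _ _ (M%:E * (e / (M + 1))%:E)%E).
  by rewrite lee_pmul// lee_fin.
by rewrite -EFinM lee_fin mulrCA ger_pMr// ler_pdivrMr// mul1r lerDl.
Qed.

(** Closedness in x is the reason for taking all balls containing x in
    [image_bound]: a ball containing x contains the points near x as well. *)
Lemma closed_image_bound G K J (d : R) : continuous J ->
  closed [set x | image_bound G K x (J x) d].
Proof.
move=> cJ; rewrite (_ : mkset _ = \bigcap_(p in [set p : V * R | 0 < p.2 < d])
   (~` ball p.1 p.2 `|` [set x | (leb_outer (G @` (K `&` ball p.1 p.2)) <=
      (J x * (2 * p.2) ^+ n)%:E)%E])); last first.
  apply/seteqP; split=> x H.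
    by move=> [c s] /= sd; have [xc|] := pselect (ball c s x); [right; exact: H|left].
  by move=> c s sd xc; have [] := H (c, s) sd.
apply: closed_bigI => -[c s] /= /andP[s0 _]; apply: closedU.
  exact/open_closedC/ball_open.
case: (leb_outer _) => [r| |].
- rewrite (_ : mkset _ = (fun x : V => J x * (2 * s) ^+ n) @^-1` [set t | r <= t]); last first.
    by apply/seteqP; split=> x /=; rewrite lee_fin.
  have cJs : continuous (fun x : V => J x * (2 * s) ^+ n).
    move=> x; have FF : Filter (nbhs x) by exact: nbhs_filter.
    by apply: cvgM; [exact: cJ|exact: cvg_cst].
  by move/continuous_closedP : cJs; apply; exact: closed_ge.
- rewrite (_ : mkset _ = set0); first exact: closed0.
  by apply/seteqP; split=> // x /=; rewrite leye_eq.
- rewrite (_ : mkset _ = setT); first exact: closedT.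
  by apply/seteqP; split=> // x _ /=; exact: leNye.
Qed.

Lemma closed_lower_bound J (d e : R) : continuous J -> 0 < d ->
  closed [set x | forall y, ball x d y -> J x <= J y + e].
Proof.
move=> cJ d0; rewrite (_ : mkset _ = \bigcap_(y in setT)
   (~` ball y d `|` J @^-1` [set t | t <= J y + e])); last first.
  apply/seteqP; split=> x H.
    move=> y _ /=; have [xy|] := pselect (ball y d x); [right|by left].
    by apply: H; exact: ball_sym.
  by move=> y xy; have [|//] := H y I; apply: contra_notP => _; exact: ball_sym.
apply: closed_bigI => y _; apply: closedU; first exact/open_closedC/ball_open.
by move/continuous_closedP : cJ; apply; exact: closed_le.
Qed.

Lemma inv_nat_lt (d : R) : 0 < d -> (Num.bound d^-1).+1%:R^-1 < d.
Proof.
move=> d0; rewrite invf_plt ?posrE//.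
by rewrite (lt_trans (archi_boundP _))// ?ltr_nat// invr_ge0 ltW.
Qed.

Lemma image_bound_mono G K x (a d e : R) : e <= d -> image_bound G K x a d -> image_bound G K x a e.
Proof.
by move=> ed H c s /andP[s0 sd]; apply: H; rewrite s0 (lt_le_trans sd).
Qed.

Lemma image_bound_sub G K S x (a d : R) : S `<=` K ->
  image_bound G K x a d -> image_bound G S x a d.
Proof.
move=> SK H c s sd xc; apply: le_trans (H c s sd xc).
by apply: le_mu_ext; apply: image_subset; exact: setSI.
Qed.

Lemma leb_bigcup_le (F : (set V)^nat) (M : \bar R) :
  (forall i, measurable (F i)) -> nondecreasing_seq F ->
  (forall i, leb n (F i) <= M)%E -> (leb n (\bigcup_i F i) <= M)%E.
Proof.
move=> mF ndF FM.
have cv := @nondecreasing_cvg_mu _ _ _ (leb n) F mF (bigcupT_measurable _ mF) ndF.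
by rewrite -(cvg_lim _ cv)//; apply: lime_le; [exact: cvgP cv|exact: nearW].
Qed.

Section null_image.
Variables (G : V -> V) (K : set V).
Hypothesis cK : compact K.
Hypothesis mG : forall S, compact S -> S `<=` K -> measurable (G @` S).

Let compact_sub S : closed S -> S `<=` K -> compact S.
Proof. by move=> cS SK; exact: subclosed_compact cS cK SK. Qed.

(** The null set is approximated from above by the relatively open subsets
    L \ S k of L; each is an increasing union of compact sets, to which the
    Riemann sums apply. *)
Lemma null_image (L : set V) (S : (set V)^nat) (a d : R) :
  closed L -> L `<=` K -> (forall k, closed (S k)) -> nondecreasing_seq S ->
  0 <= a -> 0 < d -> (forall x, L x -> image_bound G K x a d) ->
  leb n (L `\` \bigcup_k S k) = 0%E ->
  leb_outer (G @` (L `\` \bigcup_k S k)) = 0%E.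
Proof.
move=> clL LK clS ndS a0 d0 HL N0.
pose W k := L `\` S k.
have mW k : measurable (W k) by apply: measurableD; exact: closed_measurable_rV.
have W_cvg : leb n (W k) @[k --> \oo] --> 0%E.
  have WE : \bigcap_k W k = L `\` \bigcup_k S k.
    apply/seteqP; split=> [x Wx|x [Lx Sx] k _].
      by split; [have [] := Wx 0%N I|move=> [k _ Sk]; have [_] := Wx k I].
    by split=> // Skx; apply: Sx; exists k.
  rewrite -N0 -WE; apply: nonincreasing_cvg_mu => //.
  - have [M MP] := leb_bounded_fin (compact_bounded cK).
    apply: (le_lt_trans (MP (W 0%N) _ (mW _))); last by rewrite ltry.
    by move=> x [/LK].
  - exact: bigcapT_measurable.
  - by move=> k l kl; apply/subsetPset => x [Lx Sx]; split=> // Skx; apply: Sx; move: Skx; exact/subsetPset/ndS.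
have GW k : (leb_outer (G @` W k) <= a%:E * leb n (W k))%E.
  pose C m := [set x | L x /\ forall y, S k y -> ~ ball y m.+1%:R^-1 x].
  have clC m : closed (C m).
    rewrite (_ : C m = L `&` \bigcap_(y in S k) ~` ball y m.+1%:R^-1); last first.
      by apply/seteqP; split=> x [Lx H]; split=> // y /H.
    apply: closedI => //; apply: closed_bigI => y _.
    exact/open_closedC/ball_open.
  have CK m : C m `<=` K by move=> x [/LK].
  have WC : W k = \bigcup_m C m.
    apply/seteqP; split=> [x [Lx Sx]|x [m _ [Lx H]]]; last first.
      split=> // Skx; apply: (H x Skx); apply: ballxx; by rewrite invr_gt0.
    have /nbhs_ballP[e /= e0 eS] : nbhs x (~` S k).
      by apply: open_nbhs_nbhs; split=> //; exact/closed_openC.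
    exists (Num.bound e^-1) => //; split=> // y Sy /ball_sym xy.
    by apply: (eS y) Sy; apply: le_ball xy; exact/ltW/inv_nat_lt.
  have ndC : nondecreasing_seq C.
    move=> m l ml; apply/subsetPset => x [Lx H]; split=> // y Sy yx; apply: (H y Sy).
    by apply: le_ball yx; rewrite lef_pV2 ?posrE// ler_nat.
  have mGC m : measurable (G @` C m) by apply: mG => //; exact: compact_sub.
  rewrite WC image_bigcup measurable_mu_extE; last exact: bigcupT_measurable.
  apply: leb_bigcup_le => //.
    by move=> m l ml; apply/subsetPset/image_subset/subsetPset/ndC.
  move=> m; rewrite -[X in (X <= _)%E]measurable_mu_extE//.
  apply: (@le_trans _ _ (\int[leb n]_(x in C m) (a)%:E)%E).
    apply: (@area_riemann (C m) G (cst a) a d) => //=.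
    - exact: compact_sub.
    - by move=> _; rewrite a0 lexx.
    - move=> x Cx; exists a; split=> //; apply: (image_bound_sub (CK m)).
      by apply: HL; case: Cx.
  rewrite integral_cst//; last exact: closed_measurable_rV.
  rewrite lee_pmul//; apply: le_measure; rewrite ?inE//.
  - exact: closed_measurable_rV.
  - by rewrite -WC.
  - by move=> x Cx; exists m.
apply/eqP; rewrite eq_le outer_ge0 andbT.
have : (a%:E * leb n (W k))%E @[k --> \oo] --> 0%E.
  by rewrite -(mule0 a%:E); apply: cvgeZl.
move=> cv; rewrite -(cvg_lim _ cv)//; apply: lime_ge; first exact: cvgP cv.
apply: nearW => k; apply: le_trans (GW k); apply: le_mu_ext; apply: image_subset.
by move=> x [Lx Sx]; split=> // Skx; apply: Sx; exists k.
Qed.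

End null_image.

Lemma continuous_measurable_rV J : continuous J -> measurable_fun setT (J : V -> measurableTypeR R).
Proof.
move=> /continuousP cJ; apply: (measurability _ (RGenOpens.measurableE R)).
move=> _ [_ [a [b ->] <-]]; rewrite setTI; apply: open_measurable_rV.
exact/cJ/interval_open.
Qed.

(** The points where the sharp bound holds at scale 1/(k+1), and where J varies
    little at that scale, form an increasing sequence of compact sets S k to which
    [area_riemann] applies.  The rest of K is null, and so is its image by the
    crude bounds. *)
Theorem area_inequality G K J (M : R) : compact K ->
  (forall S, compact S -> S `<=` K -> measurable (G @` S)) ->
  continuous J -> (forall x, 0 <= J x <= M) ->
  (forall x, K x -> exists a d : R, [/\ 0 <= a, 0 < d & image_bound G K x a d]) ->
  (exists N, [/\ measurable N, leb n N = 0%E & forall x, K x -> ~ N x ->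
     forall e : R, 0 < e -> exists2 d : R, 0 < d & image_bound G K x (J x + e) d]) ->
  (leb_outer (G @` K) <= \int[leb n]_(x in K) (J x)%:E)%E.
Proof.
move=> cK mG cJ JM HL [N [mN N0 HJ]].
have clK : closed K := compact_closed (@norm_hausdorff _ _) cK.
have compact_sub S : closed S -> S `<=` K -> compact S.
  by move=> cS SK; exact: subclosed_compact cS cK SK.
have mK := compact_measurable_rV cK.
have [B HB] := leb_bounded_fin (compact_bounded cK).
have KB := HB K (@subset_refl _ K) mK.
have B0 : 0 <= B by rewrite -lee_fin (le_trans (measure_ge0 _ _) KB).
have mJ := continuous_measurable_rV cJ.
apply/lee_addgt0Pr => e e0.
have B1 : 0 < B + 1 by rewrite ltr_wpDl.
pose t := e / (2 * (B + 1)).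
have t0 : 0 < t by rewrite divr_gt0// mulr_gt0.
have V0 (k : nat) : 0 < (k.+1%:R^-1 : R) by rewrite invr_gt0.
pose S k := [set x | K x /\ (image_bound G K x (J x + t) k.+1%:R^-1 /\
   forall y, ball x k.+1%:R^-1 y -> J x <= J y + t)].
have clS k : closed (S k).
  apply: closedI => //; apply: closedI.
    apply: (@closed_image_bound G K (fun x => J x + t)).
    move=> x; have FF : Filter (nbhs x) by exact: nbhs_filter.
    by apply: cvgD; [exact: cJ|exact: cvg_cst].
  exact: closed_lower_bound.
have SK k : S k `<=` K by move=> x [].
have leV k l : (k <= l)%N -> l.+1%:R^-1 <= k.+1%:R^-1 :> R.
  by move=> kl; rewrite lef_pV2 ?posrE// ler_nat.
have ndS : nondecreasing_seq S.
  move=> k l kl; apply/subsetPset => x [Kx [H1 H2]]; split=> //; split.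
    by apply: image_bound_mono H1; exact: leV.
  by move=> y xy; apply: H2; apply: le_ball xy; exact: leV.
have mS k : measurable (S k) by exact: closed_measurable_rV.
have mGS k : measurable (G @` S k) by apply: mG => //; exact: compact_sub.
have JE2 (x : V) : (0 <= (J x)%:E)%E by have /andP[] := JM x; rewrite lee_fin.
have mJ' (D : set V) : measurable D -> measurable_fun D (EFin \o J).
  by move=> mD; apply/measurable_EFinP; exact: measurable_funTS.
have S_le k : (leb n (G @` S k) <= \int[leb n]_(x in K) (J x)%:E + e%:E)%E.
  rewrite -[X in (X <= _)%E]measurable_mu_extE//.
  apply: (@le_trans _ _ (\int[leb n]_(x in S k) (J x + 2 * t)%:E)%E).
    apply: (@area_riemann (S k) G (fun x => J x + 2 * t) (M + 2 * t) k.+1%:R^-1) => //.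
    - exact: compact_sub.
    - exact: measurable_funD.
    - by move=> x; have /andP[? ?] := JM x; apply/andP; split; lra.
    - move=> x [Kx [H1 H2]]; exists (J x + t); split.
      + by have /andP[? ?] := JM x; lra.
      + exact: image_bound_sub H1.
      + by move=> y /H2; lra.
  apply: (@le_trans _ _ (\int[leb n]_(x in K) ((J x)%:E + (2 * t)%:E))%E).
    apply: ge0_subset_integral => //.
    - apply/measurable_EFinP; apply: measurable_funTS; exact: measurable_funD.
    - by move=> x _; have /andP[? ?] := JM x; rewrite lee_fin; lra.
  rewrite ge0_integralD//; [|exact: mJ'|by move=> x _; rewrite lee_fin mulr_ge0// ltW].
  rewrite leeD2l// integral_cst//.
  apply: (@le_trans _ _ ((2 * t)%:E * B%:E)%E).
    by rewrite lee_pmul2l// lte_fin mulr_gt0.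
  rewrite -EFinM lee_fin /t.
  have -> : 2 * (e / (2 * (B + 1))) * B = e * B / (B + 1) by field; rewrite gt_eqF.
  by rewrite ler_pdivrMr// ler_pM2l// lerDl.
have GS : (leb n (\bigcup_k (G @` S k)) <= \int[leb n]_(x in K) (J x)%:E + e%:E)%E.
  apply: leb_bigcup_le => // k l kl; apply/subsetPset/image_subset.
  by have /subsetPset := ndS _ _ kl.
pose N' := K `\` \bigcup_k S k.
have mSU : measurable (\bigcup_k S k) by exact: bigcupT_measurable.
have N'N : N' `<=` N.
  move=> x [Kx Sx]; apply: contrapT => Nx; apply: Sx.
  have [d d0 H1] := HJ x Kx Nx t t0.
  have [d' /= d'0 H2] : exists2 d', 0 < d' & forall y, ball x d' y -> J x <= J y + t.
    have /cvgrPdist_le/(_ _ t0)/nbhs_ballP[d' d'0 H] := cJ x.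
    by exists d' => // y /H /=; rewrite ler_norml => /andP[_]; lra.
  exists (Num.bound (Num.min d d')^-1) => //.
  have m0 : 0 < Num.min d d' by rewrite lt_min d0.
  have := ltW (inv_nat_lt m0); rewrite le_min => /andP[kd kd'].
  split=> //; split; first exact: image_bound_mono H1.
  by move=> y xy; apply: H2; apply: le_ball xy.
have N'0 : leb n N' = 0%E.
  apply/eqP; rewrite eq_le measure_ge0 andbT -N0 le_measure ?inE//.
  exact: measurableD.
pose L j := [set x | K x /\ image_bound G K x j.+1%:R j.+1%:R^-1].
have clL j : closed (L j).
  apply: closedI => //; apply: (@closed_image_bound G K (cst j.+1%:R)).
  by move=> x; have FF : Filter (nbhs x) by [exact: nbhs_filter]; exact: cvg_cst.
have GN' : leb_outer (G @` N') = 0%E.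
  have LU : N' `<=` \bigcup_j (L j `\` \bigcup_k S k).
    move=> x [Kx Sx]; have [a [d [a0 d0 H]]] := HL x Kx.
    pose j := maxn (Num.bound a) (Num.bound d^-1); exists j => //; split=> //; split=> //.
    apply: (@image_bound_le _ _ _ a).
      rewrite ltW// (lt_le_trans (archi_boundP a0))// ler_nat leqW// leq_maxl//.
    apply: image_bound_mono H; apply: le_trans (leV _ _ _) (ltW (inv_nat_lt d0)).
    exact: leq_maxr.
  apply/eqP; rewrite eq_le outer_ge0 andbT.
  apply: (@le_trans _ _ (leb_outer (\bigcup_j (G @` (L j `\` \bigcup_k S k))))).
    by apply: le_mu_ext; rewrite -image_bigcup; exact: image_subset.
  apply: le_trans (outer_sub _) _.
  rewrite eseries0// => j _ _.
  apply: (@null_image G K cK mG (L j) S j.+1%:R j.+1%:R^-1) => //.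
  - by move=> x [].
  - by move=> x [].
  - apply/eqP; rewrite eq_le measure_ge0 andbT -N'0 le_measure ?inE//.
    + by apply: measurableD => //; exact: closed_measurable_rV.
    + exact: measurableD.
    + by move=> x [[Kx _] Sx].
have -> : G @` K = (\bigcup_k (G @` S k)) `|` G @` N'.
  rewrite -image_bigcup -image_setU; congr (_ @` _).
  by rewrite setDUK// => x [k _ /SK].
apply: (@le_trans _ _ (leb_outer (\bigcup_k (G @` S k)) + leb_outer (G @` N'))%E).
  exact: (@outer_measureU2 _ _ (leb_outer)).
rewrite GN' adde0 measurable_mu_extE//; exact: bigcupT_measurable.
Qed.

End Area.

(** * Bounds for images of small balls *)

Section ImageBounds.
Context {R : realType} {n : nat}.
Local Notation V := 'rV[R]_n.
Local Notation leb_outer := ((leb n)^*)%mu.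
Implicit Types (K : set V) (G : V -> V) (A : 'M[R]_n).

Lemma image_bound_of_sub G K (x : V) (a d : R) :
  (forall (c : V) (s : R), 0 < s < d -> ball c s x -> exists T : set V,
     [/\ measurable T, G @` ball c s `<=` T & (leb n T <= (a * (2 * s) ^+ n)%:E)%E]) ->
  image_bound G K x a d.
Proof.
move=> H c s sd xc; have [T [mT GT Ta]] := H c s sd xc.
apply: le_trans Ta; rewrite -measurable_mu_extE//; apply: le_mu_ext.
by apply: subset_trans GT; apply: image_subset => y [].
Qed.

Lemma image_bound_lipschitz G K (x : V) (L d : R) : 0 <= L ->
  (forall y z, ball x d y -> ball x d z -> `|G y - G z| <= L * `|y - z|) ->
  image_bound G K x ((2 * (L + 1)) ^+ n) (d / 2).
Proof.
move=> L0 lipG; apply: image_bound_of_sub => c s /andP[s0 sd] xc.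
have r0 : 0 < 2 * (L + 1) * s by rewrite !mulr_gt0// ltr_wpDl.
exists (ball (G x) (2 * (L + 1) * s)); split; first exact: measurable_ball_rV.
  move=> _ [y cy <-]; rewrite -ball_normE /=.
  have xy : ball x (s + s) y by apply: ball_triangle cy; exact: ball_sym.
  have xd : ball x d y by apply: le_ball xy; lra.
  have dx : ball x d x by apply: ballxx; lra.
  rewrite (le_lt_trans (lipG _ _ dx xd))//.
  move: xy; rewrite -ball_normE /= => xy.
  rewrite (@le_lt_trans _ _ (L * (s + s)))//; first by rewrite ler_wpM2l// ltW.
  by rewrite -subr_gt0; have -> : 2 * (L + 1) * s - L * (s + s) = 2 * s; [ring|rewrite mulr_gt0].
by rewrite leb_ball// lee_fin -exprMn (_ : 2 * _ = 2 * (L + 1) * (2 * s))//; ring.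
Qed.

Lemma leb_posdef_ball A (b c : V) (r : R) : posdef A -> 0 < r ->
  leb n [set z | ball c r ((z - b) *m invmx A)] = (\det A * (2 * r) ^+ n)%:E.
Proof.
move=> pA r0; have [dA HA] := leb_posdef pA.
have uA : A \in unitmx by rewrite unitmxE unitfE gt_eqF.
pose T : set V := [set z | ball c r (z *m invmx A)].
have mT : measurable T.
  have := measurable_affine_preimage (invmx A) 0 (measurable_ball_rV c r).
  by congr measurable; apply/seteqP; split => x /=; rewrite addr0.
rewrite EFinM -(leb_ball c r0) (leb_translate (- b) mT) -(HA T mT); congr (_ * leb n _)%E.
by apply/seteqP; split=> x /=; rewrite /T/= mulmxK.
Qed.

Lemma measurable_posdef_ball A (b c : V) (r : R) :
  measurable [set z : V | ball c r ((z - b) *m invmx A)].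
Proof.
have := measurable_affine_preimage (invmx A) (- b *m invmx A) (measurable_ball_rV c r).
by congr measurable; apply/seteqP; split => x /=; rewrite mulmxBl mulNmx.
Qed.

Lemma mulmx_norm_le A : exists2 C : R, 0 <= C & forall w : V, `|w *m A| <= C * `|w|.
Proof.
pose M := \sum_(p : 'I_n * 'I_n) `|A p.1 p.2|.
have M0 : 0 <= M by apply: sumr_ge0.
have MA i j : `|A i j| <= M.
  by rewrite /M (bigD1 (i, j))//= lerDl sumr_ge0.
exists (n%:R * M) => [|v]; first by rewrite mulr_ge0.
apply/norm_rV_le => [|i]; first by rewrite !mulr_ge0.
have -> : (v *m A) ord0 i = dotp (\row_j A j i) v.
  by rewrite mxE /dotp; apply: eq_bigr => j _; rewrite mxE mulrC.
by apply: dotp_norm_le => // j; rewrite mxE.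
Qed.

Lemma mul_expr_near (a h e : R) (m : nat) : 0 < e ->
  exists2 t : R, 0 < t & a * (h + t) ^+ m <= a * h ^+ m + e.
Proof.
move=> e0; pose p : {poly R} := a *: (h%:P + 'X) ^+ m.
have pE t : p.[t] = a * (h + t) ^+ m by rewrite !hornerE.
have /cvgrPdist_le/(_ _ e0)/nbhs_ballP[d /= d0 dP] := @continuous_horner R p 0.
exists (d / 2); first by rewrite divr_gt0.
have := dP (d / 2); rewrite /ball/= sub0r normrN gtr0_norm ?divr_gt0//.
rewrite ltr_pdivrMr// mulr_natr mulr2n ltrDl => /(_ d0).
by rewrite !pE addr0 ler_norml => /andP[+ _]; lra.
Qed.

Definition derivative_mx G (x : V) A := forall e : R, 0 < e -> exists2 d : R, 0 < d &
  forall y, `|y| < d -> `|G (x + y) - G x - y *m A| <= e * `|y|.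

(** G maps a ball of radius s into the image of the ball of radius (1 + t) s under
    the affine map approximating G. *)
Lemma image_bound_posdef G K (x : V) A (e : R) : posdef A -> derivative_mx G x A ->
  0 < e -> exists2 d : R, 0 < d & image_bound G K x (\det A + e) d.
Proof.
move=> pA dG e0; have [dA _] := leb_posdef pA.
have uA : A \in unitmx by rewrite unitmxE unitfE gt_eqF.
have [C C0 HC] := mulmx_norm_le (invmx A).
have [t t0 Ht] := @mul_expr_near (\det A) 1 e n e0.
have C1 : 0 < 2 * C + 1 by rewrite ltr_wpDl// mulr_ge0.
have [d d0 dP] := dG _ (divr_gt0 t0 C1).
exists (d / 2); first by rewrite divr_gt0.
apply: image_bound_of_sub => c s /andP[s0 sd] xc.
have r0 : 0 < (1 + t) * s by rewrite mulr_gt0// addr_gt0.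
exists [set z | ball c ((1 + t) * s) ((z - (G x - x *m A)) *m invmx A)]; split.
- exact: measurable_posdef_ball.
- move=> _ [y cy <-] /=.
  have xy : ball x (s + s) y by apply: ball_triangle cy; exact: ball_sym.
  move: xy; rewrite -ball_normE /= distrC => xy.
  have yd : `|y - x| < d by rewrite (lt_le_trans xy)//; lra.
  have := dP _ yd; rewrite (_ : x + (y - x) = y) => [Hw|]; last by rewrite addrC subrK.
  set w := G y - G x - _ in Hw.
  have -> : (G y - (G x - x *m A)) *m invmx A = y + w *m invmx A.
    have -> : G y - (G x - x *m A) = y *m A + w.
      by rewrite /w mulmxBl; apply/rowP => i; rewrite !mxE; ring.
    by rewrite mulmxDl mulmxK.
  have ww : `|w *m invmx A| <= t * s.
    rewrite (le_trans (HC _))//.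
    rewrite (@le_trans _ _ (C * (t / (2 * C + 1) * (s + s))))//.
      rewrite ler_wpM2l// (le_trans Hw)// ler_wpM2l ?divr_ge0 ?(ltW t0) ?(ltW C1)//.
      exact: ltW.
    have -> : C * (t / (2 * C + 1) * (s + s)) = (t * s) * (2 * C / (2 * C + 1)).
      by field; rewrite gt_eqF.
    by rewrite ger_pMr ?mulr_gt0// ler_pdivrMr// mul1r lerDl.
  move: cy; rewrite -ball_normE /= => cy.
  rewrite opprD addrA (le_lt_trans (ler_normB _ _))//.
  by rewrite mulrDl mul1r ltr_leD.
- rewrite leb_posdef_ball// lee_fin mulrCA exprMn mulrA ler_wpM2r ?exprn_ge0 ?mulr_ge0 ?(ltW s0)//.
  by rewrite -[X in _ <= X + _]mulr1 -[X in _ * X + _](expr1n _ n).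
Qed.

Lemma dotpC (x y : V) : dotp x y = dotp y x.
Proof. by apply: eq_bigr => i _; rewrite mulrC. Qed.

Lemma dotpDl (x y z : V) : dotp (x + y) z = dotp x z + dotp y z.
Proof. by rewrite /dotp -big_split; apply: eq_bigr => i _; rewrite !mxE mulrDl. Qed.

Lemma dotpZl (a : R) (x z : V) : dotp (a *: x) z = a * dotp x z.
Proof. by rewrite /dotp mulr_sumr; apply: eq_bigr => i _; rewrite !mxE mulrA. Qed.

Lemma dotpNl (x z : V) : dotp (- x) z = - dotp x z.
Proof. by rewrite -scaleN1r dotpZl mulN1r. Qed.

Lemma dotpDr (x y z : V) : dotp z (x + y) = dotp z x + dotp z y.
Proof. by rewrite dotpC dotpDl !(dotpC z). Qed.

Lemma dotpZr (a : R) (x z : V) : dotp z (a *: x) = a * dotp z x.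
Proof. by rewrite dotpC dotpZl (dotpC z). Qed.

Lemma dotpNr (x z : V) : dotp z (- x) = - dotp z x.
Proof. by rewrite dotpC dotpNl (dotpC z). Qed.

Lemma dotp_ge0 (x : V) : 0 <= dotp x x.
Proof. by apply: sumr_ge0 => i _; rewrite -expr2 sqr_ge0. Qed.

Lemma quadfE A (v : V) : quadf A v = dotp (v *m A) v.
Proof. by rewrite /quadf /dotp mxE; apply: eq_bigr => i _; rewrite [v^T _ _]mxE. Qed.

Lemma dotp_le_norm (z : V) (s : R) : `|z| <= s -> dotp z z <= n%:R * s ^+ 2.
Proof.
move=> zs; apply: (@le_trans _ _ (\sum_(j < n) s ^+ 2)).
  apply: ler_sum => j _; rewrite -expr2 -[X in X <= _]ger0_norm ?sqr_ge0// normrX.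
  rewrite ler_pXn2r ?nnegrE// ?(le_trans (norm_coord_le _ _))//.
  exact: le_trans zs.
by rewrite sumr_const card_ord mulr_natl.
Qed.

Lemma norm_le_dotp (x : V) (s : R) : 0 <= s -> dotp x x <= n%:R * s ^+ 2 ->
  `|x| <= n%:R * s.
Proof.
move=> s0 xs; apply/norm_rV_le => [|i]; first by rewrite mulr_ge0.
rewrite -(@ler_pXn2r _ 2)// ?nnegrE ?mulr_ge0// -normrX ger0_norm ?sqr_ge0//.
have xi : x ord0 i ^+ 2 <= dotp x x.
  by rewrite /dotp (bigD1 i)//= -expr2 lerDl sumr_ge0// => j _; rewrite -expr2 sqr_ge0.
rewrite (le_trans xi)// (le_trans xs)// exprMn ler_wpM2r ?sqr_ge0//.
case: (posnP n) => [->|n0]; first by rewrite expr0n.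
by rewrite expr2 ler_peMl// ler1n.
Qed.

Lemma posdef_shift A (t : R) : sym A -> (forall v, 0 <= quadf A v) -> 0 < t ->
  posdef (A + t%:M).
Proof.
move=> sA A0 t0; split.
  by rewrite /sym/= linearD/= tr_scalar_mx sA.
move=> v v0; rewrite quadfE mulmxDr dotpDl -quadfE mul_mx_scalar dotpZl.
rewrite ltr_wpDl// mulr_gt0// lt_neqAle dotp_ge0 andbT eq_sym.
apply: contra v0 => /eqP v0; apply/eqP/rowP => i; rewrite mxE.
have /eqP := v0; rewrite psumr_eq0; last by move=> j _; rewrite -expr2 sqr_ge0.
by move=> /allP/(_ i (mem_index_enum _)); rewrite -expr2 sqrf_eq0 => /eqP.
Qed.

(** u minimizes q(u - z) / 2 + t |u - w|^2 / 2, where q is the form of A.  The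
    bound is uniform in t, although the inverse of A + t I is not bounded. *)
Lemma shift_contraction A (t : R) (z u w : V) : (forall v, 0 <= quadf A v) ->
  0 < t -> u *m (A + t%:M) = z *m A + t *: w ->
  dotp u u <= dotp z z + dotp w w.
Proof.
move=> A0 t0; rewrite mulmxDr mul_mx_scalar => E.
have {}E : (z - u) *m A = t *: (u - w).
  apply/eqP; rewrite mulmxBl scalerBr subr_eq addrAC eq_sym subr_eq -E.
  by rewrite addrC.
have := A0 (z - u); rewrite quadfE E dotpZl pmulr_rge0//.
have := dotp_ge0 (u - z - w).
rewrite !(dotpDl, dotpDr, dotpNl, dotpNr) (dotpC z u) (dotpC w u) (dotpC w z).
lra.
Qed.

Lemma det_shift_small A (e : R) : \det A = 0 -> 0 < e ->
  exists2 t : R, 0 < t & \det (A + t%:M) <= e.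
Proof.
move=> A0 e0; pose p := char_poly (- A).
have pE t : p.[t] = \det (A + t%:M).
  rewrite /p /char_poly /char_poly_mx -horner_evalE -det_map_mx; congr (\det _).
  apply/matrixP => i j; rewrite !mxE -[LHS]/(horner _ t) hornerD hornerN hornerC hornerMn hornerX.
  by rewrite opprK addrC.
have /cvgrPdist_le/(_ _ e0)/nbhs_ballP[d /= d0 dP] := @continuous_horner R p 0.
exists (d / 2); first by rewrite divr_gt0.
have := dP (d / 2); rewrite /ball/= sub0r normrN gtr0_norm ?divr_gt0//.
rewrite ltr_pdivrMr// mulr_natr mulr2n ltrDl => /(_ d0).
rewrite !pE (_ : 0%:M = 0) ?raddf0// addr0 A0 sub0r normrN.
by rewrite -pE => /(le_trans (ler_norm _)).
Qed.

(** The image of a ball of radius s is contained in the image, under A + t I, of a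
    ball whose radius is a multiple of s independent of t ([shift_contraction]):
    the error term, of size t s, is absorbed by the part t I.  The determinant of
    A + t I is as small as desired. *)
Lemma image_bound_singular G K (x : V) A (e : R) : sym A -> (forall v, 0 <= quadf A v) ->
  \det A = 0 -> derivative_mx G x A ->
  0 < e -> exists2 d : R, 0 < d & image_bound G K x e d.
Proof.
move=> sA A0 dA dG e0.
have k0 : 0 < (3 * n%:R + 1 : R) by rewrite ltr_wpDl// mulr_ge0.
have [t t0 Ht] := det_shift_small dA (divr_gt0 e0 (exprn_gt0 n k0)).
have pA := posdef_shift sA A0 t0.
set At := A + t%:M in Ht pA.
have [dAt _] := leb_posdef pA.
have uA : At \in unitmx by rewrite unitmxE unitfE gt_eqF.
have [d d0 dP] := dG _ t0.
exists (d / 2); first by rewrite divr_gt0.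
apply: image_bound_of_sub => c s /andP[s0 sd] xc.
have r0 : 0 < (3 * n%:R + 1) * s by rewrite mulr_gt0.
pose b := G x + (c - x) *m A.
exists [set z | ball (0 : V) ((3 * n%:R + 1) * s) ((z - b) *m invmx At)]; split.
- exact: measurable_posdef_ball.
- move=> _ [y cy <-] /=.
  have xy : ball x (s + s) y by apply: ball_triangle cy; exact: ball_sym.
  move: xy; rewrite -ball_normE /= distrC => xy.
  have yd : `|y - x| < d by rewrite (lt_le_trans xy)//; lra.
  have := dP _ yd; rewrite (_ : x + (y - x) = y) => [Hw|]; last by rewrite addrC subrK.
  pose w := t^-1 *: (G y - G x - (y - x) *m A).
  set u := (G y - b) *m invmx At.
  have Eu : u *m At = (y - c) *m A + t *: w.
    rewrite mulmxKV// /w scalerA divff ?gt_eqF// scale1r /b.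
    by rewrite !mulmxBl; apply/rowP => i; rewrite !mxE; ring.
  have wn : `|w| <= 2 * s.
    rewrite normrZ gtr0_norm ?invr_gt0// mulrC ler_pdivrMr//.
    by rewrite (le_trans Hw)// mulrC ler_pM2r// (le_trans (ltW xy))// mulr_natl mulr2n.
  have zn : `|y - c| <= s.
    by move: cy; rewrite -ball_normE /= distrC => /ltW.
  rewrite sub0r normrN.
  apply: (@le_lt_trans _ _ (n%:R * (3 * s))); last first.
    by rewrite -subr_gt0 (_ : _ - _ = s)//; ring.
  apply: norm_le_dotp; first by rewrite mulr_ge0// ltW.
  rewrite (le_trans (shift_contraction A0 t0 Eu))//.
  rewrite (le_trans (lerD (dotp_le_norm zn) (dotp_le_norm wn)))// -mulrDr ler_wpM2l//.
  by have := sqr_ge0 s; rewrite !exprMn; lra.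
- rewrite leb_posdef_ball// lee_fin (mulrCA 2) exprMn mulrA ler_wpM2r//.
    by rewrite exprn_ge0// mulr_ge0// ltW.
  by rewrite -ler_pdivlMr// exprn_gt0.
Qed.

End ImageBounds.

(** * Differentiability of locally Lipschitz gradients *)

Section Differentiability.
Context {R : realType} {n : nat}.
Local Notation V := 'rV[R]_n.
Implicit Types (G : V -> V) (Omega : set V).

Lemma common_radius (I : finType) (P : I -> R -> Prop) :
  (forall i d d', d' <= d -> P i d -> P i d') ->
  (forall i, exists2 d : R, 0 < d & P i d) -> exists2 d : R, 0 < d & forall i, P i d.
Proof.
move=> mono H.
have /choice[d dP] : forall i, exists d, 0 < d /\ P i d by move=> i; have [d ? ?] := H i; exists d.
exists (\big[Num.min/1]_i d i).
  by apply: lt_bigmin => // i _; have [] := dP i.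
by move=> i; have [_] := dP i; apply: mono; exact: bigmin_le.
Qed.

(** A Lipschitz retraction onto a closed ball of the sup norm: it extends functions
    that are Lipschitz on a ball only. *)
Definition clamp (q : V) (r : R) (x : V) : V :=
  \row_i Num.max (q ord0 i - r) (Num.min (x ord0 i) (q ord0 i + r)).

Lemma clamp_in q r x : 0 <= r -> `|clamp q r x - q| <= r.
Proof.
move=> r0; apply/norm_rV_le => // i; rewrite !mxE ler_distl.
rewrite le_max lexx/= ge_max ge_min lexx orbT andbT.
by rewrite lerD2l ge0_cp.
Qed.

Lemma clamp_id q r x : ball q r x -> clamp q r x = x.
Proof.
move=> [r0 xq]; apply/rowP => i; rewrite mxE.
have := xq ord0 i; rewrite /ball/= ltr_distl => /andP[? ?].
by rewrite min_l ?max_r//; lra.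
Qed.

Lemma max_lipschitz (a b c : R) : `|Num.max a b - Num.max a c| <= `|b - c|.
Proof.
have := ler_norm (b - c); have := ler_norm (c - b); rewrite distrC ler_norml.
by case: (leP a b) => ?; case: (leP a c) => ? *; apply/andP; split; lra.
Qed.

Lemma min_lipschitz (a b c : R) : `|Num.min b a - Num.min c a| <= `|b - c|.
Proof.
have := ler_norm (b - c); have := ler_norm (c - b); rewrite distrC ler_norml.
by case: (leP b a) => ?; case: (leP c a) => ? *; apply/andP; split; lra.
Qed.

Lemma clamp_lipschitz q r x y : `|clamp q r x - clamp q r y| <= `|x - y|.
Proof.
apply/norm_rV_le => // i.
have := norm_coord_le (x - y) i; rewrite !mxE; apply: le_trans.
rewrite (le_trans (max_lipschitz _ _ _))//.
exact: min_lipschitz.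
Qed.

Lemma ae_derivative_mx_ball G (q : V) (r L : R) : 0 < r -> 0 <= L ->
  (forall y z, ball q (2 * r) y -> ball q (2 * r) z -> `|G y - G z| <= L * `|y - z|) ->
  (leb n).-negligible [set x | ball q r x /\ ~ exists A, derivative_mx G x A].
Proof.
move=> r0 L0 lipG.
pose F (i : 'I_n) x := G (clamp q r x) ord0 i.
have qB x : ball q (2 * r) (clamp q r x).
  rewrite -ball_normE /= distrC (le_lt_trans (clamp_in _ _ (ltW r0)))//.
  by rewrite mulr_natl mulr2n ltrDl.
have lipF i x y : `|F i x - F i y| <= L * `|x - y|.
  apply: (@le_trans _ _ (L * `|clamp q r x - clamp q r y|)).
    apply: le_trans (lipG _ _ (qB x) (qB y)).
    by have := norm_coord_le (G (clamp q r x) - G (clamp q r y)) i; rewrite !mxE.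
  by rewrite ler_wpM2l// clamp_lipschitz.
have : {ae leb n, forall x, forall i, exists a, forall e : R, 0 < e ->
     exists2 d, 0 < d & near_affine (F i) a x e d}.
  apply: (@filter_forall _ _ _ _ (ae_filter_ringOfSetsType (leb n))) => i.
  exact: rademacher (lipF i).
apply: negligibleS => x [xq nA] /= H; apply: nA.
have /choice[a aP] := H.
exists (\matrix_(j, i) a i ord0 j) => e e0.
have [d d0 dP] : exists2 d, 0 < d & forall i, near_affine (F i) (a i) x e d.
  apply: common_radius => [i d d' dd' Hd y yd|i]; last exact: aP.
  by apply: Hd; exact: lt_le_trans dd'.
have /nbhs_ballP[d' /= d'0 d'P] : nbhs x (ball q r).
  by apply: open_nbhs_nbhs; split=> //; exact: ball_open.
exists (Num.min d d'); first by rewrite lt_min d0.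
move=> y; rewrite lt_min => /andP[yd yd'].
have xyq : ball q r (x + y).
  by apply: d'P; rewrite -ball_normE /= opprD addrA subrr sub0r normrN.
apply/norm_rV_le => [|i]; first by rewrite mulr_ge0// ltW.
have := dP i y yd; rewrite /F !clamp_id//.
congr (`|_| <= _); rewrite [in RHS]mxE [X in _ = X + _]mxE.
congr (_ + _); first by rewrite [in RHS]mxE.
rewrite [in RHS]mxE [X in _ = - X]mxE; congr (- _).
by apply: eq_bigr => j _; rewrite [in RHS]mxE mulrC.
Qed.

(** Countably many rational balls on which G is Lipschitz cover Omega. *)
Lemma ae_derivative_mx G Omega : 
  (forall x, Omega x -> exists r L : R, [/\ 0 < r, 0 <= L &
     forall y z, ball x r y -> ball x r z -> `|G y - G z| <= L * `|y - z|]) ->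
  (leb n).-negligible [set x | Omega x /\ ~ exists A, derivative_mx G x A].
Proof.
move=> H.
pose Q (p : 'rV[rat]_n * nat) : V := map_mx ratr p.1.
pose r (p : 'rV[rat]_n * nat) : R := p.2.+1%:R^-1.
have r0 p : 0 < r p by rewrite invr_gt0.
pose good p := exists L : R, 0 <= L /\ forall y z, ball (Q p) (2 * r p) y ->
  ball (Q p) (2 * r p) z -> `|G y - G z| <= L * `|y - z|.
pose bad p := if pselect (good p) then
  [set x | ball (Q p) (r p) x /\ ~ exists A, derivative_mx G x A] else set0.
have negb p : (leb n).-negligible (bad p).
  rewrite /bad; case: pselect => [[L [L0 HL]]|_] /=; last exact: negligible_set0.
  exact: ae_derivative_mx_ball HL.
suff : (leb n).-negligible (\bigcup_k (if unpickle k is Some p then bad p else set0)).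
  apply: negligibleS => x [Ox nA].
  have [d [L [d0 L0 HL]]] := H x Ox.
  have d40 : 0 < d / 4 by rewrite divr_gt0.
  pose k := Num.bound (d / 4)^-1.
  have kd : k.+1%:R^-1 < d / 4 := inv_nat_lt d40.
  have k0 : 0 < (k.+1%:R^-1 : R) by rewrite invr_gt0.
  have /choice[q qP] : forall i, exists q : rat, `|ratr q - x ord0 i| < k.+1%:R^-1 :> R.
    move=> i; have := @rat_in_itvoo R (x ord0 i - k.+1%:R^-1) (x ord0 i + k.+1%:R^-1).
    rewrite ltrD2l gtrN// => /(_ isT)[q]; rewrite in_itv/= => qx; exists q.
    by rewrite ltr_distl.
  exists (pickle (\row_i q i, k)) => //; rewrite pickleK /bad.
  have xQ : ball (Q (\row_i q i, k)) (r (\row_i q i, k)) x.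
    by apply/ball_rVP => // i; rewrite !mxE.
  case: pselect => //= -[]; exists L; split=> // y z yB zB; apply: HL.
    have := ball_triangle (ball_sym xQ) yB; apply: le_ball.
    by rewrite /r/=; move: (k.+1%:R^-1 : R) kd => w; lra.
  have := ball_triangle (ball_sym xQ) zB; apply: le_ball.
  by rewrite /r/=; move: (k.+1%:R^-1 : R) kd => w; lra.
apply: negligible_bigcup => k; case: (unpickle k) => [p|]; [exact: negb|exact: negligible_set0].
Qed.

Lemma derive_grad (h : V -> R) (x v : V) : differentiable h x -> 'D_v h x = dotp (grad h x) v.
Proof.
move=> dh; rewrite deriveE// [in LHS](row_sum_delta v) linear_sum.
apply: eq_bigr => i _; rewrite linearZ/= mxE /partial deriveE//.
by rewrite mulrC.
Qed.

Lemma is_derive_line (h : V -> R) (x v : V) (t : R) : differentiable h (x + t *: v) ->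
  is_derive t 1 (fun s : R => h (x + s *: v)) (dotp (grad h (x + t *: v)) v).
Proof.
move=> dh; rewrite -derive_grad//.
have dv : derivable h (x + t *: v) v by exact: diff_derivable.
pose f1 (k : R) := k^-1 *: (((fun s : R => h (x + s *: v)) \o shift t) (k *: (1 : R)) - h (x + t *: v)).
pose f2 (k : R) := k^-1 *: ((h \o shift (x + t *: v)) (k *: v) - h (x + t *: v)).
have E : f1 = f2.
  apply/funext => k; rewrite /f1 /f2 /=; congr (_ *: (h _ - _)).
  by rewrite [k *: 1]mulr1 scalerDl addrCA.
by apply: DeriveDef; [rewrite /derivable -/f1 E|rewrite /derive -/f1 E].
Qed.

Lemma MVT01 (f df : R -> R) : (forall t : R, 0 <= t <= 1 -> is_derive t 1 f (df t)) ->
  exists2 t : R, 0 <= t <= 1 & f 1 - f 0 = df t.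
Proof.
move=> fdf; have [|||c] := @MVT R f df 0 1.
- exact: ltr01.
- by move=> t; rewrite in_itv/= => /andP[? ?]; apply: fdf; rewrite !ltW.
- apply: derivable_within_continuous => t; rewrite in_itv/= => t01.
  by have [] := fdf t t01.
rewrite in_itv/= => /andP[c0 c1]; rewrite subr0 mulr1 => E.
by exists c => //; rewrite !ltW.
Qed.

Lemma line_MVT (h : V -> R) (x v : V) (a b : R) :
  (forall t : R, 0 <= t <= 1 -> differentiable h (x + t *: v)) ->
  exists2 t : R, 0 <= t <= 1 &
    h (x + v) - h x - a - b = dotp (grad h (x + t *: v)) v - a - 2 * b * t.
Proof.
move=> dh.
pose f (s : R) := h (x + s *: v) - a * s - b * s ^+ 2.
have df (t : R) : 0 <= t <= 1 ->
    is_derive t 1 f (dotp (grad h (x + t *: v)) v - a - 2 * b * t).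
  move=> t01; have ? := is_derive_line (dh t t01).
  apply: is_derive_eq; rewrite /GRing.scale/=; ring.
have [t t01 E] := MVT01 df; exists t => //.
rewrite -E /f scale1r scale0r addr0; ring.
Qed.

Lemma ball_line (x v : V) (r t : R) : `|v| < r -> 0 <= t <= 1 -> ball x r (x + t *: v).
Proof.
move=> vr /andP[t0 t1]; rewrite -ball_normE /= opprD addrA subrr sub0r normrN normrZ.
by rewrite (le_lt_trans _ vr)// ger0_norm// ler_piMl.
Qed.

Lemma dotp_norm (a y : V) : `|dotp a y| <= n%:R * `|a| * `|y|.
Proof. by apply: dotp_norm_le => // i; exact: norm_coord_le. Qed.

(** The mean value theorem on segments turns the first order expansion of the
    gradient into a second order expansion of h. *)
Lemma taylor2 (h : V -> R) (x : V) A (r : R) : 0 < r ->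
  (forall y, ball x r y -> differentiable h y) -> derivative_mx (grad h) x A ->
  forall e : R, 0 < e -> exists2 d : R, 0 < d & forall v, `|v| < d ->
    `|h (x + v) - h x - dotp (grad h x) v - quadf A v / 2| <= e * `|v| ^+ 2.
Proof.
move=> r0 dh dG e e0.
have n1 : 0 < (n%:R + 1 : R) by rewrite ltr_wpDl.
have [d d0 dP] := dG _ (divr_gt0 e0 n1).
exists (Num.min d r); first by rewrite lt_min d0.
move=> v; rewrite lt_min => /andP[vd vr].
have [t t01 ->] := @line_MVT h x v (dotp (grad h x) v) (quadf A v / 2)
  (fun t t01 => dh _ (ball_line x vr t01)).
have -> : dotp (grad h (x + t *: v)) v - dotp (grad h x) v - 2 * (quadf A v / 2) * t =
    dotp (grad h (x + t *: v) - grad h x - (t *: v) *m A) v.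
  by rewrite !(dotpDl, dotpNl) quadfE -scalemxAl dotpZl; field.
rewrite (le_trans (dotp_norm _ _))//.
have tv : `|t *: v| <= `|v|.
  by case/andP: t01 => ? ?; rewrite normrZ ger0_norm// ler_piMl.
have := dP _ (le_lt_trans tv vd) => H.
rewrite (@le_trans _ _ (n%:R * (e / (n%:R + 1) * `|v|) * `|v|))//.
  rewrite ler_wpM2r// ler_wpM2l// (le_trans H)// ler_wpM2l// divr_ge0// ltW//.
rewrite expr2 mulrA [X in _ <= X]mulrA ler_wpM2r// mulrA ler_wpM2r//.
by rewrite ler_pdivrMr// mulrC ler_pM2l// lerDl.
Qed.

(** Both sides of the symmetry are the limit of the same second difference. *)
Lemma derivative_mx_sym (h : V -> R) (x : V) A (r : R) : 0 < r ->
  (forall y, ball x r y -> differentiable h y) -> derivative_mx (grad h) x A -> sym A.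
Proof.
move=> r0 dh dG.
have key (e : R) : 0 < e -> exists2 d : R, 0 < d & forall v w (s : R), 0 < s -> s < d ->
    `|v| <= s -> `|w| <= s ->
    `|h (x + v + w) - h (x + v) - (h (x + w) - h x) - dotp (v *m A) w| <= e * s ^+ 2.
  move=> e0.
  have n1 : 0 < (3 * n%:R + 1 : R) by rewrite ltr_wpDl// mulr_ge0.
  have [d d0 dP] := dG _ (divr_gt0 e0 n1).
  exists (Num.min d r / 2); first by rewrite divr_gt0// lt_min d0.
  move=> v w s s0; rewrite ltr_pdivlMr// lt_min => /andP[sd sr] vs ws.
  have vw (t : R) : 0 <= t <= 1 -> `|v + t *: w| <= s * 2 /\ `|t *: w| <= s.
    move=> /andP[t0 t1]; have tw : `|t *: w| <= s.
      by rewrite normrZ ger0_norm// (le_trans _ ws)// ler_piMl.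
    by split=> //; rewrite (le_trans (ler_normD _ _))// mulr_natr mulr2n lerD.
  have inb u : `|u| <= s * 2 -> ball x r (x + u).
    move=> us; rewrite -ball_normE /= opprD addrA subrr sub0r normrN.
    exact: le_lt_trans sr.
  have s2 : s <= s * 2 by lra.
  pose F (t : R) := h (x + v + t *: w) - h (x + t *: w).
  have dF (t : R) : 0 <= t <= 1 -> is_derive t 1 F
      (dotp (grad h (x + v + t *: w)) w - dotp (grad h (x + t *: w)) w).
    move=> t01; have [vtw tw] := vw t t01.
    have ? : is_derive t 1 (fun s : R => h (x + v + s *: w)) (dotp (grad h (x + v + t *: w)) w).
      by apply: is_derive_line; rewrite -addrA; apply: dh; exact: inb.
    have ? : is_derive t 1 (fun s : R => h (x + s *: w)) (dotp (grad h (x + t *: w)) w).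
      by apply: is_derive_line; apply: dh; apply: inb; exact: le_trans s2.
    exact: is_deriveB.
  have [t t01] := MVT01 dF; have [vtw tw] := vw t t01.
  rewrite /F scale1r scale0r !addr0 => E.
  have -> : h (x + v + w) - h (x + v) - (h (x + w) - h x) - dotp (v *m A) w =
      dotp (grad h (x + (v + t *: w)) - grad h x - (v + t *: w) *m A) w -
      dotp (grad h (x + t *: w) - grad h x - (t *: w) *m A) w.
    rewrite mulmxDl !(dotpDl, dotpNl) addrA.
    move: E; move: (h _) (h _) (h _) (h _) (dotp _ _) (dotp _ _) (dotp _ _) (dotp _ _) => *; lra.
  have H1 := dP _ (le_lt_trans vtw sd).
  have H2 := dP _ (le_lt_trans (le_trans tw s2) sd).
  rewrite (le_trans (ler_normB _ _))// (le_trans (lerD (dotp_norm _ _) (dotp_norm _ _)))//.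
  pose q := e / (3 * n%:R + 1).
  have q0 : 0 <= q by rewrite divr_ge0// ltW.
  have B1 : `|grad h (x + (v + t *: w)) - grad h x - (v + t *: w) *m A| <= q * (s * 2).
    by rewrite (le_trans H1)// ler_wpM2l.
  have B2 : `|grad h (x + t *: w) - grad h x - (t *: w) *m A| <= q * s.
    by rewrite (le_trans H2)// ler_wpM2l.
  apply: (@le_trans _ _ (n%:R * (q * (s * 2)) * s + n%:R * (q * s) * s)).
    by apply: lerD; apply: ler_pM => //; rewrite ?mulr_ge0// ler_wpM2l.
  have -> : n%:R * (q * (s * 2)) * s + n%:R * (q * s) * s = (3 * n%:R * q) * s ^+ 2 by ring.
  rewrite ler_wpM2r ?sqr_ge0// /q mulrCA ger_pMr// ler_pdivrMr// mul1r lerDl//.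
suff E v w : dotp (v *m A) w = dotp (w *m A) v.
  apply/matrixP => i j; have := E (delta_mx ord0 i) (delta_mx ord0 j).
  have D k l : dotp (delta_mx ord0 k *m A) (delta_mx ord0 l) = A k l.
    by rewrite -[delta_mx ord0 l]scale1r dotp_delta mulr1 -rowE mxE.
  by rewrite !D mxE => ->.
pose m := Num.max 1 (Num.max `|v| `|w|).
have m0 : 0 < m by rewrite lt_max ltr01.
apply/eqP; rewrite -subr_eq0 -normr_le0; apply/ler_addgt0Pr => e e0; rewrite add0r.
have e20 : 0 < e / (2 * m ^+ 2) by rewrite divr_gt0// mulr_gt0// exprn_gt0.
have [d d0 dP] := key _ e20.
pose t := d / (2 * m).
have t0 : 0 < t by rewrite divr_gt0// mulr_gt0.
have tm : t * m < d.
  by rewrite /t invfM mulrA mulfVK ?gt_eqF// ltr_pdivrMr// mulr_natr mulr2n ltrDl.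
have tm0 : 0 < t * m by rewrite mulr_gt0.
have tv : `|t *: v| <= t * m.
  by rewrite normrZ gtr0_norm// ler_pM2l// !le_max lexx orbT.
have tw : `|t *: w| <= t * m.
  by rewrite normrZ gtr0_norm// ler_pM2l// !le_max lexx !orbT.
have K1 := dP _ _ _ tm0 tm tv tw; have K2 := dP _ _ _ tm0 tm tw tv.
have t20 : 0 < t ^+ 2 by rewrite exprn_gt0.
rewrite -(ler_pM2l t20) -[X in X * _ <= _](gtr0_norm t20) -normrM.
have -> : t ^+ 2 * (dotp (v *m A) w - dotp (w *m A) v) =
  dotp (t *: v *m A) (t *: w) - dotp (t *: w *m A) (t *: v).
  by rewrite -!scalemxAl !dotpZl !dotpZr; ring.
move: K1 K2; rewrite (addrAC x (t *: w)).
have -> : e / (2 * m ^+ 2) * (t * m) ^+ 2 = t ^+ 2 * e / 2 by field; rewrite gt_eqF.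
move: (h _) (h _) (h _) (h _) (dotp _ _) (dotp _ _) => c1 c2 c3 c4 c5 c6.
by rewrite !ler_norml => /andP[? ?] /andP[? ?]; apply/andP; split; lra.
Qed.

End Differentiability.

(** * Location of the roots of complex polynomials *)

Section ComplexNorm.
Context {R : realType}.
Local Notation C := R[i].
Local Notation rc := (real_complex R).
(* the modulus as an element of R; the norm of the ring R[i] has values in R[i] *)
Local Notation nc := (@complex.ComplexField.Normc.normc R).
Implicit Types (z w t : C).

Lemma ncE z : nc z = Num.sqrt (complex.Re z ^+ 2 + complex.Im z ^+ 2).
Proof. by case: z. Qed.

Lemma nc_ge0 z : 0 <= nc z.
Proof. by rewrite ncE sqrtr_ge0. Qed.

Lemma nc_rc (x : R) : nc (rc x) = `|x|.
Proof. by rewrite ncE /= expr0n addr0 sqrtr_sqr. Qed.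

Lemma nc_Re z : `|complex.Re z| <= nc z.
Proof. by rewrite ncE -sqrtr_sqr ler_wsqrtr// lerDl sqr_ge0. Qed.

Lemma nc_Im z : `|complex.Im z| <= nc z.
Proof. by rewrite ncE -sqrtr_sqr ler_wsqrtr// lerDr sqr_ge0. Qed.

Lemma ncM z w : nc (z * w) = nc z * nc w.
Proof. exact: complex.ComplexField.Normc.normcM. Qed.

Lemma ncN z : nc (- z) = nc z.
Proof. by rewrite !ncE; case: z => a b /=; rewrite !sqrrN. Qed.

Lemma ncD z w : nc (z + w) <= nc z + nc w.
Proof. exact: le_normcD. Qed.

Lemma nc0 : nc 0 = 0. Proof. by rewrite -[0](rmorph0 rc) nc_rc normr0. Qed.
Lemma nc1 : nc 1 = 1. Proof. by rewrite -[1](rmorph1 rc) nc_rc normr1. Qed.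

Lemma nc_eq0 z : nc z = 0 -> z = 0.
Proof. exact: complex.ComplexField.Normc.eq0_normc. Qed.

Lemma nc_prod (I : Type) (s : seq I) (F : I -> C) :
  nc (\prod_(i <- s) F i) = \prod_(i <- s) nc (F i).
Proof. by elim/big_rec2 : _ => [|i y z _ <-]; rewrite ?nc1// ncM. Qed.

Lemma nc_sum (I : Type) (s : seq I) (F : I -> C) :
  nc (\sum_(i <- s) F i) <= \sum_(i <- s) nc (F i).
Proof.
elim/big_rec2 : _ => [|i y z _ h]; first by rewrite nc0.
by rewrite (le_trans (ncD _ _))// lerD2l.
Qed.

Lemma ncB_sub z w : nc z - nc w <= nc (z - w).
Proof. by rewrite lerBlDr (le_trans _ (ncD _ _))// subrK. Qed.

(** [N] is a formal degree: the coefficient [c] may vanish. *)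
Definition has_lead (N : nat) (c : C) (p : {poly C}) := (size p <= N.+1)%N /\ p`_N = c.

Lemma has_lead_factor N c p : c != 0 -> has_lead N c p ->
  exists2 rs : seq C, size rs = N & p = c *: \prod_(r <- rs) ('X - r%:P).
Proof.
move=> c0 [sp pN].
have szp : size p = N.+1.
  apply/eqP; rewrite eqn_leq sp /= ltnNge; apply: contra c0 => sz.
  by rewrite -pN nth_default.
have lp : lead_coef p = c by rewrite lead_coefE szp.
have [rs prs] := closed_field_poly_normal p.
exists rs; last by rewrite {1}prs lp.
have := congr1 (fun q : {poly C} => size q) prs.
by rewrite /= size_scale ?lp// size_prod_XsubC szp => -[].
Qed.

Lemma nc_factor c (rs : seq C) t :
  nc ((c *: \prod_(r <- rs) ('X - r%:P)).[t]) = nc c * \prod_(r <- rs) nc (t - r).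
Proof.
rewrite hornerZ ncM horner_prod nc_prod; congr (_ * _).
by apply: eq_bigr => r _; rewrite !hornerE.
Qed.

Lemma root_factor c (rs : seq C) r : r \in rs ->
  root (c *: \prod_(r <- rs) ('X - r%:P)) r.
Proof. by move=> rrs; rewrite rootE hornerZ (eqP (_ : root _ r)) ?mulr0// root_prod_XsubC. Qed.

Lemma nc_away N c p t (d : R) : c != 0 -> has_lead N c p -> 0 <= d ->
  (forall r, root p r -> d <= nc (t - r)) -> nc c * d ^+ N <= nc p.[t].
Proof.
move=> c0 lp d0 away; have [rs sz pE] := has_lead_factor c0 lp.
rewrite pE nc_factor ler_wpM2l ?nc_ge0// -sz.
have : forall r, r \in rs -> d <= nc (t - r).
  by move=> r rrs; apply: away; rewrite pE root_factor.
elim: {pE sz} rs => [|r rs IH] h; first by rewrite big_nil expr0.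
rewrite big_cons exprS ler_pM ?exprn_ge0//; first by apply: h; rewrite mem_head.
by apply: IH => s srs; apply: h; rewrite inE srs orbT.
Qed.

Lemma nc_growth N c p (D : set C) : c != 0 -> has_lead N c p ->
  (forall r, root p r -> exists2 d : R, 0 < d & forall t, D t -> d <= nc (t - r)) ->
  exists2 k : R, 0 < k & forall t, D t -> k * (1 + nc t) ^+ N <= nc p.[t].
Proof.
move=> c0 lp away; have [rs sz pE] := has_lead_factor c0 lp.
have {away} away r : r \in rs -> exists2 d : R, 0 < d & forall t, D t -> d <= nc (t - r).
  by move=> rrs; apply: away; rewrite pE root_factor.
have nc0c : 0 < nc c.
  by rewrite lt_neqAle nc_ge0 andbT eq_sym; apply: contra c0 => /eqP/nc_eq0 ->.
suff [k k0 H] : exists2 k : R, 0 < k & forall t, D t ->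
    k * (1 + nc t) ^+ size rs <= \prod_(r <- rs) nc (t - r).
  exists (nc c * k); first by rewrite mulr_gt0.
  by move=> t Dt; rewrite pE nc_factor -mulrA ler_pM2l// -sz; exact: H.
elim: {pE sz} rs away => [|r rs IH] away.
  by exists 1 => // t _; rewrite big_nil expr0 mulr1.
have [|k k0 H] := IH; first by move=> s srs; apply: away; rewrite inE srs orbT.
have [d d0 dP] := away r (mem_head _ _).
have m0 : 0 < 1 + nc r + d by rewrite ltr_wpDl// addr_ge0// nc_ge0.
exists (d / (1 + nc r + d) * k); first by rewrite mulr_gt0// divr_gt0.
move=> t Dt; rewrite big_cons /= exprS mulrACA ler_pM//.
- by rewrite mulr_ge0 ?divr_ge0 ?(ltW d0) ?(ltW m0)// addr_ge0// nc_ge0.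
- by rewrite mulr_ge0 ?(ltW k0)// exprn_ge0// addr_ge0// nc_ge0.
- rewrite mulrAC ler_pdivrMr//.
  have := dP t Dt; have := ncB_sub t r; have := nc_ge0 r; have := nc_ge0 t.
  by move: (nc t) (nc r) (nc (t - r)) => x y z x0 y0 xy dz; nra.
- exact: H.
Qed.

(** Z confines the roots of a connected family of polynomials of the same degree
    and leading coefficient, and D is separated from its complement within Z.
    The set of parameters without root in D is open, because the polynomial
    grows at least like (1 + |t|)^N on D, and closed, because the modulus at a
    point t of D and Z is bounded below by a power of its distance to the rest
    of Z. *)
Lemma root_confinement (X : topologicalType) (A : set X) (T : X -> {poly C})
    (N : nat) (c : C) (D Z : set C) (b0 : X) :
  connected A -> c != 0 -> A b0 -> (forall b, A b -> has_lead N c (T b)) ->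
  (forall b r, A b -> root (T b) r -> Z r) ->
  (forall t, D t -> Z t -> exists2 d : R, 0 < d & forall r, Z r -> ~ D r -> d <= nc (t - r)) ->
  (forall r, Z r -> ~ D r -> exists2 d : R, 0 < d & forall t, D t -> d <= nc (t - r)) ->
  (forall b, A b -> forall e : R, 0 < e -> \forall b' \near b, A b' ->
     forall t, D t -> nc ((T b').[t] - (T b).[t]) <= e * (1 + nc t) ^+ N) ->
  (forall r, D r -> ~ root (T b0) r) -> forall b r, A b -> D r -> ~ root (T b) r.
Proof.
move=> cA c0 Ab0 lead inZ sep1 sep2 cont S0.
pose S := [set b | A b /\ forall r, D r -> ~ root (T b) r].
have nc0c : 0 < nc c.
  by rewrite lt_neqAle nc_ge0 andbT eq_sym; apply: contra c0 => /eqP/nc_eq0 ->.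
have nct t : 0 < 1 + nc t by rewrite ltr_pwDl// nc_ge0.
suff SA : S = A by move=> b r Ab; move: Ab; rewrite -SA => -[_]; apply.
apply: cA.
- by exists b0; split.
- exists (interior [set b | A b -> S b]); first exact: open_interior.
  apply/seteqP; split=> [b Sb|b [Ab /interior_subset]]; last exact.
  have [Ab Sbr] := Sb; split=> //.
  have [k k0 kP] : exists2 k : R, 0 < k & forall t, D t -> k * (1 + nc t) ^+ N <= nc (T b).[t].
    apply: (nc_growth c0 (lead b Ab)) => r rb; apply: sep2; first exact: inZ rb.
    by move=> Dr; exact: Sbr rb.
  have := cont b Ab (k / 2) (divr_gt0 k0 (ltr0Sn _ _)).
  rewrite /interior/=; apply: filterS => b' H Ab'; split=> // t Dt /eqP rt.
  have := H Ab' t Dt; rewrite rt sub0r ncN.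
  move=> /(le_trans (kP t Dt)); rewrite leNgt => /negP; apply.
  by rewrite ltr_pM2r ?exprn_gt0// ltr_pdivrMr// mulr_natr mulr2n ltrDl.
- exists (closure S); first exact: closed_closure.
  apply/seteqP; split=> [b Sb|b [Ab clS]].
    by split; [have [] := Sb|exact: subset_closure].
  split=> // t Dt rt.
  have [d d0 dP] := sep1 t Dt (inZ b t Ab rt).
  pose e := nc c * d ^+ N / (2 * (1 + nc t) ^+ N).
  have e0 : 0 < e by rewrite divr_gt0 ?mulr_gt0 ?exprn_gt0.
  have [b' [[Ab' Sb'] H]] := clS _ (cont b Ab e e0).
  have := H Ab' t Dt; move/eqP : rt => ->; rewrite subr0.
  have : nc c * d ^+ N <= nc (T b').[t].
    apply: nc_away; [exact: c0|exact: lead|exact: ltW|].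
    move=> r rb'; apply: dP; first exact: inZ rb'.
    by move=> Dr; exact: Sb' rb'.
  move=> /le_trans /[apply]; rewrite leNgt => /negP; apply.
  rewrite /e invfM mulrA mulfVK ?gt_eqF ?exprn_gt0//.
  by rewrite ltr_pdivrMr// mulr_natr mulr2n ltrDl mulr_gt0// exprn_gt0.
Qed.

End ComplexNorm.

(** * Hyperbolic polynomials positive on the orthant *)

Section Homogeneous.
Context {R : realType}.
Local Notation C := R[i].
Local Notation rc := (real_complex R).
Local Notation nc := (@complex.ComplexField.Normc.normc R).
Local Notation homog N P := (P \is mpoly.ishomog1 N (@mpoly.mdeg _)).

Section has_lead.
Implicit Types (f g : {poly C}).

Lemma has_leadM p q a b f g : has_lead p a f -> has_lead q b g ->
  has_lead (p + q) (a * b) (f * g).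
Proof.
move=> [sf fp] [sg gq]; split.
  rewrite (leq_trans (size_polyMleq _ _))// -subn1 leq_subLR.
  by rewrite (leq_trans (leq_add sf sg))// addSn addnS add1n.
rewrite coefM (bigD1 (inord p : 'I_(p + q).+1))//= inordK ?ltnS ?leq_addr//.
rewrite addKn fp gq big1 ?addr0// => i ip.
have {}ip : i != p :> nat.
  by apply: contra ip => /eqP ip; apply/eqP/val_inj; rewrite /= inordK ?ltnS ?leq_addr.
have [lt_ip|le_pi] := ltnP i p.
  by rewrite [g`__]nth_default ?mulr0// (leq_trans sg)// ltn_subRL ltn_add2r.
rewrite nth_default ?mul0r// (leq_trans sf)// ltn_neqAle eq_sym ip//.
Qed.

Lemma has_lead1 : has_lead 0 1 (1 : {poly C}).
Proof. by split; rewrite ?size_poly1 ?coef1. Qed.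

Lemma has_leadX p a f m : has_lead p a f -> has_lead (p * m) (a ^+ m) (f ^+ m).
Proof.
move=> fa; elim: m => [|m IH]; first by rewrite muln0 !expr0; exact: has_lead1.
by rewrite mulnS !exprS; exact: has_leadM.
Qed.

Lemma has_lead_line (w a : C) : has_lead 1 a (w%:P + a *: 'X).
Proof.
split; last by rewrite coefD coefC coefZ coefX mulr1 add0r.
rewrite (leq_trans (size_polyD _ _))// geq_max (leq_trans (size_polyC_leq1 _))//.
by rewrite (leq_trans (size_scale_leq _ _))// size_polyX.
Qed.

Lemma has_lead_sum N (I : eqType) (s : seq I) (c : I -> C) (f : I -> {poly C}) :
  (forall i, i \in s -> has_lead N (c i) (f i)) ->
  has_lead N (\sum_(i <- s) c i) (\sum_(i <- s) f i).
Proof.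
move=> H; split; last first.
  by rewrite coef_sum big_seq [RHS]big_seq; apply: eq_bigr => i /H[].
rewrite big_seq; apply: (leq_trans (size_sum _ _ _)).
by apply/bigmax_leqP_seq => i _ /H[].
Qed.

Lemma has_leadZ N c a f : has_lead N a f -> has_lead N (c * a) (c *: f).
Proof.
by move=> [sf fa]; split; rewrite ?coefZ ?fa// (leq_trans (size_scale_leq _ _)).
Qed.

End has_lead.

Definition evalC k (z : 'I_k -> C) (P : mpoly.mpoly k R) : C := mpoly.mmap rc z P.

(** t |-> P (w + t a) *)
Definition line k (w a : 'I_k -> C) (P : mpoly.mpoly k R) : {poly C} :=
  mpoly.mmap (polyC \o rc) (fun i => (w i)%:P + a i *: 'X) P.

Lemma evalCE k (z : 'I_k -> C) (P : mpoly.mpoly k R) :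
  evalC z P = \sum_(m <- mpoly.msupp P) rc (mpoly.mcoeff m P) * \prod_i z i ^+ m i.
Proof. by []. Qed.

Lemma lineE k (w a : 'I_k -> C) (P : mpoly.mpoly k R) :
  line w a P = \sum_(m <- mpoly.msupp P)
    (rc (mpoly.mcoeff m P)) *: \prod_i ((w i)%:P + a i *: 'X) ^+ m i.
Proof. by apply: eq_bigr => m _; rewrite /= mul_polyC. Qed.

Lemma horner_line k (w a : 'I_k -> C) P t :
  (line w a P).[t] = evalC (fun i => w i + a i * t) P.
Proof.
rewrite lineE evalCE horner_sum; apply: eq_bigr => m _.
rewrite hornerZ horner_prod; congr (_ * _); apply: eq_bigr => i _.
by rewrite horner_exp !hornerE.
Qed.

Lemma eq_evalC k (z w : 'I_k -> C) P : z =1 w -> evalC z P = evalC w P.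
Proof. by move=> zw; congr evalC; apply/funext. Qed.

Lemma homog_mdeg k N (P : mpoly.mpoly k R) m : homog N P -> m \in mpoly.msupp P ->
  (\sum_i m i)%N = N.
Proof. by move=> /mpoly.dhomogP h mP; rewrite -mpoly.mdegE; exact: h. Qed.

Lemma has_lead_prod_line k (w a : 'I_k -> C) (m : mpoly.multinom k) :
  has_lead (\sum_i m i)%N (\prod_i a i ^+ m i) (\prod_i ((w i)%:P + a i *: 'X) ^+ m i).
Proof.
elim: (index_enum _) => [|i s IH]; first by rewrite !big_nil; exact: has_lead1.
rewrite !big_cons; apply: has_leadM => //.
by rewrite -[X in has_lead X]mul1n; apply: has_leadX; exact: has_lead_line.
Qed.

Lemma has_lead_lineP k (w a : 'I_k -> C) N P : homog N P ->
  has_lead N (evalC a P) (line w a P).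
Proof.
move=> hP; rewrite lineE evalCE; apply: has_lead_sum => m mP; apply: has_leadZ.
by rewrite -(homog_mdeg hP mP); exact: has_lead_prod_line.
Qed.

Lemma evalC_scale k (z : 'I_k -> C) (c : C) N P : homog N P ->
  evalC (fun i => c * z i) P = c ^+ N * evalC z P.
Proof.
move=> hP; rewrite !evalCE mulr_sumr big_seq [RHS]big_seq; apply: eq_bigr => m mP.
rewrite mulrCA; congr (_ * _); rewrite -(homog_mdeg hP mP) expr_sum -big_split.
by apply: eq_bigr => i _; rewrite exprMn.
Qed.

Lemma evalC_real k (v : 'I_k -> R) P : evalC (fun i => rc (v i)) P = rc (mpoly.meval v P).
Proof.
rewrite evalCE mpoly.mevalE rmorph_sum; apply: eq_bigr => m _.
by rewrite rmorphM rmorph_prod; congr (_ * _); apply: eq_bigr => i _; rewrite rmorphXn.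
Qed.

(** Stable under products: the degrees p and the constants a add up. *)
Let close (rho d : R) (p : nat) (a : R) (z w : C) :=
  [/\ nc z <= rho ^+ p, nc w <= rho ^+ p & nc (z - w) <= a * d * rho ^+ p].

Let closeM rho d p q a b z w x y : 0 <= rho -> close rho d p a z w ->
  close rho d q b x y -> close rho d (p + q) (a + b) (z * x) (w * y).
Proof.
move=> rho0 [z1 w1 zw] [x1 y1 xy]; rewrite /close !ncM exprD.
split; [by rewrite ler_pM ?nc_ge0|by rewrite ler_pM ?nc_ge0|].
have -> : z * x - w * y = (z - w) * x + w * (x - y) by ring.
rewrite (le_trans (ncD _ _))// !ncM.
have -> : (a + b) * d * (rho ^+ p * rho ^+ q) =
  a * d * rho ^+ p * rho ^+ q + rho ^+ p * (b * d * rho ^+ q) by ring.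
by rewrite lerD// ler_pM ?nc_ge0.
Qed.

Lemma evalC_lipschitz k N (P : mpoly.mpoly k R) : homog N P ->
  exists2 K : R, 0 <= K & forall (rho d : R) (z w : 'I_k -> C), 1 <= rho -> 0 <= d ->
    (forall i, nc (z i) <= rho) -> (forall i, nc (w i) <= rho) ->
    (forall i, nc (z i - w i) <= d) ->
    nc (evalC z P - evalC w P) <= K * d * rho ^+ N.
Proof.
move=> hP.
exists (\sum_(m <- mpoly.msupp P) `|mpoly.mcoeff m P| * N%:R).
  by apply: sumr_ge0 => m _; rewrite mulr_ge0.
move=> rho d z w rho1 d0 zr wr zwd; rewrite !evalCE -sumrB.
have rho0 : 0 <= rho by exact: le_trans rho1.
rewrite (le_trans (nc_sum _ _))// !mulr_suml big_seq [X in _ <= X]big_seq.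
apply: ler_sum => m mP; rewrite -mulrBr ncM nc_rc -!mulrA ler_wpM2l// mulrA.
have c1 : close rho d 0 0 1 1.
  by split; rewrite ?nc1 ?expr0// subrr nc0 mul0r mul0r.
have cX i p : close rho d p p%:R (z i ^+ p) (w i ^+ p).
  elim: p => [|p IH]; first by rewrite !expr0; exact: c1.
  rewrite !exprS -nat1r -add1n; apply: closeM => //.
  split; rewrite ?expr1 ?mul1r//.
  by rewrite (le_trans (zwd i))// ler_peMr.
suff [_ _] : close rho d (\sum_i m i)%N (\sum_i m i)%:R
    (\prod_i z i ^+ m i) (\prod_i w i ^+ m i) by rewrite (homog_mdeg hP mP).
elim: (index_enum _) => [|i s IH]; first by rewrite !big_nil; exact: c1.
by rewrite !big_cons natrD; exact: closeM.
Qed.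

Definition dirderiv k (b : 'I_k -> R) (P : mpoly.mpoly k R) : mpoly.mpoly k R :=
  \sum_i b i *: mpoly.mderiv i P.

(** Both sides are derivations in P that agree on the variables. *)
Lemma deriv_line k (w : 'I_k -> C) (b : 'I_k -> R) (P : mpoly.mpoly k R) :
  (line w (fun i => rc (b i)) P)^`().[0] = evalC w (dirderiv b P).
Proof.
pose a i := rc (b i); rewrite -/a.
pose ok (Q : mpoly.mpoly k R) := (line w a Q)^`().[0] = evalC w (dirderiv b Q).
have lineD p q : line w a (p + q) = line w a p + line w a q by rewrite /line rmorphD.
have lineM p q : line w a (p * q) = line w a p * line w a q by rewrite /line rmorphM.
have line0 p : (line w a p).[0] = evalC w p.
  by rewrite horner_line; apply: eq_evalC => i; rewrite mulr0 addr0.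
have okC c : ok (mpoly.mpolyC _ c).
  rewrite /ok /line mpoly.mmapC derivC horner0 /dirderiv big1 /evalC ?rmorph0// => i _.
  by rewrite mpoly.mderivC scaler0.
have okD p q : ok p -> ok q -> ok (p + q).
  rewrite /ok lineD derivD hornerD => -> ->.
  rewrite -rmorphD/=; congr evalC; rewrite /dirderiv -big_split/=.
  by apply: eq_bigr => i _; rewrite mpoly.mderivD scalerDr.
have okM p q : ok p -> ok q -> ok (p * q).
  rewrite /ok lineM derivM hornerD !hornerM !line0 => -> ->.
  rewrite -!rmorphM -rmorphD/=; congr evalC.
  rewrite /dirderiv mulr_suml mulr_sumr -big_split/=.
  by apply: eq_bigr => i _; rewrite mpoly.mderivM scalerDr scalerAl scalerAr.
have dirX i : dirderiv b (mpoly.mpolyX R (mpoly.mnm1 i)) = mpoly.mpolyC k (b i).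
  rewrite /dirderiv (bigD1 i)//= big1 ?addr0 => [|j ji].
    rewrite mpoly.mderivX mpoly.mnm1E eqxx scale1r.
    have -> : mpoly.mnm_sub (mpoly.mnm1 i) (mpoly.mnm1 i) = mpoly.mnm0 by apply/mpoly.mnmP => j; rewrite mpoly.mnmBE mpoly.mnm0E subnn.
    by rewrite mpoly.mpolyX0 -mpoly.alg_mpolyC.
  by rewrite mpoly.mderivX mpoly.mnm1E eq_sym (negbTE ji) scale0r scaler0.
have okX i : ok (mpoly.mpolyX R (mpoly.mnm1 i)).
  rewrite /ok dirX /line mpoly.mmapX mpoly.mmap1U derivD derivC add0r derivZ derivX.
  by rewrite hornerZ hornerC mulr1 /evalC mpoly.mmapC.
have okXn i p : ok (mpoly.mpolyX R (mpoly.mnm1 i) ^+ p).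
  elim: p => [|p IH]; first by rewrite expr0 -mpoly.mpolyC1; exact: okC.
  by rewrite exprS; exact: okM.
rewrite (mpoly.mpolyE P) -[_ = _]/(ok _); apply: (big_ind ok).
- by rewrite -mpoly.mpolyC0; exact: okC.
- exact: okD.
move=> m _; rewrite -mpoly.mul_mpolyC; apply: (okM _ _ (okC _)).
rewrite mpoly.mpolyXE_id; apply: (big_ind ok) => //.
by rewrite -mpoly.mpolyC1; exact: okC.
Qed.

(** Continuity of t |-> P (w + t a) in w, uniform in t relative to the growth of a
    polynomial of degree N, as [root_confinement] requires. *)
Lemma line_close k N (P : mpoly.mpoly k R) (B : R) : homog N P -> 1 <= B ->
  exists2 K : R, 0 <= K & forall (w w' a : 'I_k -> C) t (d : R), 0 <= d ->
    (forall i, nc (w i) <= B) -> (forall i, nc (w' i) <= B) -> (forall i, nc (a i) <= B) ->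
    (forall i, nc (w i - w' i) <= d) ->
    nc ((line w a P).[t] - (line w' a P).[t]) <= K * d * (1 + nc t) ^+ N.
Proof.
move=> hP B1; have [K K0 KP] := evalC_lipschitz hP.
have B0 : 0 <= B by exact: le_trans B1.
exists (K * B ^+ N); first by rewrite mulr_ge0 ?exprn_ge0.
move=> w w' a t d d0 wB w'B aB ww'; rewrite !horner_line.
have -> : K * B ^+ N * d * (1 + nc t) ^+ N = K * d * (B * (1 + nc t)) ^+ N.
  by rewrite exprMn; ring.
have bnd u : (forall i, nc (u i) <= B) -> forall i, nc (u i + a i * t) <= B * (1 + nc t).
  move=> uB i; rewrite (le_trans (ncD _ _))// ncM mulrDr mulr1 lerD//.
  by rewrite ler_wpM2r ?nc_ge0.
apply: KP => //; [|exact: bnd|exact: bnd|].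
- by rewrite (le_trans B1)// ler_peMr// lerDl nc_ge0.
- by move=> i; rewrite opprD addrACA subrr addr0.
Qed.

Definition orthant k : set ('I_k -> R) := [set a | forall i, 0 < a i].

Definition hyperbolic k (e : 'I_k -> R) (P : mpoly.mpoly k R) :=
  forall (x : 'I_k -> R) z, evalC (fun i => rc (x i) + z * rc (e i)) P = 0 -> complex.Im z = 0.

Local Notation ii := ('i : C).

(** Hyperbolicity in the direction e excludes real roots of t |-> P (i al e + be x +
    t a) when al > 0.  For be = 0 all roots are in the lower half plane by
    homogeneity, and they stay there as be grows to 1; hence P does not vanish at
    i al e + x + i a, and its modulus there is bounded below independently of al,
    which can tend to 0. *)
Lemma tube_nonvanishing k N (P : mpoly.mpoly k R) (e x a : 'I_k -> R) : homog N P ->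
  (forall b, orthant b -> 0 < mpoly.meval b P) -> orthant e -> hyperbolic e P ->
  orthant a -> evalC (fun i => rc (x i) + ii * rc (a i)) P != 0.
Proof.
move=> hP Ppos e0 hypP a0.
pose la i := rc (a i).
pose B := 1 + \sum_i (`|e i| + `|x i| + `|a i|).
have B1 : 1 <= B by rewrite lerDl sumr_ge0// => i _; rewrite !addr_ge0.
have Bi i : `|e i| + `|x i| + `|a i| <= B.
  rewrite /B (bigD1 i)//= addrCA lerDl.
  by apply: addr_ge0 => //; apply: sumr_ge0 => j _; rewrite !addr_ge0.
have c0 : evalC la P != 0.
  by rewrite /la evalC_real fmorph_eq0 gt_eqF// Ppos.
have nci : nc ii = 1 by rewrite ncE /= expr0n expr1n add0r sqrtr1.
have im_i : complex.Im ii = 1 by [].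
pose w (al be : R) i := rc al * ii * rc (e i) + rc be * rc (x i).
have wB al be : 0 <= al <= 1 -> 0 <= be <= 1 -> forall i, nc (w al be i) <= B.
  move=> /andP[al0 al1] /andP[be0 be1] i; rewrite (le_trans _ (Bi i))//.
  rewrite (le_trans (ncD _ _))// !ncM !nc_rc nci mulr1 (ger0_norm al0) (ger0_norm be0).
  rewrite -[X in X <= _]addr0 lerD// lerD//.
    by rewrite -[leRHS]mul1r ler_wpM2r.
  by rewrite -[leRHS]mul1r ler_wpM2r.
have laB i : nc (la i) <= B.
  by rewrite nc_rc (le_trans _ (Bi i))// lerDr addr_ge0.
have [K K0 KP] := line_close hP B1.
(* with the base point moved to i al e + x, all roots are in the lower half plane *)
have conf al : 0 < al -> al <= 1 -> forall r, 0 <= complex.Im r -> ~ root (line (w al 1) la P) r.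
  move=> al0 al1 r r0.
  suff H be s : `[0, 1]%classic be -> [set t | 0 <= complex.Im t] s -> ~ root (line (w al be) la P) s.
    by apply: H => //=; rewrite in_itv /= lexx ler01.
  move: be s.
  apply: (@root_confinement R (R : topologicalType) `[0, 1]%classic (fun be => line (w al be) la P) N
    (evalC la P) [set t | 0 <= complex.Im t] [set t | complex.Im t != 0] (0 : R)) => //.
  - exact: segment_connected.
  - by rewrite /= in_itv /= lexx ler01.
  - by move=> be _; exact: has_lead_lineP.
  - move=> be t _ /eqP; rewrite horner_line /= => Pt; apply/eqP => t0.
    have tE : t = rc (complex.Re t) by case: (t) t0 => u v /= ->.
    have /hypP : evalC (fun i => rc (be * x i + a i * complex.Re t) + rc al * ii * rc (e i)) P = 0.
      rewrite -[RHS]Pt; apply: eq_evalC => i; rewrite [in RHS]tE /w /la.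
      by rewrite !rmorphD !rmorphM/=; ring.
    by move=> /= /eqP; rewrite !(mulr0, mulr1, mul0r, addr0, add0r) gt_eqF.
  - move=> t /= t0 t1; exists (complex.Im t); first by rewrite lt_neqAle eq_sym t1.
    move=> s _ /negP; rewrite -ltNge => s0; rewrite (le_trans _ (nc_Im _))//.
    rewrite (le_trans _ (ler_norm _))//; case: t s s0 {t0 t1} => ? ? [? ?] /= s0.
    by rewrite lerDl oppr_ge0 ltW.
  - move=> s /= s1 /negP; rewrite -ltNge => s0; exists (- complex.Im s); first by rewrite oppr_gt0.
    move=> t t0; rewrite (le_trans _ (nc_Im _))// (le_trans _ (ler_norm _))//.
    by case: t s s0 t0 {s1} => ? ? [? ?] /= s0 t0; rewrite lerDr.
  - move=> be /= be01 eps eps0.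
    pose S := 1 + K * B.
    have S0 : 0 < S by rewrite ltr_pwDl// mulr_ge0// (le_trans _ B1).
    near=> be' => be'01 t _.
    have dd : `|be' - be| <= eps / S.
      near: be'; apply/nbhs_ballP; exists (eps / S) => /=; first by rewrite divr_gt0.
      by move=> z /=; rewrite /ball/= distrC => /ltW.
    have b1 : 0 <= be <= 1 by move: be01; rewrite in_itv.
    have b2 : 0 <= be' <= 1 by move: be'01; rewrite /= in_itv.
    have al2 : 0 <= al <= 1 by rewrite (ltW al0).
    rewrite (le_trans (KP _ _ _ t (eps / S * B) _ (wB _ _ al2 b2) (wB _ _ al2 b1) laB _))//.
    + by rewrite mulr_ge0// ?divr_ge0 ?(ltW eps0) ?(ltW S0)// (le_trans _ B1).
    + move=> i.
      have -> : w al be' i - w al be i = rc (be' - be) * rc (x i) by rewrite /w rmorphB/=; ring.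
      rewrite ncM !nc_rc ler_pM// (le_trans _ (Bi i))//.
      by rewrite -addrA addrCA lerDl addr_ge0.
    + rewrite ler_wpM2r ?exprn_ge0 ?addr_ge0 ?nc_ge0//.
      have -> : K * (eps / S * B) = eps * ((K * B) / S) by ring.
      by rewrite ler_piMr ?(ltW eps0)// ler_pdivrMr// mul1r lerDr.
  - move=> t t0 /eqP; rewrite horner_line.
    have [->|tn0] := eqVneq t 0.
      have -> : evalC (fun i => w al 0 i + la i * 0) P = evalC (fun i => (rc al * ii) * rc (e i)) P.
        by apply: eq_evalC => i; rewrite /w rmorph0 mul0r mulr0 !addr0.
      rewrite (evalC_scale _ _ hP) evalC_real => /eqP.
      rewrite mulf_eq0 fmorph_eq0 (gt_eqF (Ppos _ e0)) orbF expf_eq0 mulf_eq0 fmorph_eq0 (gt_eqF al0).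
      by move=> /= /andP[_ /eqP i0]; have := nci; rewrite i0 nc0 => /esym/eqP; rewrite oner_eq0.
    pose s := rc al * ii / t.
    have -> : evalC (fun i => w al 0 i + la i * t) P = evalC (fun i => t * (rc (a i) + s * rc (e i))) P.
      apply: eq_evalC => i; rewrite /w rmorph0 mul0r addr0 /s /la mulrDr addrC mulrC; congr (_ + _).
      by field.
    rewrite (evalC_scale _ _ hP) => /eqP; rewrite mulf_eq0 expf_eq0 (negbTE tn0) andbF/= => /eqP Ps.
    have s0 := hypP _ _ Ps.
    have sE : s = rc (complex.Re s) by case: (s) s0 => u v /= ->.
    have [s1|s1] := leP 0 (complex.Re s).
      have : evalC (fun i => rc (a i + complex.Re s * e i)) P = 0.
        by rewrite -[RHS]Ps; apply: eq_evalC => i; rewrite [in RHS]sE rmorphD rmorphM.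
      rewrite evalC_real => /eqP; rewrite fmorph_eq0 gt_eqF//; apply: Ppos => i.
      by rewrite ltr_pwDl// mulr_ge0// ltW.
    have : s * t = rc al * ii by rewrite /s mulfVK.
    rewrite sE => /(congr1 (@complex.Im _)); case: (t) t0 => u v /= v0.
    rewrite !(mulr0, mulr1, mul0r, addr0, add0r) => vE.
    have : complex.Re s * v <= 0 by rewrite mulr_le0_ge0// ltW.
    by rewrite vE leNgt al0.
have away al : 0 < al -> al <= 1 -> nc (evalC la P) <= nc (line (w al 1) la P).[ii].
  move=> al0 al1; rewrite -[leLHS]mulr1 -[X in _ * X <= _](expr1n _ N).
  apply: (nc_away (p := line (w al 1) la P)) => //; first exact: has_lead_lineP.
  move=> r rr; rewrite (le_trans _ (nc_Im _))// (le_trans _ (ler_norm _))//.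
  have : ~ (0 <= complex.Im r) by move=> r0; exact: (conf al al0 al1 r r0).
  move=> /negP; rewrite -ltNge; case: r {rr} => u v /= v0.
  by rewrite lerDl oppr_ge0 ltW.
have nc0c : 0 < nc (evalC la P).
  by rewrite lt_neqAle nc_ge0 andbT eq_sym; apply: contra c0 => /eqP/nc_eq0 ->.
apply/eqP => P0.
pose S := (1 + K * B * 2 ^+ N) * 2.
have q0 : 0 <= K * B * 2 ^+ N by rewrite !mulr_ge0 ?exprn_ge0// (le_trans _ B1).
have S0 : 0 < S by rewrite mulr_gt0// ltr_pwDl.
pose al := Num.min 1 (nc (evalC la P) / S).
have al0 : 0 < al by rewrite lt_min ltr01 divr_gt0.
have al1 : al <= 1 by rewrite ge_min lexx.
have := away al al0 al1.
have al2 : 0 <= al <= 1 by rewrite (ltW al0).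
have : nc ((line (w al 1) la P).[ii] - (line (w 0 1) la P).[ii]) <= K * (al * B) * (1 + nc ii) ^+ N.
  apply: KP => //.
  - by rewrite mulr_ge0 ?(ltW al0)// (le_trans _ B1).
  - by apply: wB; rewrite ?lexx ?ler01.
  - by apply: wB; rewrite ?lexx ?ler01.
  - move=> i.
    have -> : w al 1 i - w 0 1 i = rc al * ii * rc (e i) by rewrite /w rmorph0/=; ring.
    rewrite !ncM !nc_rc nci mulr1.
    by rewrite (ger0_norm (ltW al0)) ler_wpM2l ?(ltW al0)// (le_trans _ (Bi i))// -addrA lerDl addr_ge0.
have -> : (line (w 0 1) la P).[ii] = 0.
  rewrite horner_line -[RHS]P0; apply: eq_evalC => i.
  by rewrite /w /la rmorph0 rmorph1 !mul0r add0r mul1r mulrC.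
rewrite subr0 nci => h1 /le_trans /(_ h1); rewrite leNgt => /negP; apply.
have : al * S <= nc (evalC la P) by rewrite -ler_pdivlMr// ge_min lexx orbT.
rewrite /S -[1 + 1]/(2 : R).
have -> : K * (al * B) * 2 ^+ N = al * (K * B * 2 ^+ N) by ring.
move: q0 nc0c al0; clear; move: al (K * B * 2 ^+ N) (nc _) => x1 x2 x3; nra.
Unshelve. all: by end_near. Qed.

Lemma complex_ReIm (z : C) : z = rc (complex.Re z) + ii * rc (complex.Im z).
Proof. exact: complexE. Qed.

Lemma Im_add (z w : C) : complex.Im (z + w) = complex.Im z + complex.Im w.
Proof. by case: z; case: w. Qed.

Lemma Im_invN (r : C) : complex.Im r < 0 -> complex.Im ((- r)^-1) < 0.
Proof.
case: r => u v /= v0; rewrite !sqrrN mulNr opprK.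
by rewrite nmulr_rlt0// invr_gt0 ltr_wpDl ?sqr_ge0// exprn_even_gt0//= lt_eqF.
Qed.

(** The logarithmic derivative at 0 is the sum of the inverses of the opposites of
    the roots. *)
Lemma log_derivative_Im (rs : seq C) : (forall r, r \in rs -> complex.Im r < 0) ->
  let p := \prod_(r <- rs) ('X - r%:P) in
  p.[0] != 0 /\ (rs != [::] -> complex.Im (p^`().[0] / p.[0]) < 0).
Proof.
move=> /= H; suff : let p := \prod_(r <- rs) ('X - r%:P) in
    p.[0] != 0 /\ (if rs is [::] then complex.Im (p^`().[0] / p.[0]) = 0
                   else complex.Im (p^`().[0] / p.[0]) < 0).
  by case: (rs) => [|r s] /= [? ?].
elim: rs H => [|r rs IH] H /=; first by rewrite big_nil hornerC derivC hornerC mul0r oner_eq0.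
have [|p0 ple] := IH; first by move=> s srs; apply: H; rewrite inE srs orbT.
have r0 := H r (mem_head _ _).
have rn0 : r != 0 by apply/eqP => rr; move: r0; rewrite rr /= ltxx.
rewrite big_cons; move: (\prod_(_ <- _) _) p0 ple => p p0 ple.
rewrite derivM derivXsubC mul1r hornerD !hornerM hornerXsubC sub0r.
split; first by rewrite mulf_neq0// oppr_eq0.
have -> : (p.[0] + - r * p^`().[0]) / (- r * p.[0]) = (- r)^-1 + p^`().[0] / p.[0].
  by field; rewrite p0 rn0.
rewrite Im_add -[ltRHS]addr0 ltr_leD ?Im_invN//.
by case: (rs) ple => [->//|? ? /ltW].
Qed.

Lemma homog_dirderiv k N (P : mpoly.mpoly k R) b : homog N.+1 P -> homog N (dirderiv b P).
Proof.
move=> hP; apply: rpred_sum => i _; apply: rpredZ.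
apply/mpoly.dhomogP => m; rewrite mpoly.mcoeff_msupp mpoly.mcoeff_deriv => m0.
have mP : mpoly.mnm_add m (mpoly.mnm1 i) \in mpoly.msupp P.
  by rewrite mpoly.mcoeff_msupp; apply: contra m0 => /eqP ->; rewrite mul0rn.
move/mpoly.dhomogP : hP => /(_ _ mP) /=; rewrite mpoly.mdegD mpoly.mdeg1 addn1.
by move=> [].
Qed.

Section Derivative.
Variables (k N : nat) (P : mpoly.mpoly k R) (e b : 'I_k -> R).
Hypotheses (hP : homog N.+1 P) (Ppos : forall b, orthant b -> 0 < mpoly.meval b P).
Hypotheses (e0 : orthant e) (hypP : hyperbolic e P) (b0 : orthant b).

Let tube (x a : 'I_k -> R) i := rc (x i) + ii * rc (a i).

(** The roots of t |-> P (w + t b) are in the lower half plane, for w in the tube. *)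
Let dirderiv_tube x a : orthant a ->
  complex.Im (evalC (tube x a) (dirderiv b P) / evalC (tube x a) P) < 0.
Proof.
move=> a0; pose q := line (tube x a) (fun i => rc (b i)) P.
have c0 : evalC (fun i => rc (b i)) P != 0.
  by rewrite evalC_real fmorph_eq0 gt_eqF// Ppos.
have q0 : q.[0] = evalC (tube x a) P.
  by rewrite horner_line; apply: eq_evalC => i; rewrite mulr0 addr0.
rewrite -q0 -deriv_line -/q.
have [rs szrs qE] := has_lead_factor c0 (has_lead_lineP (tube x a) (fun i => rc (b i)) hP).
have [r|p0] := @log_derivative_Im rs.
  move=> rrs; rewrite ltNge; apply/negP => r0.
  have : root q r by rewrite /q qE; exact: root_factor.
  rewrite rootE horner_line.
  have -> : evalC (fun i => tube x a i + rc (b i) * r) P =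
      evalC (tube (fun i => x i + complex.Re r * b i) (fun i => a i + complex.Im r * b i)) P.
    apply: eq_evalC => i; rewrite /tube [in LHS](complex_ReIm r) !rmorphD !rmorphM/=.
    by ring.
  have pos : orthant (fun i => a i + complex.Im r * b i).
    by move=> i; rewrite ltr_pwDl// mulr_ge0// ltW.
  apply/negP; exact: (tube_nonvanishing (fun i => x i + complex.Re r * b i) hP Ppos e0 hypP pos).
rewrite {1 2}/q qE derivZ !hornerZ -mulf_div divff// mul1r; apply.
by rewrite -size_eq0 szrs.
Qed.

(** Evaluate the logarithmic derivative at i a, and use homogeneity. *)
Lemma dirderiv_pos a : orthant a -> 0 < mpoly.meval a (dirderiv b P).
Proof.
move=> a0; have := dirderiv_tube (fun=> 0) a0.
have tE Q M : homog M Q -> evalC (tube (fun=> 0) a) Q = ii ^+ M * rc (mpoly.meval a Q).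
  move=> hQ; rewrite -evalC_real -(evalC_scale _ _ hQ); apply: eq_evalC => i.
  by rewrite /tube rmorph0 add0r.
rewrite (tE _ _ (homog_dirderiv b hP)) (tE _ _ hP) exprS.
have i0 : ii != 0 :> C by rewrite neq0Ci.
have Pa := Ppos a0.
have -> : forall u v : R, v != 0 -> ii ^+ N * rc u / (ii * ii ^+ N * rc v) = - ii * rc (u / v) :> C.
  move=> u v v0; rewrite rmorphM fmorphV; apply: (mulIf i0).
  have ->  : - ii * (rc u * (rc v)^-1) * ii = rc u / rc v :> C.
    by rewrite mulrAC mulNr -expr2 sqrCi opprK mul1r.
  have v1 : rc v != 0 by rewrite fmorph_eq0.
  have iN : ii ^+ N != 0 :> C by rewrite expf_neq0.
  by field; rewrite v1 iN i0.
  2: by rewrite gt_eqF.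
rewrite /= !(mulr0, mul0r, mulN1r, oppr0, add0r) oppr_lt0.
by rewrite pmulr_lgt0// invr_gt0.
Qed.

Lemma dirderiv_hyperbolic : hyperbolic e (dirderiv b P).
Proof.
move=> x z Dz.
have up y w : 0 < complex.Im w -> evalC (fun i => rc (y i) + w * rc (e i)) (dirderiv b P) != 0.
  move=> w0; have -> : evalC (fun i => rc (y i) + w * rc (e i)) (dirderiv b P) =
     evalC (tube (fun i => y i + complex.Re w * e i) (fun i => complex.Im w * e i)) (dirderiv b P).
    apply: eq_evalC => i; rewrite /tube [in LHS](complex_ReIm w) !rmorphD !rmorphM/=.
    by ring.
  apply/eqP => D0; have := @dirderiv_tube (fun i => y i + complex.Re w * e i)
    (fun i => complex.Im w * e i).
  by rewrite D0 mul0r /= ltxx => H; suff : false by []; apply: H => i; rewrite mulr_gt0.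
case: (ltgtP (complex.Im z) 0) => // [z0|z0]; last by have := up x z z0; rewrite Dz eqxx.
have := up (fun i => - x i) (- z).
have -> : evalC (fun i => rc (- x i) + - z * rc (e i)) (dirderiv b P) =
    evalC (fun i => (-1) * (rc (x i) + z * rc (e i))) (dirderiv b P).
  by apply: eq_evalC => i; rewrite rmorphN/=; ring.
rewrite (evalC_scale _ _ (homog_dirderiv b hP)) Dz mulr0 eqxx => H.
suff : false by []; apply: H; case: (z) z0 => u v /= v0.
by rewrite oppr_gt0.
Qed.

End Derivative.

(** Each coefficient is, up to a positive factor, a limit of iterated derivatives
    along directions of the open orthant, and these are positive. *)
Lemma hyperbolic_coeff_ge0 k N (P : mpoly.mpoly k R) (e : 'I_k -> R) : homog N P ->
  (forall b, orthant b -> 0 < mpoly.meval b P) -> orthant e -> hyperbolic e P ->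
  forall m, 0 <= mpoly.mcoeff m P.
Proof.
elim: N P => [|N IH] P hP Ppos e0 hypP m.
  have [m0|m0] := boolP (m \in mpoly.msupp P); last by rewrite mpoly.memN_msupp_eq0.
  have := Ppos e e0; rewrite mpoly.mevalE.
  rewrite big_seq (eq_bigr (fun m' => if m' == m then mpoly.mcoeff m P else 0)); last first.
    move=> m' m'P.
    have z m1 : m1 \in mpoly.msupp P -> m1 = mpoly.mnm0.
      by move=> /(homog_mdeg hP) /eqP; rewrite -mpoly.mdegE mpoly.mdeg_eq0 => /eqP.
    rewrite (z _ m0) (z _ m'P) eqxx big1 ?mulr1// => i _.
    by rewrite mpoly.mnm0E expr0.
  rewrite -big_seq -big_mkcond /= big_const_seq => /ltW.
  have -> : count (fun i => i == m) (mpoly.msupp P) = 1%N.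
    by rewrite -[LHS]/(count_mem m (mpoly.msupp P)) count_uniq_mem ?mpoly.msupp_uniq// m0.
  by rewrite /= addr0.
have [/eqP|] := boolP (mpoly.mdeg m == 0%N).
  move=> mdeg0; rewrite mpoly.memN_msupp_eq0//; apply/negP => /(homog_mdeg hP).
  by rewrite -mpoly.mdegE mdeg0.
rewrite mpoly.mdeg_eq0 => m0.
have [j mj] : exists j, (0 < m j)%N.
  apply/existsP; apply: contraNT m0; rewrite negb_exists => /forallP m0.
  by apply/eqP/mpoly.mnmP => j; rewrite mpoly.mnm0E; apply/eqP; rewrite -leqn0 leqNgt.
pose m' := mpoly.mnm_sub m (mpoly.mnm1 j).
have m'E : mpoly.mnm_add m' (mpoly.mnm1 j) = m.
  by apply: mpoly.submK; apply/mpoly.mnm_lepP => i; rewrite mpoly.mnm1E; case: eqP => // <-.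
pose S := \sum_i mpoly.mcoeff m' (mpoly.mderiv i P).
have key t : 0 < t -> 0 <= mpoly.mcoeff m' (mpoly.mderiv j P) + t * S.
  (* the direction e_j, moved into the open orthant *)
  move=> t0; pose b i : R := (i == j)%:R + t.
  have b0 : orthant b by move=> i; rewrite /b ltr_wpDl.
  have -> : mpoly.mcoeff m' (mpoly.mderiv j P) + t * S = mpoly.mcoeff m' (dirderiv b P).
    rewrite /dirderiv [RHS]raddf_sum /=.
    under [RHS]eq_bigr do rewrite mpoly.mcoeffZ /b mulrDl.
    rewrite big_split /= -mulr_sumr; congr (_ + _).
    rewrite (bigD1 j)//= eqxx mul1r big1 ?addr0// => i ij.
    by rewrite (negbTE ij) mul0r.
  apply: IH => //; first exact: homog_dirderiv.
    by move=> a a0; exact: (dirderiv_pos hP Ppos e0 hypP b0).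
  exact: (dirderiv_hyperbolic hP Ppos e0 hypP b0).
have : 0 <= mpoly.mcoeff m' (mpoly.mderiv j P).
  apply/ler_addgt0Pr => t t0.
  have S1 : 0 < 1 + `|S| by rewrite ltr_pwDl.
  rewrite (le_trans (key (t / (1 + `|S|)) _)) ?divr_gt0// lerD2l.
  rewrite -mulrA ler_piMr ?(ltW t0)// mulrC ler_pdivrMr// mul1r.
  by rewrite (le_trans (ler_norm _))// lerDr.
by rewrite mpoly.mcoeff_deriv m'E pmulrn_lge0.
Qed.

End Homogeneous.

Section Means.
Context {R : realType}.

(** P is compared with the monomial whose exponents are the means of those of P,
    weighted by its coefficients; these means are the logarithmic derivatives of P
    at (1, ..., 1).  The inequality is exp x >= exp mu (1 + x - mu), summed. *)
Lemma arithmetic_geometric_mean k (P : mpoly.mpoly k R) (c : R) (lam : 'I_k -> R) :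
  (forall m, 0 <= mpoly.mcoeff m P) -> 0 < mpoly.meval (fun=> 1) P ->
  (forall i, mpoly.meval (fun=> 1) (mpoly.mderiv i P) = c) -> orthant lam ->
  mpoly.meval (fun=> 1) P * (\prod_i lam i) `^ (c / mpoly.meval (fun=> 1) P)
    <= mpoly.meval lam P.
Proof.
move=> Pge0 S0 dP lam0; set S := mpoly.meval (fun=> 1) P in S0 *.
have SE : S = \sum_(m <- mpoly.msupp P) mpoly.mcoeff m P.
  rewrite /S mpoly.mevalE; apply: eq_bigr => m _; rewrite big1 ?mulr1// => i _.
  by rewrite expr1n.
have cE i : c = \sum_(m <- mpoly.msupp P) mpoly.mcoeff m P * (m i)%:R.
  rewrite -(dP i) /mpoly.mderiv raddf_sum /=; apply: eq_bigr => m _.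
  rewrite mpoly.mevalZ mpoly.mevalX big1 ?mulr1 1?mulrC// => j _.
  by rewrite expr1n.
have prodE (m : mpoly.multinom k) : \prod_i lam i ^+ m i = expR (\sum_i (m i)%:R * ln (lam i)).
  rewrite expR_sum; apply: eq_bigr => i _.
  by rewrite mulrC expRM_natr lnK// posrE.
pose mu := c / S * \sum_i ln (lam i).
have muE : (\prod_i lam i) `^ (c / S) = expR mu.
  rewrite /powR gt_eqF ?prodr_gt0// /mu; congr (expR (_ * _)).
  have -> : \prod_i lam i = expR (\sum_i ln (lam i)).
    by rewrite expR_sum; apply: eq_bigr => i _; rewrite lnK// posrE.
  by rewrite expRK.
rewrite muE mpoly.mevalE.
apply: (@le_trans _ _ (\sum_(m <- mpoly.msupp P) mpoly.mcoeff m P *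
    (expR mu * (1 + (\sum_i (m i)%:R * ln (lam i) - mu))))); last first.
  apply: ler_sum => m _; rewrite ler_wpM2l// prodE.
  move: (\sum_i _) => y; rewrite -[X in _ <= expR X](subrK mu) [in leRHS]addrC expRD.
  rewrite ler_wpM2l ?expR_ge0//; exact: expR_ge1Dx.
have -> : \sum_(m <- mpoly.msupp P) mpoly.mcoeff m P *
    (expR mu * (1 + (\sum_i (m i)%:R * ln (lam i) - mu))) =
  expR mu * (S * (1 - mu) + \sum_(m <- mpoly.msupp P) mpoly.mcoeff m P * \sum_i (m i)%:R * ln (lam i)).
  rewrite SE mulr_suml -big_split mulr_sumr/=; apply: eq_bigr => m _.
  ring.
have -> : \sum_(m <- mpoly.msupp P) mpoly.mcoeff m P * \sum_i (m i)%:R * ln (lam i) = S * mu.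
  under eq_bigr do rewrite mulr_sumr.
  rewrite exchange_big /= /mu mulrA mulrCA divff ?gt_eqF// mulr1 mulr_sumr; apply: eq_bigr => i _.
  by rewrite (cE i) mulr_suml; apply: eq_bigr => m _; rewrite mulrA.
by rewrite -mulrDr subrK mulr1 mulrC.
Qed.

End Means.

(** * Orthogonal diagonalization of real symmetric matrices *)

Section Spectral.
Context {R : realType}.
Local Notation rc := (real_complex R).

Lemma dotpE n (x y : 'rV[R]_n) : dotp x y = (x *m y^T) ord0 ord0.
Proof. by rewrite mxE; apply: eq_bigr => i _; rewrite mxE. Qed.

Lemma dotp_mulmxl n (A : 'M[R]_n) (x y : 'rV[R]_n) : dotp (x *m A) y = dotp x (y *m A^T).
Proof. by rewrite !dotpE trmx_mul trmxK mulmxA. Qed.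

Lemma dotp_eq0 n (x : 'rV[R]_n) : dotp x x = 0 -> x = 0.
Proof.
move=> /eqP; rewrite psumr_eq0 => [/allP x0|i _]; last by rewrite -expr2 sqr_ge0.
apply/rowP => i; rewrite mxE; have := x0 i (mem_index_enum i).
by rewrite mulf_eq0 orbb => /eqP.
Qed.

(** A complex eigenvalue al + i be exists.  Pairing the real and imaginary parts of
    an eigenvector with each other gives be = 0, by symmetry. *)
Lemma symmetric_eigenvector n (A : 'M[R]_n.+1) : sym A ->
  exists v : 'rV[R]_n.+1, exists l : R, v != 0 /\ v *m A = l *: v.
Proof.
move=> symA; pose AC := map_mx rc A.
have [mu] : exists mu, root (char_poly AC) mu by apply/closed_rootP; rewrite size_char_poly.
rewrite -eigenvalue_root_char => /eigenvalueP[v vA v0].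
pose a := map_mx (@complex.Re R) v; pose b := map_mx (@complex.Im R) v.
pose al := complex.Re mu; pose be := complex.Im mu.
have ReM (z : R[i]) (x : R) : complex.Re (z * rc x) = complex.Re z * x.
  by case: z => p q /=; rewrite mulr0 subr0.
have ImM (z : R[i]) (x : R) : complex.Im (z * rc x) = complex.Im z * x.
  by case: z => p q /=; rewrite mulr0 add0r.
have aA : a *m A = al *: a - be *: b.
  apply/rowP => j; rewrite !mxE; move/rowP : vA => /(_ j); rewrite !mxE.
  move=> /(congr1 (@complex.Re R)); rewrite raddf_sum /=.
  under eq_bigr do rewrite mxE ReM.
  move=> vA; rewrite (eq_bigr (fun i => complex.Re (v ord0 i) * A i j)) => [|i _]; last by rewrite mxE.
  by rewrite vA /al /be; case: (mu) (v ord0 j) => ? ? [].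
have bA : b *m A = al *: b + be *: a.
  apply/rowP => j; rewrite !mxE; move/rowP : vA => /(_ j); rewrite !mxE.
  move=> /(congr1 (@complex.Im R)); rewrite raddf_sum /=.
  under eq_bigr do rewrite mxE ImM.
  move=> vA; rewrite (eq_bigr (fun i => complex.Im (v ord0 i) * A i j)) => [|i _]; last by rewrite mxE.
  by rewrite vA /al /be; case: (mu) (v ord0 j) => ? ? [].
have dA : dotp (a *m A) b = dotp a (b *m A) by rewrite dotp_mulmxl symA.
have vn0 : 0 < dotp a a + dotp b b.
  rewrite lt_neqAle addr_ge0 ?dotp_ge0// andbT eq_sym paddr_eq0 ?dotp_ge0//.
  apply: contra v0 => /andP[/eqP/dotp_eq0 aE /eqP/dotp_eq0 bE].
  apply/eqP/rowP => j; move/rowP : aE => /(_ j); move/rowP : bE => /(_ j).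
  by rewrite !mxE; case: (v ord0 j) => ? ? /= -> ->.
have be0 : be = 0.
  move: dA; rewrite aA bA dotpDl dotpDr dotpNl !dotpZl !dotpZr => dA.
  have : be * (dotp a a + dotp b b) = 0 by rewrite mulrDr; move: dA; lra.
  by move=> /eqP; rewrite mulf_eq0 (gt_eqF vn0) orbF => /eqP.
have [a0|a0] := eqVneq a 0.
  exists b, al; rewrite bA be0 scale0r addr0; split=> //.
  apply: contra_ltN vn0 => /eqP ->; rewrite a0 /dotp !big1 ?addr0// => i _;
  by rewrite mxE mul0r.
by exists a, al; rewrite aA be0 scale0r subr0.
Qed.

(** H is the reflection exchanging v and the basis vector. *)
Lemma householder n (v : 'rV[R]_n) (i : 'I_n) : dotp v v = 1 ->
  exists H : 'M[R]_n, [/\ H^T = H, H *m H = 1%:M & delta_mx ord0 i *m H = v].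
Proof.
move=> v1; pose e : 'rV[R]_n := delta_mx ord0 i.
have [ve|ve] := eqVneq v e.
  by exists 1%:M; rewrite trmx1 !mulmx1.
pose w := v - e; pose c := dotp w w.
have c0 : c != 0 by apply: contra ve => /eqP/dotp_eq0/eqP; rewrite subr_eq0.
have wwT : w *m w^T = c%:M by rewrite [LHS]mx11_scalar -dotpE.
have ee : dotp e e = 1.
  rewrite /dotp (bigD1 i)//= big1 => [|j ji]; rewrite !mxE ?eqxx ?mulr1 ?addr0//.
  by rewrite (negbTE ji) mulr0.
have cE : c = 2 * (1 - dotp e v).
  rewrite /c /w dotpDl !dotpDr !dotpNl !dotpNr v1 ee (dotpC v e); ring.
exists (1%:M - (2 / c) *: (w^T *m w)); split.
- by rewrite linearB/= linearZ/= trmx1 trmx_mul trmxK.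
- rewrite mulmxBr mulmx1 mulmxBl mul1mx -scalemxAr -scalemxAl.
  have -> : w^T *m w *m (w^T *m w) = c *: (w^T *m w).
    by rewrite mulmxA -(mulmxA _ w) wwT mul_mx_scalar -scalemxAl.
  have -> : (2 / c) *: ((2 / c) *: (c *: (w^T *m w))) = (2 / c + 2 / c) *: (w^T *m w).
    by rewrite !scalerA; congr (_ *: _); field.
  rewrite scalerDl opprB addrA; apply/matrixP => p q; rewrite !mxE; ring.
- rewrite mulmxBr mulmx1 -scalemxAr mulmxA [e *m w^T]mx11_scalar -dotpE mul_scalar_mx scalerA.
  have -> : 2 / c * dotp e w = -1.
    have -> : dotp e w = - (c / 2) by rewrite cE /w dotpDr dotpNr ee; field.
    by field.
  by rewrite scaleN1r opprK /w addrC subrK.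
Qed.

(** Conjugation by a reflection taking an eigenvector to the first basis vector
    leaves a symmetric block of smaller size. *)
Lemma spectral_theorem n (A : 'M[R]_n) : sym A ->
  exists (Q : 'M[R]_n) (lam : 'rV[R]_n), Q *m Q^T = 1%:M /\ A = Q^T *m diag_mx lam *m Q.
Proof.
elim: n A => [|n IH] A symA.
  by exists 1%:M, 0; split; apply/matrixP => -[].
have [v0 [l [v00 v0A]]] := symmetric_eigenvector symA.
pose s := dotp v0 v0.
have s0 : 0 < s.
  by rewrite lt_neqAle dotp_ge0 andbT eq_sym; apply: contra v00 => /eqP/dotp_eq0 ->.
pose v := (Num.sqrt s)^-1 *: v0.
have vA : v *m A = l *: v by rewrite -scalemxAl v0A !scalerA mulrC.
have v1 : dotp v v = 1.
  rewrite dotpZl dotpZr mulrA -invfM -expr2 sqr_sqrtr ?(ltW s0)//.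
  by rewrite mulVf// gt_eqF.
move: v vA v1 => v vA v1; clear v0 v00 v0A s s0; rewrite -(add1n n) in A symA v vA v1 *.
have [H [HT HH eH]] := householder (lshift n ord0) v1.
pose B : 'M[R]_(1 + n) := H *m A *m H.
have symB : B^T = B by rewrite /B !trmx_mul HT symA mulmxA.
pose e : 'rV[R]_(1 + n) := delta_mx ord0 (lshift n ord0).
have eB : e *m B = l *: e.
  rewrite /B !mulmxA eH vA -scalemxAl; congr (_ *: _).
  by rewrite -eH -mulmxA HH mulmx1.
have AE : A = H *m B *m H by rewrite /B !mulmxA HH mul1mx -mulmxA HH mulmx1.
move: B symB eB AE => B symB eB AE.
have BE : B = block_mx l%:M 0 0 (drsubmx B).
  have rowB j : B (lshift n ord0) j = l * (lshift n ord0 == j)%:R.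
    by move: eB; rewrite -rowE => /rowP /(_ j); rewrite !mxE eqxx andTb eq_sym.
  rewrite -[LHS]submxK; congr block_mx.
  - by apply/matrixP => i j; rewrite !mxE !ord1 rowB eqxx mulr1.
  - apply/matrixP => i j; rewrite !mxE !ord1 rowB -val_eqE/=.
    by rewrite mulr0.
  - apply/matrixP => i j; rewrite !mxE !ord1 -symB mxE rowB -val_eqE/=.
    by rewrite mulr0.
have [|Q' [lam' [QQ' BE']]] := IH (drsubmx B).
  by rewrite /sym /= trmx_drsub symB.
exists (block_mx 1%:M 0 0 Q' *m H), (row_mx l%:M lam'); split.
  rewrite trmx_mul mulmxA -(mulmxA _ H) HT HH mulmx1 tr_block_mx !trmx0 trmx1.
  by rewrite mulmx_block !mulmx0 !mul0mx !mulmx1 !addr0 add0r QQ' -scalar_mx_block.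
rewrite AE trmx_mul HT tr_block_mx !trmx0 trmx1 -!mulmxA; congr (_ *m _).
rewrite !mulmxA; congr (_ *m _).
rewrite {1}BE BE' diag_mx_row.
rewrite !mulmx_block !(mulmx0, mul0mx, mul1mx, mulmx1, addr0, add0r).
congr block_mx; apply/matrixP => i j; by rewrite !ord1 !mxE /=.
Qed.

End Spectral.

(** * The majorization of the determinant and the Garding cone *)

Section Garding.
Context {R : realType} (n N : nat).
Variable g : mpoly.mpoly (n * n) R.
Hypothesis gGD : central_GD N g.
Local Notation C := R[i].
Local Notation rc := (real_complex R).
Local Notation nc := (@complex.ComplexField.Normc.normc R).

Definition mxC (A : 'M[C]_n) : 'I_(n * n) -> C := fun k => mxvec A ord0 k.

Lemma evalC_mx (A : 'M[R]_n) : evalC (mxC (map_mx rc A)) g = rc (evalS g A).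
Proof. by rewrite -evalC_real; apply: eq_evalC => k; rewrite /mxC -map_mxvec mxE. Qed.

Definition mxline (A B : 'M[R]_n) : {poly C} := line (mxC (map_mx rc A)) (mxC (map_mx rc B)) g.

Lemma horner_mxline (A B : 'M[R]_n) z :
  (mxline A B).[z] = evalC (mxC (map_mx rc A + z *: map_mx rc B)) g.
Proof.
rewrite /mxline horner_line; apply: eq_evalC => k.
by rewrite /mxC linearD/= linearZ/= !mxE mulrC.
Qed.

Lemma horner_mxline_real (A B : 'M[R]_n) t : (mxline A B).[rc t] = rc (evalS g (A + t *: B)).
Proof. by rewrite horner_mxline -evalC_mx map_mxD map_mxZ. Qed.

Lemma map_lineS (A : 'M[R]_n) : map_poly rc (lineS g A) = mxline A 1%:M.
Proof.
rewrite /lineS /mxline /line /mpoly.mmap rmorph_sum; apply: eq_bigr => m _.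
rewrite rmorphM/= map_polyC/=; congr (_ * _).
rewrite rmorph_prod; apply: eq_bigr => k _; rewrite rmorphXn; congr (_ ^+ _).
rewrite /mxC; case/mxvec_indexP: k => i j; rewrite !mxvecE !mxE rmorphD rmorphMn/=.
by rewrite map_polyX map_polyC/= addrC rmorph_nat scaler_nat.
Qed.

Lemma GD_root (A : 'M[R]_n) z : sym A -> root (mxline A 1%:M) z -> complex.Im z = 0.
Proof. by move=> sA; rewrite -map_lineS; exact: (GD_real gGD sA). Qed.

Lemma evalS_scale c (A : 'M[R]_n) : evalS g (c *: A) = c ^+ N * evalS g A.
Proof.
apply: (fmorph_inj rc) => /=; rewrite rmorphM rmorphXn/= -!evalC_mx.
rewrite -(evalC_scale _ _ (GD_homog gGD)); apply: eq_evalC => k.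
by rewrite /mxC map_mxZ linearZ/= mxE.
Qed.

Lemma has_lead_mxline (A : 'M[R]_n) : has_lead N (rc (evalS g 1%:M)) (mxline A 1%:M).
Proof. by rewrite -evalC_mx; apply: has_lead_lineP; exact: GD_homog. Qed.

Lemma garding_cone_neq0 A : garding_cone g A -> sym A /\ evalS g A != 0.
Proof. by move=> /connected_component_sub. Qed.

Lemma posdef1 : posdef (1%:M : 'M[R]_n).
Proof.
split; first by rewrite /sym/= trmx1.
move=> v v0; rewrite quadfE mulmx1 lt_neqAle dotp_ge0 andbT eq_sym.
by apply: contra v0 => /eqP/dotp_eq0 ->.
Qed.

Lemma quadfD (A B : 'M[R]_n) v : quadf (A + B) v = quadf A v + quadf B v.
Proof. by rewrite !quadfE mulmxDr dotpDl. Qed.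

Lemma quadfZ c (A : 'M[R]_n) v : quadf (c *: A) v = c * quadf A v.
Proof. by rewrite !quadfE -scalemxAr dotpZl. Qed.

(** The real polynomial t |-> g ((1 - t) I + t A). *)
Definition segment_poly (A : 'M[R]_n) : {poly R} :=
  mpoly.mmap polyC (fun k => mxvec (map_mx polyC 1%:M + 'X *: map_mx polyC (A - 1%:M)) ord0 k) g.

Lemma horner_segment_poly A t : (segment_poly A).[t] = evalS g (1%:M + t *: (A - 1%:M)).
Proof.
rewrite /segment_poly /evalS /mpoly.meval /mpoly.mmap horner_sum; apply: eq_bigr => m _.
rewrite hornerM hornerC; congr (_ * _).
rewrite /mpoly.mmap1 horner_prod; apply: eq_bigr => k _.
rewrite horner_exp; congr (_ ^+ _).
by case/mxvec_indexP: k => i j; rewrite !mxvecE !mxE hornerD hornerM hornerX !hornerC.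
Qed.

(** g does not vanish on the segment from I to A, which consists of positive definite
    matrices. *)
Lemma posdef_evalS_gt0 A : posdef A -> 0 < evalS g A.
Proof.
move=> pA; rewrite ltNge; apply/negP => gA.
have [||t /= t01 /rootP] := @poly_ivt _ (- segment_poly A) 0 1.
- exact: ler01.
- rewrite !hornerN !horner_segment_poly scale0r addr0 scale1r addrC subrK.
  by rewrite oppr_le0 oppr_ge0 gA (ltW (GD_normalized gGD)).
rewrite hornerN horner_segment_poly => /eqP; rewrite oppr_eq0; apply/negP.
have /andP[t0 t1] := t01.
suff /(GD_cone gGD)/garding_cone_neq0[] : posdef (1%:M + t *: (A - 1%:M)) by [].
have -> : 1%:M + t *: (A - 1%:M) = (1 - t) *: 1%:M + t *: A.
  by rewrite scalerBr scalerBl scale1r addrA addrAC.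
have [sA Apos] := pA; have [_ Ipos] := posdef1.
split; first by rewrite /sym/= linearD/= !linearZ/= trmx1 sA.
move=> v v0; rewrite quadfD !quadfZ.
have := Apos v v0; have := Ipos v v0; move: t0 t1; clear.
by move: (quadf _ _) (quadf A v) => x y; nra.
Qed.

(** g restricted to the matrices diagonal in the basis of the rows of Q *)
Definition diag_restriction (Q : 'M[R]_n) : mpoly.mpoly n R :=
  mpoly.mmap (@mpoly.mpolyC n R) (fun k =>
    mxvec (\matrix_(a, b) \sum_i (Q i a * Q i b) *: mpoly.mpolyX R (mpoly.mnm1 i)) ord0 k) g.

Lemma evalC_diag_restriction Q (z : 'I_n -> C) : evalC z (diag_restriction Q) =
  evalC (mxC (map_mx rc Q^T *m diag_mx (\row_i z i) *m map_mx rc Q)) g.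
Proof.
rewrite evalCE /evalC /diag_restriction [X in mpoly.mmap _ _ X = _]/mpoly.mmap [LHS]rmorph_sum.
apply: eq_bigr => m _; rewrite [LHS]rmorphM /= mpoly.mmapC; congr (_ * _).
rewrite rmorph_prod; apply: eq_bigr => k _; rewrite rmorphXn; congr (_ ^+ _).
rewrite /mxC; case/mxvec_indexP: k => i j; rewrite !mxvecE !mxE rmorph_sum.
apply: eq_bigr => k _; rewrite /= mpoly.mmapZ mpoly.mmapX mpoly.mmap1U.
rewrite mul_mx_diag !mxE rmorphM/=; ring.
Qed.

Lemma meval_diag_restriction Q (lam : 'I_n -> R) : mpoly.meval lam (diag_restriction Q) =
  evalS g (Q^T *m diag_mx (\row_i lam i) *m Q).
Proof.
apply: (fmorph_inj rc) => /=; rewrite -evalC_real evalC_diag_restriction -evalC_mx.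
congr (evalC (mxC _) g); rewrite map_mxM; congr (_ *m _); rewrite map_mxM; congr (_ *m _).
by rewrite map_diag_mx; congr diag_mx; apply/rowP => i; rewrite !mxE.
Qed.

Lemma homog_diag_restriction Q : diag_restriction Q \is mpoly.ishomog1 N (@mpoly.mdeg _).
Proof.
rewrite /diag_restriction /mpoly.mmap big_seq; apply: rpred_sum => m mg.
rewrite mpoly.mul_mpolyC; apply: mpoly.dhomogZ.
rewrite -(homog_mdeg (GD_homog gGD) mg) /mpoly.mmap1.
elim: (index_enum _) => [|k s IH]; first by rewrite !big_nil; exact: mpoly.dhomog1.
rewrite !big_cons; apply: mpoly.dhomogM => //.
rewrite -[X in mpoly.ishomog1 X]mul1n; apply: mpoly.dhomogMn.
case/mxvec_indexP: k => i j; rewrite mxvecE mxE; apply: rpred_sum => k _.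
by apply: mpoly.dhomogZ; rewrite mpoly.dhomogX /= mpoly.mdeg1.
Qed.

Section Majorization.
Variable Q : 'M[R]_n.
Hypothesis QQ : Q *m Q^T = 1%:M.
Local Notation P := (diag_restriction Q).
Local Notation one := (fun=> 1 : R).
Let M (lam : 'I_n -> R) := Q^T *m diag_mx (\row_i lam i) *m Q.

Let QtQ : Q^T *m Q = 1%:M. Proof. exact: mulmx1C. Qed.

Let M1 : M one = 1%:M.
Proof.
rewrite /M (_ : \row__ _ = const_mx 1); last by apply/rowP => i; rewrite !mxE.
by rewrite diag_const_mx mulmx1.
Qed.

Let symM lam : sym (M lam).
Proof. by rewrite /sym/= /M !trmx_mul trmxK tr_diag_mx mulmxA. Qed.

Let quadfM lam v : quadf (M lam) v = \sum_i lam i * (v *m Q^T) ord0 i ^+ 2.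
Proof.
rewrite quadfE /M !mulmxA dotp_mulmxl /dotp; apply: eq_bigr => i _.
by rewrite mul_mx_diag !mxE; ring.
Qed.

Let posdefM lam : orthant lam -> posdef (M lam).
Proof.
move=> lam0; split; first exact: symM.
move=> v v0; rewrite quadfM lt_neqAle sumr_ge0 => [|i _]; last first.
  by rewrite mulr_ge0 ?sqr_ge0// ltW.
rewrite andbT eq_sym; apply: contra v0; rewrite psumr_eq0 => [/allP H|i _]; last first.
  by rewrite mulr_ge0 ?sqr_ge0// ltW.
have vQ : v *m Q^T = 0.
  apply/rowP => i; rewrite [in RHS]mxE; have := H i (mem_index_enum i).
  by rewrite mulf_eq0 (gt_eqF (lam0 i)) sqrf_eq0 => /eqP.
by rewrite -[v]mulmx1 -QtQ mulmxA vQ mul0mx.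
Qed.

Let MD (x y : 'I_n -> R) t : M (fun i => x i + t * y i) = M x + t *: M y.
Proof.
rewrite /M scalemxAl scalemxAr -mulmxDl -mulmxDr; congr (_ *m _ *m _).
by apply/matrixP => i j; rewrite !mxE; case: (i == j); rewrite ?mulr1n// !mulr0n mulr0 addr0.
Qed.

Let restriction_hyperbolic : hyperbolic one P.
Proof.
move=> x z; rewrite evalC_diag_restriction => H.
apply: (GD_root (symM x)); rewrite rootE horner_mxline -[X in _ == X]H; apply/eqP.
congr (evalC (mxC _) g).
have -> : map_mx rc (1%:M : 'M[R]_n) = map_mx rc Q^T *m map_mx rc Q by rewrite -map_mxM QtQ.
rewrite /M map_mxM scalemxAl -mulmxDl; congr (_ *m _).
rewrite map_mxM map_diag_mx -mul_mx_scalar -mulmxDr; congr (_ *m _).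
by apply/matrixP => i j; rewrite !mxE; case: (i == j); rewrite ?mulr1n ?mulr1// !mulr0n addr0.
Qed.

(** The i-th partial derivative of P is the derivative of g in the direction of the
    projection on the i-th basis vector, of trace 1. *)
Let restriction_gradient (c : R) : is_gradient g 1%:M c%:M ->
  forall i, mpoly.meval one (mpoly.mderiv i P) = c.
Proof.
move=> [_ grad1] i; pose d j : R := (j == i)%:R.
have dD : dirderiv d P = mpoly.mderiv i P.
  rewrite /dirderiv (bigD1 i)//= /d eqxx scale1r big1 ?addr0// => j ji.
  by rewrite (negbTE ji) scale0r.
pose p : {poly R} := mpoly.mmap polyC (fun j => (1 : R)%:P + d j *: 'X) P.
have pE t : p.[t] = evalS g (1%:M + t *: M d).
  rewrite -M1 -MD -meval_diag_restriction /p /mpoly.meval /mpoly.mmap horner_sum.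
  apply: eq_bigr => m _; rewrite hornerM hornerC; congr (_ * _).
  rewrite /mpoly.mmap1 horner_prod; apply: eq_bigr => j _.
  by rewrite horner_exp !hornerE mulrC.
have pC : map_poly rc p = line (fun=> rc 1) (fun j => rc (d j)) P.
  rewrite /p /line /mpoly.mmap rmorph_sum; apply: eq_bigr => m _.
  rewrite rmorphM/= map_polyC/=; congr (_ * _).
  rewrite rmorph_prod; apply: eq_bigr => j _; rewrite rmorphXn; congr (_ ^+ _).
  by rewrite rmorphD/= map_polyC map_polyZ map_polyX.
have <- : p^`().[0] = mpoly.meval one (mpoly.mderiv i P).
  apply: (fmorph_inj rc) => /=.
  by rewrite -evalC_real -dD -deriv_line -pC deriv_map horner_map.
have dp : is_derive (0 : R) (1 : R) (horner p) p^`().[0] by exact: is_derive_poly.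
have dg := grad1 (M d) (symM d).
have trM : \tr (c%:M *m M d) = c.
  rewrite mul_scalar_mx mxtraceZ /M mxtrace_mulC mulmxA QQ mul1mx mxtrace_diag.
  rewrite (bigD1 i)//= mxE /d eqxx big1 ?addr0 ?mulr1// => j ji.
  by rewrite mxE (negbTE ji).
rewrite trM in dg.
rewrite -(@derive_val _ _ _ _ _ _ _ dp) -(@derive_val _ _ _ _ _ _ _ dg) /derive.
set f1 := fun _ => _; set f2 := fun _ => _; suff -> : f1 = f2 by [].
apply/funext => t; rewrite /f1 /f2 /= !pE scale0r !addr0 [_ *: 1]mulr1.
by congr (_ *: (evalS g _ - _)); rewrite addrC.
Qed.

Hypothesis n0 : (0 < n)%N.

(** The gradient of g at I being central, the partial derivatives of the
    restriction at (1, ..., 1) coincide, so that all mean exponents are N / n. *)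
Lemma restriction_majorization lam : orthant lam ->
  (0 < N)%N /\ evalS g 1%:M * (\prod_i lam i) `^ (N%:R / n%:R) <= evalS g (M lam).
Proof.
move=> lam0; have [c c0 /restriction_gradient dP] := GD_central gGD.
have Ppos b : orthant b -> 0 < mpoly.meval b P.
  by move=> b0; rewrite meval_diag_restriction; exact/posdef_evalS_gt0/posdefM.
have hP := homog_diag_restriction Q.
have e0 : orthant (one : 'I_n -> R) by move=> i; rewrite ltr01.
have coef0 := hyperbolic_coeff_ge0 hP Ppos e0 restriction_hyperbolic.
have := arithmetic_geometric_mean coef0 (Ppos _ e0) dP lam0.
have -> : mpoly.meval one P = evalS g 1%:M by rewrite meval_diag_restriction -/(M one) M1.
rewrite meval_diag_restriction -/(M lam).
have g1 := GD_normalized gGD.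
(* Euler's identity at (1, ..., 1) *)
have cE : n%:R * c = N%:R * evalS g 1%:M.
  have <- : mpoly.meval one P = evalS g 1%:M by rewrite meval_diag_restriction -/(M one) M1.
  have -> : n%:R * c = \sum_(i < n) mpoly.meval one (mpoly.mderiv i P).
    by rewrite (eq_bigr (fun=> c)) ?sumr_const ?card_ord ?mulr_natl.
  under eq_bigr do rewrite /mpoly.mderiv raddf_sum /=.
  rewrite exchange_big /= mpoly.mevalE mulr_sumr big_seq [RHS]big_seq; apply: eq_bigr => m mP.
  rewrite -(homog_mdeg hP mP) natr_sum mulr_suml; apply: eq_bigr => i _.
  rewrite mpoly.mevalZ mpoly.mevalX -mulrA; congr (_ * (_ * _)).
  by rewrite !big1 // => j _; rewrite expr1n.
have n1 : 0 < n%:R :> R by rewrite ltr0n.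
have -> : c / evalS g 1%:M = N%:R / n%:R.
  by rewrite -[c](mulKf (lt0r_neq0 n1)) cE; field; rewrite !gt_eqF.
split=> //; rewrite -(ltr0n R); have : 0 < N%:R * evalS g 1%:M by rewrite -cE mulr_gt0.
by rewrite pmulr_lgt0.
Qed.

End Majorization.

Theorem garding_majorization (A : 'M[R]_n) : (0 < n)%N -> posdef A ->
  (0 < N)%N /\ evalS g 1%:M * (\det A) `^ (N%:R / n%:R) <= evalS g A.
Proof.
move=> n0 pA; have [sA Apos] := pA.
have [Q [lam [QQ AE]]] := spectral_theorem sA.
have lamE : diag_mx lam = diag_mx (\row_i lam ord0 i).
  by congr diag_mx; apply/rowP => i; rewrite mxE.
have := @restriction_majorization Q QQ n0 (lam ord0).
have -> : \prod_i lam ord0 i = \det A.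
  by rewrite AE !det_mulmx det_diag mulrAC -det_mulmx (mulmx1C QQ) det1 mul1r.
rewrite -lamE -AE; apply => i.
have := Apos (row i Q); rewrite quadfE AE !mulmxA dotp_mulmxl.
have -> : row i Q *m Q^T = delta_mx ord0 i by rewrite -row_mul QQ rowE mulmx1.
have -> : dotp (delta_mx ord0 i *m diag_mx lam) (delta_mx ord0 i) = lam ord0 i.
  rewrite /dotp (bigD1 i)//= mul_mx_diag !mxE !eqxx mul1r mulr1 big1 ?addr0// => j ji.
  by rewrite !mxE (negbTE ji) mulr0.
apply; apply/eqP => Q0; move/matrixP : QQ => /(_ i i).
rewrite !mxE eqxx big1 => [/esym/eqP|j _]; first by rewrite oner_eq0.
by move/rowP : Q0 => /(_ j); rewrite !mxE => ->; rewrite mul0r.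
Qed.

Lemma mxline_near (B : 'M[R]_n) (e : R) : 0 < e ->
  \forall B' \near B, forall t, nc ((mxline B' 1%:M).[t] - (mxline B 1%:M).[t]) <= e * (1 + nc t) ^+ N.
Proof.
move=> e0; pose b : R := 2 + \sum_i \sum_j `|B i j|.
have bB i j : 1 + `|B i j| <= b.
  rewrite /b (bigD1 i)//= (bigD1 j)//=.
  have : 0 <= \sum_(j0 < n | j0 != j) `|B i j0| by apply: sumr_ge0.
  have : 0 <= \sum_(i0 < n | i0 != i) \sum_j0 `|B i0 j0|.
    by apply: sumr_ge0 => i0 _; apply: sumr_ge0.
  lra.
have b1 : 1 <= b.
  have : 0 <= \sum_i \sum_j `|B i j| by apply: sumr_ge0 => i0 _; apply: sumr_ge0.
  by rewrite /b; lra.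
have [K K0 KP] := line_close (GD_homog gGD) b1.
pose d := Num.min 1 (e / (1 + K)).
have d0 : 0 < d by rewrite lt_min ltr01 divr_gt0// ltr_pwDl.
apply/nbhs_ballP; exists d => //= B' BB' t.
have BB'E i j : `|B' i j - B i j| < d by rewrite distrC; exact: (BB'.2 i j).
have cE (X : 'M[R]_n) (r : R) : (forall i j, `|X i j| <= r) ->
    forall k, nc (mxC (map_mx rc X) k) <= r.
  by move=> H k; case/mxvec_indexP: k => i j; rewrite /mxC mxvecE mxE nc_rc.
rewrite (le_trans (KP _ _ _ t d (ltW d0) _ _ _ _))//.
- apply: cE => i j; rewrite (le_trans _ (bB i j))// -[B' i j](subrK (B i j)).
  rewrite (le_trans (ler_normD _ _))// lerD2r (le_trans (ltW (BB'E i j)))//.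
  by rewrite ge_min lexx.
- by apply: cE => i j; rewrite (le_trans _ (bB i j))// lerDr.
- apply: cE => i j; rewrite (le_trans _ b1)// mxE normr_nat.
  by rewrite -[1]/(1%:R) ler_nat; case: (i == j).
- move=> k; case/mxvec_indexP: k => i j; rewrite /mxC !mxvecE !mxE -rmorphB nc_rc.
  exact: ltW.
- rewrite ler_wpM2r ?exprn_ge0 ?addr_ge0 ?nc_ge0//.
  rewrite (@le_trans _ _ (K * (e / (1 + K))))//.
    by rewrite ler_wpM2l// ge_min lexx orbT.
  have K1 : 0 < 1 + K by rewrite ltr_pwDl.
  by rewrite mulrCA ler_piMr ?(ltW e0)// ler_pdivrMr// mul1r lerDr.
Qed.

(** The roots of t |-> g (A + t I) are real, and nonzero for A in the cone; they are
    negative at A = I, and the cone is connected. *)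
Lemma garding_cone_root A (t : R) : garding_cone g A -> 0 <= t -> evalS g (A + t%:M) != 0.
Proof.
move=> GA t0; have g1 := GD_normalized gGD.
have c0 : rc (evalS g 1%:M) != 0 :> C by rewrite fmorph_eq0 gt_eqF.
suff : ~ root (mxline A 1%:M) (rc t).
  move=> H; apply/eqP => gA; apply: H.
  by rewrite rootE horner_mxline_real scalemx1 gA rmorph0.
pose D : set C := [set t | complex.Im t = 0 /\ 0 <= complex.Re t].
pose Z : set C := [set t | complex.Im t = 0 /\ t != 0].
have sepDZ (r s : C) : D s -> Z r -> ~ D r -> complex.Re r < 0 /\ complex.Re s - complex.Re r <= nc (s - r).
  move=> [s1 s2] [r1 r2] nD; split.
    by rewrite ltNge; apply/negP => r3; apply: nD.
  rewrite (le_trans _ (nc_Re _))// (le_trans _ (ler_norm _))//.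
  by case: (s) (r) => ? ? [].
apply: (@root_confinement R ('M[R]_n : topologicalType) (garding_cone g)
   (fun A => mxline A 1%:M) N (rc (evalS g 1%:M)) D Z (1%:M : 'M[R]_n)) => //.
- exact: component_connected.
- apply: (GD_cone gGD); exact: posdef1.
- by move=> B _; exact: has_lead_mxline.
- move=> B r /garding_cone_neq0[sB gB] rr; split; first exact: GD_root rr.
  apply: contra gB => /eqP r0; move: rr; rewrite r0 rootE -[0](rmorph0 rc) horner_mxline_real.
  by rewrite scale0r addr0 fmorph_eq0.
- move=> s Ds [_ s0]; exists (complex.Re s).
    have [s1 s2] := Ds; rewrite lt_neqAle s2 andbT eq_sym.
    by apply: contra s0 => /eqP s3; rewrite eq_complex s1 s3 /= !eqxx.
  move=> r Zr nDr; have [r0] := sepDZ _ _ Ds Zr nDr; apply: le_trans.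
  by rewrite lerDl oppr_ge0 ltW.
- move=> r Zr nDr; exists (- complex.Re r).
    have D0 : D 0 by split.
    by rewrite oppr_gt0; have [] := sepDZ _ _ D0 Zr nDr.
  move=> s Ds; have [r0] := sepDZ _ _ Ds Zr nDr; apply: le_trans.
  by rewrite lerDr; have [] := Ds.
- move=> B GB e e0; apply: filterS (mxline_near B e0) => B' H _ s _; exact: H.
- move=> r [r1 r2]; rewrite rootE.
  have -> : r = rc (complex.Re r) by case: (r) r1 => u v /= ->.
  rewrite horner_mxline_real fmorph_eq0.
  have -> : 1%:M + complex.Re r *: 1%:M = (1 + complex.Re r) *: (1%:M : 'M[R]_n).
    by rewrite scalerDl scale1r.
  rewrite evalS_scale.
  apply/negP; rewrite mulf_neq0 ?gt_eqF//.
  by rewrite exprn_gt0// ltr_pwDl.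
Qed.

(** For A in the cone, the roots of t |-> g (A + t I) are at distance at least s from
    s, so that |g (A + s I)| >= g(I) s^N; but g vanishes at - s I + s I = 0. *)
Lemma garding_cone_closure (s : R) : (0 < N)%N -> 0 < s -> ~ closure (garding_cone g) (- s%:M).
Proof.
move=> N0 s0 clS; have g1 := GD_normalized gGD.
pose e := evalS g 1%:M * s ^+ N / (2 * (1 + s) ^+ N).
have s1 : 0 < 1 + s by rewrite ltr_wpDr// ltW.
have e0 : 0 < e by rewrite divr_gt0 ?mulr_gt0 ?exprn_gt0.
have [B [GB HB]] := clS _ (mxline_near (- s%:M) e0).
have := HB (rc s); rewrite !horner_mxline_real scalemx1 addNr.
have -> : evalS g 0 = 0.
  by rewrite -[X in evalS g X](scale0r (1%:M : 'M[R]_n)) evalS_scale expr0n gtn_eqF ?mul0r.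
rewrite rmorph0 subr0 !nc_rc (gtr0_norm s0).
have [sB gB] := garding_cone_neq0 GB.
have c0 : rc (evalS g 1%:M) != 0 :> C by rewrite fmorph_eq0 gt_eqF.
have := @nc_away R N (rc (evalS g 1%:M)) (mxline B 1%:M) (rc s) s c0 (has_lead_mxline B) (ltW s0).
rewrite horner_mxline_real !nc_rc scalemx1 (gtr0_norm g1) => H h1.
suff : evalS g 1%:M * s ^+ N <= e * (1 + s) ^+ N.
  rewrite /e invfM mulrA mulfVK ?gt_eqF ?exprn_gt0// leNgt => /negP; apply.
  by rewrite ltr_pdivrMr// mulr_natr mulr2n ltrDl mulr_gt0// exprn_gt0.
apply: le_trans h1; apply: H => r rr.
have r0 := GD_root sB rr.
have rE : r = rc (complex.Re r) by case: (r) r0 => u v /= ->.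
rewrite rE -rmorphB nc_rc (le_trans _ (ler_norm _))// lerDl oppr_ge0.
rewrite leNgt; apply/negP => r1; move: rr; rewrite rE rootE horner_mxline_real fmorph_eq0 scalemx1.
exact/negP/garding_cone_root/ltW.
Qed.

End Garding.

(** * Quadratic test functions and the maximum principle *)

Section Quadratic.
Context {R : realType} {n : nat}.
Local Notation V := 'rV[R]_n.

Lemma derive_quadratic (u : V -> R) (y v : V) (b c : R) : differentiable u y ->
  (forall t : R, u (y + t *: v) = u y + b * t + c * t ^+ 2) -> 'D_v u y = b.
Proof.
move=> du uE; have dy : differentiable u (y + (0 : R) *: v) by rewrite scale0r addr0.
have := is_derive_line dy; rewrite scale0r addr0 -derive_grad// => d1.
pose p : {poly R} := (u y)%:P + b *: 'X + c *: 'X^2.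
have pE : (fun s : R => u (y + s *: v)) = horner p.
  by apply/funext => s; rewrite uE /p !hornerE.
rewrite pE in d1.
have d2 : is_derive (0 : R) (1 : R) (horner p) p^`().[0] by exact: is_derive_poly.
rewrite -(@derive_val _ _ _ _ _ _ _ d1) (@derive_val _ _ _ _ _ _ _ d2).
rewrite /p !derivD derivC !derivZ derivX derivXn /= expr1.
by rewrite !(hornerD, hornerZ, hornerC, hornerX) !addr0 mulr0 addr0 add0r mulr1.
Qed.

Definition quadratic (x : V) (c : R) (p : V) (A : 'M[R]_n) (y : V) : R :=
  c + dotp p (y - x) + quadf A (y - x) / 2.

Lemma differentiable_affine (x : V) (c : R) (p : V) (y : V) :
  differentiable (fun z : V => c + dotp p (z - x)) y.
Proof.
rewrite (_ : (fun _ => _) = cst (c - dotp p x) +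
  \sum_(i < n) (p ord0 i *: (fun z : V => z ord0 i))); last first.
  apply/funext => z /=; rewrite dotpDr dotpNr addrCA addrC fctE; congr (_ + _).
  by rewrite fct_sumE /dotp; apply: eq_bigr.
apply: differentiableD; first exact: differentiable_cst.
apply: differentiable_sum => i; apply: differentiableZ; exact: differentiable_coord.
Qed.

Lemma dotp_delta1 (y : V) (i : 'I_n) : dotp y (delta_mx ord0 i) = y ord0 i.
Proof. by rewrite -[delta_mx _ _]scale1r dotp_delta ?mul1r ?mulr1. Qed.

Variables (x : V) (c : R) (p : V) (A : 'M[R]_n).
Hypothesis symA : sym A.
Local Notation q := (quadratic x c p A).

Lemma quadf_coord (y : V) : quadf A y = \sum_i (\sum_j y ord0 j * A j i) * y ord0 i.
Proof. by rewrite quadfE /dotp; apply: eq_bigr => i _; rewrite mxE. Qed.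

Lemma differentiable_quadratic (y : V) : differentiable q y.
Proof.
pose co (i : 'I_n) (z : V) := (z - x) ord0 i.
have dco i : differentiable (co i) y.
  rewrite (_ : co i = (fun z : V => z ord0 i) + cst (- x ord0 i)); last first.
    by apply/funext => z; rewrite /co !mxE.
  by apply: differentiableD; [exact: differentiable_coord|exact: differentiable_cst].
rewrite (_ : q = (fun z => c + dotp p (z - x)) +
    2^-1 *: \sum_(i < n) ((\sum_(j < n) (A j i *: co j)) * co i)); last first.
  apply/funext => z; rewrite /quadratic fctE; congr (_ + _).
  rewrite mulrC -[RHS]/(2^-1 * _); congr (_ * _).
  rewrite quadf_coord fct_sumE; apply: eq_bigr => i _.
  rewrite fctE fct_sumE; congr (_ * _); apply: eq_bigr => j _.
  by rewrite mulrC.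
apply: differentiableD; first exact: differentiable_affine.
apply: differentiableZ; apply: differentiable_sum => i; apply: differentiableM => //.
by apply: differentiable_sum => j; apply: differentiableZ.
Qed.

Let quadratic_line (y v : V) (t : R) :
  q (y + t *: v) = q y + dotp (p + (y - x) *m A) v * t + quadf A v / 2 * t ^+ 2.
Proof.
rewrite /quadratic.
have -> : y + t *: v - x = (y - x) + t *: v by rewrite addrAC.
move: (y - x) => w; rewrite dotpDr dotpZr [dotp (p + _) _]dotpDl.
have -> : quadf A (w + t *: v) = quadf A w + 2 * t * dotp (w *m A) v + t ^+ 2 * quadf A v.
  rewrite !quadfE mulmxDl -scalemxAl !dotpDl !dotpDr !dotpZl !dotpZr.
  have -> : dotp (v *m A) w = dotp (w *m A) v by rewrite dotp_mulmxl symA dotpC.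
  by ring.
by move: (quadf _ _) (dotp _ _) => ? ?; field.
Qed.

Lemma partial_quadratic i : partial i q = fun y => (p + (y - x) *m A) ord0 i.
Proof.
apply/funext => y; rewrite /partial (derive_quadratic (differentiable_quadratic y) (quadratic_line y _)).
by rewrite dotp_delta1.
Qed.

Let partial_affine i : partial i q = fun y => p ord0 i + dotp (\row_j A j i) (y - x).
Proof.
rewrite partial_quadratic; apply/funext => y; rewrite mxE; congr (_ + _).
by rewrite mxE /dotp; apply: eq_bigr => j _; rewrite mxE mulrC.
Qed.

Let partial2_quadratic i j : partial i (partial j q) = cst (A i j).
Proof.
apply/funext => y; rewrite partial_affine {1}/partial.
apply: (@derive_quadratic _ _ _ (A i j) 0); first exact: differentiable_affine.
move=> t; rewrite mul0r addr0 -[RHS]addrA; congr (_ + _).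
have -> : y + t *: delta_mx ord0 i - x = (y - x) + t *: delta_mx ord0 i by rewrite addrAC.
by rewrite dotpDr dotpZr dotp_delta1 mxE mulrC.
Qed.

Lemma C2_near_quadratic (y : V) : C2_near q y.
Proof.
apply: (@nearW _ (nbhs y) _ (nbhs_filter y)) => z; split; first exact: differentiable_quadratic.
  by move=> i; rewrite partial_affine; exact: differentiable_affine.
by move=> i j; rewrite partial2_quadratic; exact: cst_continuous.
Qed.

Lemma quadratic_jet : (q x, grad q x, hess q x) = (c, p, A).
Proof.
rewrite /quadratic subrr /dotp big1 => [|i _]; last by rewrite mxE mulr0.
rewrite quadfE mul0mx /dotp big1 => [|i _]; last by rewrite mxE mul0r.
rewrite mul0r !addr0; congr (_, _, _).
  by apply/rowP => i; rewrite mxE partial_quadratic subrr mul0mx addr0.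
by apply/matrixP => i j; rewrite mxE partial2_quadratic.
Qed.

End Quadratic.

Lemma quadratic_upper_jet {R : realType} n (u : 'rV[R]_n -> R) x p A : sym A ->
  (\forall y \near x, u y <= u x + dotp p (y - x) + quadf A (y - x) / 2) ->
  upper_jet u x (u x, p, A).
Proof.
move=> sA H; exists (quadratic x (u x) p A); split=> //.
- exact: C2_near_quadratic.
- by have /(congr1 (fun j => j.1.1))/= -> := quadratic_jet x (u x) p sA.
- by rewrite quadratic_jet.
Qed.

Lemma quadratic_lower_jet {R : realType} n (u : 'rV[R]_n -> R) x p A : sym A ->
  (\forall y \near x, u x + dotp p (y - x) + quadf A (y - x) / 2 <= u y) ->
  lower_jet u x (u x, p, A).
Proof.
move=> sA H; exists (quadratic x (u x) p A); split=> //.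
- exact: C2_near_quadratic.
- by have /(congr1 (fun j => j.1.1))/= -> := quadratic_jet x (u x) p sA.
- by rewrite quadratic_jet.
Qed.

Section MaximumPrinciple.
Context {R : realType} {n : nat}.
Local Notation V := 'rV[R]_n.
Implicit Types (Omega : set V) (h : V -> R).

Lemma open_bdry Omega x : open Omega -> closure Omega x -> ~ bdry Omega x -> Omega x.
Proof.
move=> oO clx nb; apply: contrapT => nx; apply: nb; split=> //.
by move/interior_subset.
Qed.

Lemma closure_bounded Omega : bounded_set Omega -> bounded_set (closure Omega).
Proof.
move=> [M [Mr MO]]; exists M; split=> // r Mr' x clx.
have /closure_id E := @closed_closed_ball_ R V 0 r.
have : closed_ball_ Num.norm (0 : V) r x.
  rewrite E; apply: closureS clx => y Oy; rewrite /closed_ball_/= sub0r normrN.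
  exact: MO Oy.
by rewrite /closed_ball_/= sub0r normrN.
Qed.

Lemma compact_closure_bounded Omega : bounded_set Omega -> compact (closure Omega).
Proof.
by move=> bO; apply: bounded_closed_compact; [exact: closure_bounded|exact: closed_closure].
Qed.

Lemma bdry_closure Omega : bdry Omega `<=` closure Omega. Proof. by move=> x []. Qed.

Lemma continuous_dotp (p x : V) : continuous (fun y : V => dotp p (y - x)).
Proof.
move=> y; apply: differentiable_continuous.
rewrite (_ : (fun _ => _) = (fun z : V => 0 + dotp p (z - x))).
  exact: differentiable_affine.
by apply/funext => z; rewrite add0r.
Qed.

Lemma continuous_sqr (a : R) : continuous (fun y : V => a * dotp y y).
Proof.
move=> y; apply: differentiable_continuous.
rewrite (_ : (fun _ => _) = quadratic 0 0 0 ((2 * a)%:M)); last first.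
  apply/funext => z; rewrite /quadratic subr0 quadfE mul_mx_scalar dotpZl.
  rewrite [dotp 0 z]big1 ?add0r => [|i _]; last by rewrite mxE mul0r.
  by field.
apply: differentiable_quadratic; exact: tr_scalar_mx.
Qed.

(** If h x0 > m, a small multiple e of |x|^2 keeps the maximum of h + e |x|^2 inside
    Omega, where - 2 e I is then the Hessian of an upper jet. *)
Theorem maximum_principle (N : nat) (g : mpoly.mpoly (n * n) R) (f : V -> R) Omega h (m : R) :
  central_GD N g -> (0 < N)%N -> open Omega -> bounded_set Omega ->
  {within closure Omega, continuous h} -> admissible_solution g f Omega h ->
  (forall z, bdry Omega z -> h z <= m) -> forall x, Omega x -> h x <= m.
Proof.
move=> gGD N0 oO bO ch [_ sol] hm x0 Ox0; rewrite leNgt; apply/negP => mx0.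
have [B B0 HB] : exists2 B : R, 0 <= B & forall y, closure Omega y -> dotp y y <= B.
  have [M [_ MC]] := closure_bounded bO.
  have M1 : M < `|M| + 1 by rewrite (le_lt_trans (ler_norm M))// ltrDl.
  exists (n%:R * (`|M| + 1) ^+ 2); first by rewrite mulr_ge0// sqr_ge0.
  by move=> y Cy; apply: dotp_le_norm; exact: MC Cy.
pose e := (h x0 - m) / (2 * (B + 1)).
have B1 : 0 < 2 * (B + 1) by rewrite mulr_gt0// ltr_wpDl.
have e0 : 0 < e by rewrite divr_gt0// subr_gt0.
have eB : e * B < h x0 - m.
  rewrite /e -mulrA gtr_pMr ?subr_gt0// mulrC ltr_pdivrMr// mul1r.
  by move: B0; clear; lra.
have cw : {within closure Omega, continuous (fun y => h y + e * dotp y y)}.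
  have cs : {within closure Omega, continuous (fun y : V => e * dotp y y)}.
    by apply: continuous_subspaceT => y; exact: continuous_sqr.
  by move=> y; exact: cvgD (ch y) (cs y).
have [] := @compact_EVT_max _ R (fun y => h y + e * dotp y y) (closure Omega) _ _ cw.
- by exists x0; exact: subset_closure.
- exact: compact_closure_bounded.
move=> x1; rewrite inE => Cx1 xmax.
have {}xmax y : closure Omega y -> h y + e * dotp y y <= h x1 + e * dotp x1 x1.
  by move=> Cy; apply: xmax; rewrite inE.
have Ox1 : Omega x1.
  apply: (open_bdry oO Cx1) => bx1.
  have := xmax x0 (subset_closure Ox0); have := hm _ bx1.
  have : e * dotp x1 x1 <= e * B by rewrite ler_wpM2l ?(ltW e0)// HB.
  have : 0 <= e * dotp x0 x0 by rewrite mulr_ge0 ?dotp_ge0// ltW.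
  by lra.
have sA : sym (- (2 * e)%:M : 'M[R]_n) by rewrite /sym/= linearN/= tr_scalar_mx.
have [+ _] := sol x1 Ox1.
move=> /(_ (h x1) (- (2 * e) *: x1) (- (2 * e)%:M)) [].
  apply: quadratic_upper_jet => //.
  apply: (@filterS _ (nbhs x1) (nbhs_filter x1) _ _ _ (open_nbhs_nbhs (conj oO Ox1))) => y Oy.
  have := xmax y (subset_closure Oy).
  rewrite quadfE mulmxN mul_mx_scalar dotpNl !dotpZl !dotpDr !dotpDl !dotpNl !dotpNr.
  rewrite (dotpC y x1); lra.
by move=> + _; apply: (garding_cone_closure gGD N0); rewrite mulr_gt0.
Qed.

End MaximumPrinciple.

(** * The equation at contact points *)

Section PositiveDefinite.
Context {R : realType} {n : nat}.
Local Notation V := 'rV[R]_n.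
Implicit Types (A : 'M[R]_n).

Lemma psd_posdef A : sym A -> (forall v, 0 <= quadf A v) -> \det A != 0 -> posdef A.
Proof.
move=> sA A0 dA; split=> // v v0; rewrite lt_neqAle A0 andbT eq_sym.
apply: contra v0 => /eqP qv.
have [//|vA] : v *m A = 0 \/ v *m A != 0 by case: eqVneq => ?; [left|right].
  move=> vA0; apply/eqP.
  have uA : A \in unitmx by rewrite unitmxE unitfE.
  by rewrite -[v]mulmx1 -(mulmxV uA) mulmxA vA0 mul0mx.
(* otherwise the form is negative at v - t v A for small positive t *)
exfalso; pose w := v *m A; pose s := dotp w w; pose q := quadf A w.
have s0 : 0 < s.
  by rewrite lt_neqAle dotp_ge0 andbT eq_sym; apply: contra vA => /eqP/dotp_eq0/eqP.
have q0 : 0 <= q by exact: A0.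
pose t := s / (q + 1).
have t0 : 0 < t by rewrite divr_gt0// ltr_wpDl.
have := A0 (v - t *: w).
have -> : quadf A (v - t *: w) = t ^+ 2 * q - 2 * t * s.
  have vw : dotp (v *m A) w = s by [].
  have wv : dotp (w *m A) v = s by rewrite dotp_mulmxl sA dotpC.
  have vv : dotp (v *m A) v = 0 by rewrite -quadfE.
  rewrite quadfE mulmxBl -scalemxAl dotpDl dotpNl dotpZl !dotpDr !dotpNr !dotpZr vw wv vv.
  by rewrite -[dotp (w *m A) w]quadfE -/q; ring.
have tq : t * (q + 1) = s by rewrite /t divfK// gt_eqF// ltr_wpDl.
move: tq t0 s0 q0; clear; move: (t) (s) (q) => t1 s1 q1 <- t0 s0 q0; nra.
Qed.

(** d is at most the smallest eigenvalue. *)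
Lemma posdef_coercive A : posdef A -> exists2 d : R, 0 < d & forall v, d * dotp v v <= quadf A v.
Proof.
move=> pA; have [sA Apos] := pA.
have [Q [lam [QQ AE]]] := spectral_theorem sA.
have QtQ := mulmx1C QQ.
have qE v : quadf A v = \sum_i lam ord0 i * (v *m Q^T) ord0 i ^+ 2.
  rewrite quadfE AE !mulmxA dotp_mulmxl /dotp; apply: eq_bigr => i _.
  by rewrite mul_mx_diag !mxE; ring.
have dE v : dotp v v = \sum_i (v *m Q^T) ord0 i ^+ 2.
  rewrite -[X in dotp X _]mulmx1 -QtQ mulmxA dotp_mulmxl /dotp.
  by apply: eq_bigr => i _; rewrite expr2.
have [|i|d d0 dlam] := @common_radius R 'I_n (fun i d => d <= lam ord0 i).
- by move=> i d d'; exact: le_trans.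
- exists (lam ord0 i) => //.
  have -> : lam ord0 i = quadf A (row i Q).
    rewrite qE (bigD1 i)//= -row_mul QQ !mxE eqxx expr1n mulr1 big1 ?addr0// => j ji.
    by rewrite !mxE eq_sym (negbTE ji) expr0n mulr0.
  apply: Apos; apply/eqP => Q0; move/matrixP : QQ => /(_ i i).
  rewrite !mxE eqxx big1 => [/esym/eqP|j _]; first by rewrite oner_eq0.
  by move/rowP : Q0 => /(_ j); rewrite !mxE => ->; rewrite mul0r.
exists d => // v; rewrite qE dE mulr_sumr; apply: ler_sum => i _.
by rewrite ler_wpM2r ?sqr_ge0.
Qed.

End PositiveDefinite.

Section Contact.
Context {R : realType} {n N : nat}.
Local Notation V := 'rV[R]_n.
Variables (g : mpoly.mpoly (n * n) R) (f : V -> R) (Omega : set V) (h : V -> R).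
Hypotheses (n0 : (0 < n)%N) (gGD : central_GD N g) (oO : open Omega).
Hypotheses (hC11 : C11 Omega h) (sol : admissible_solution g f Omega h).

Lemma open_ball_sub x : Omega x -> exists2 r : R, 0 < r & ball x r `<=` Omega.
Proof.
move=> Ox; have /nbhs_ballP[r r0 rO] := open_nbhs_nbhs (conj oO Ox).
by exists r.
Qed.

Lemma C11_lipschitz x : Omega x -> exists r L : R, [/\ 0 < r, 0 <= L, ball x r `<=` Omega &
  forall y z, ball x r y -> ball x r z -> `|grad h y - grad h z| <= L * `|y - z|].
Proof.
move=> Ox; have [U nU lipU] := hC11.2 x Ox.
have /nbhs_ballP[r r0 rU] := nU; have [r' r'0 rO] := open_ball_sub Ox.
have [M [_ HM]] := lipU.
exists (Num.min r r'), (`|M| + 1); split.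
- by rewrite lt_min r0.
- by rewrite addr_ge0.
- by move=> y xy; apply: rO; apply: le_ball xy; rewrite ge_min lexx orbT.
move=> y z xy xz; apply: (HM (`|M| + 1) _ (y, z)).
  by rewrite (le_lt_trans (ler_norm _))// ltrDl.
by split; apply: rU; [apply: le_ball xy|apply: le_ball xz]; rewrite ge_min lexx.
Qed.

Lemma continuous_grad x : Omega x -> {for x, continuous (grad h)}.
Proof.
move=> Ox; have [r [L [r0 L0 rO lip]]] := C11_lipschitz Ox.
apply: (@cvgrPdist_le _ _ _ (nbhs x) (nbhs_filter x) _ _).2 => e e0.
have L1 : 0 < L + 1 by rewrite ltr_wpDl.
pose d := Num.min r (e / (L + 1)).
have d0 : 0 < d by rewrite lt_min r0 divr_gt0.
apply/nbhs_ballP; exists d => //= y xy.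
rewrite (le_trans (lip _ _ (ballxx _ r0) _))//.
  by apply: le_ball xy; rewrite ge_min lexx.
have : `|x - y| < d by rewrite -ball_normE in xy.
rewrite lt_min => /andP[_]; rewrite ltr_pdivlMr// => xe.
by rewrite (le_trans _ (ltW xe))// mulrC ler_wpM2l// lerDl.
Qed.

Section Point.
Variables (x : V) (A : 'M[R]_n).
Hypotheses (Ox : Omega x) (dG : derivative_mx (grad h) x A).

Let taylor (e : R) : 0 < e -> exists2 d : R, 0 < d & forall v : V, `|v| < d ->
  `|h (x + v) - h x - dotp (grad h x) v - quadf A v / 2| <= e * `|v| ^+ 2.
Proof.
have [r r0 rO] := open_ball_sub Ox.
by apply: (taylor2 r0) => // y xy; apply: hC11.1; exact: rO.
Qed.

Lemma contact_sym : sym A.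
Proof.
have [r r0 rO] := open_ball_sub Ox.
by apply: (@derivative_mx_sym _ _ h x A r) => // y xy; apply: hC11.1; exact: rO.
Qed.

Lemma norm_le_enorm (v : V) : `|v| <= enorm v.
Proof.
apply/norm_rV_le => [|i]; first exact: sqrtr_ge0.
rewrite -sqrtr_sqr ler_wsqrtr// /dotp (bigD1 i)//= expr2 lerDl.
by apply: sumr_ge0 => j _; rewrite -expr2 sqr_ge0.
Qed.

Lemma Diff2_opp : Diff2 Omega (fun y => - h y) x.
Proof.
split=> //; exists (- grad h x), (- A).
  by rewrite /sym/= linearN/= contact_sym.
move=> e e0; have [d d0 H] := taylor e0.
apply/nbhs_ballP; exists d => //= y xy.
have xyd : `|y - x| < d by move: xy; rewrite -ball_normE /= distrC.
have := H _ xyd; rewrite [x + (y - x)]addrC subrK.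
have -> : - h y - (- h x + dotp (- grad h x) (y - x) + quadf (- A) (y - x) / 2) =
    - (h y - h x - dotp (grad h x) (y - x) - quadf A (y - x) / 2).
  by rewrite dotpNl [quadf (- A) _]quadfE mulmxN dotpNl -quadfE; ring.
rewrite normrN; move=> /le_trans; apply; rewrite ler_wpM2l ?(ltW e0)//.
by rewrite lerXn2r ?nnegrE ?sqrtr_ge0// norm_le_enorm.
Qed.

Hypothesis contact : forall y, Omega y -> h x + dotp (grad h x) (y - x) <= h y.

(** Subtract the supporting plane from the Taylor expansion, on short multiples of
    v. *)
Lemma contact_psd v : 0 <= quadf A v.
Proof.
apply/ler_addgt0Pr => e e0; have [r r0 rO] := open_ball_sub Ox.
have v1 : 0 < 1 + `|v| by rewrite ltr_pwDl.
pose e' := e / (2 * (1 + `|v|) ^+ 2).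
have e'0 : 0 < e' by rewrite divr_gt0// mulr_gt0// exprn_gt0.
have [d d0 H] := taylor e'0.
pose t := Num.min r d / (1 + `|v|) / 2.
have rd : 0 < Num.min r d by rewrite lt_min r0 d0.
have t0 : 0 < t by rewrite !divr_gt0.
have tv : `|t *: v| < Num.min r d.
  rewrite normrZ gtr0_norm// /t -!mulrA -[ltRHS]mulr1 ltr_pM2l// mulrC.
  have := normr_ge0 v; move: (`|v|) v1 => w w1 w0.
  by rewrite ltr_pdivrMr// mul1r; lra.
have tv1 : `|t *: v| < r by apply: lt_le_trans tv _; rewrite ge_min lexx.
have tv2 : `|t *: v| < d by apply: lt_le_trans tv _; rewrite ge_min lexx orbT.
have Oy : Omega (x + t *: v).
  by apply: rO; rewrite -ball_normE /= opprD addrA subrr sub0r normrN.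
have := contact Oy; rewrite [x + _ - x]addrAC subrr add0r => c1.
have := H _ tv2; rewrite ler_norml => /andP[_ c2].
have : 0 <= quadf A (t *: v) / 2 + e' * `|t *: v| ^+ 2 by move: c1 c2; lra.
rewrite quadfE -scalemxAl dotpZl dotpZr -quadfE normrZ gtr0_norm// exprMn.
have -> : t * (t * quadf A v) / 2 + e' * (t ^+ 2 * `|v| ^+ 2) =
  t ^+ 2 / 2 * (quadf A v + 2 * e' * `|v| ^+ 2) by field.
rewrite pmulr_rge0 ?divr_gt0 ?exprn_gt0// => /le_trans; apply; rewrite lerD2l.
have W0 : 0 < (1 + `|v|) ^+ 2 by rewrite exprn_gt0.
have -> : 2 * e' * `|v| ^+ 2 = e * (`|v| ^+ 2 / (1 + `|v|) ^+ 2).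
  by rewrite /e'; field; rewrite gt_eqF.
rewrite ler_piMr ?(ltW e0)// ler_pdivrMr// mul1r lerXn2r ?nnegrE ?(ltW v1)//.
by rewrite lerDr.
Qed.

(** Shrinking A slightly leaves room for the Taylor error, so that (1 - e) A is the
    Hessian of a lower jet; by homogeneity e can tend to 0. *)
Lemma contact_garding : posdef A -> evalS g A <= f x.
Proof.
move=> pA; have [d d0 dA] := posdef_coercive pA.
have g0 : 0 < evalS g A := posdef_evalS_gt0 gGD pA.
have key e : 0 < e -> e < 1 -> (1 - e) ^+ N * evalS g A <= f x.
  move=> e0 e1; have e2 : 0 < 1 - e by rewrite subr_gt0.
  have pB : posdef ((1 - e) *: A).
    have [sA Apos] := pA; split; first by rewrite /sym/= linearZ/= sA.
    by move=> v v0; rewrite quadfZ mulr_gt0// Apos.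
  have [_ low] := sol.2 x Ox.
  rewrite -(evalS_scale gGD).
  have [] := low (h x) (grad h x) ((1 - e) *: A).
  - apply: quadratic_lower_jet; first by have [] := pB.
    have ed : 0 < e * d / 2 by rewrite divr_gt0// mulr_gt0.
    have [r r0 H] := taylor ed.
    apply/nbhs_ballP; exists r => //= y xy.
    have xyd : `|y - x| < r by move: xy; rewrite -ball_normE /= distrC.
    have := H _ xyd; rewrite [x + (y - x)]addrC subrK ler_norml => /andP[+ _].
    have : d * `|y - x| ^+ 2 <= quadf A (y - x).
      apply: le_trans (dA _); rewrite ler_wpM2l ?(ltW d0)//.
      rewrite -[leRHS]sqr_sqrtr ?dotp_ge0//.
      by rewrite lerXn2r ?nnegrE ?sqrtr_ge0// norm_le_enorm.
    rewrite quadfZ; move: (`|y - x| ^+ 2) (quadf _ _) (dotp _ _) (h y) (h x) => w q a b c dq lb.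
    have := ler_wpM2l (ltW e0) dq; lra.
  - by move=> nC; exfalso; apply: nC; apply: subset_closure; exact: (GD_cone gGD pB).
  - by case.
apply/ler_addgt0Pr => e e0.
pose M := 1 + N%:R * evalS g A.
have M0 : 0 < M by rewrite ltr_pwDl// mulr_ge0// ltW.
pose t := Num.min (1 / 2) (e / M).
have t0 : 0 < t by rewrite lt_min !divr_gt0.
have t1 : t < 1 by rewrite gt_min ltr_pdivrMr// mul1r ltr1n.
have tM : t * M <= e by rewrite -ler_pdivlMr// ge_min lexx orbT.
rewrite -lerBlDr (le_trans _ (key t t0 t1))//.
have bern : 1 - N%:R * t <= (1 - t) ^+ N.
  elim: (N) => [|m IH]; first by rewrite mul0r subr0 expr0.
  rewrite exprS -natr1 (@le_trans _ _ ((1 - t) * (1 - m%:R * t)))//.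
    have : 0 <= m%:R :> R by [].
    move=> m0; have : 0 <= m%:R * (t * t) by rewrite !mulr_ge0// ltW.
    by rewrite mulrBr mulr1 mulrBl mul1r; lra.
  by rewrite ler_wpM2l// subr_ge0 ltW.
apply: (@le_trans _ _ ((1 - N%:R * t) * evalS g A)); last by rewrite ler_wpM2r// ltW.
move: tM; rewrite /M => tM; rewrite mulrBl mul1r lerD2l lerN2.
rewrite (le_trans _ tM)// mulrDr mulr1 mulrA [t * _]mulrC.
by rewrite lerDr ltW.
Qed.

(** Singular A are trivial; the others are positive definite and subject to both the
    equation and the majorization of the determinant. *)
Lemma contact_det : \det A <= (f x / evalS g 1%:M) `^ (n%:R / N%:R).
Proof.
have [dA|dA] := eqVneq (\det A) 0; first by rewrite dA powR_ge0.
have pA := psd_posdef contact_sym contact_psd dA.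
have [dA0 _] := leb_posdef pA.
have [N0 maj] := garding_majorization gGD n0 pA.
have g1 := GD_normalized gGD.
have -> : \det A = ((\det A) `^ (N%:R / n%:R)) `^ (n%:R / N%:R).
  rewrite -powRrM mulrA mulfVK ?pnatr_eq0 -?lt0n// divff ?pnatr_eq0 -?lt0n//.
  by rewrite powRr1// ltW.
have m0 : 0 <= evalS g 1%:M * \det A `^ (N%:R / n%:R) by rewrite mulr_ge0 ?powR_ge0// ltW.
have fle := le_trans maj (contact_garding pA).
have fg0 : 0 <= f x / evalS g 1%:M by apply: divr_ge0; [exact: le_trans m0 fle|exact: ltW].
apply: ge0_ler_powR; rewrite ?nnegrE ?fg0 ?divr_ge0 ?powR_ge0//.
by rewrite ler_pdivlMr// mulrC.
Qed.

Lemma contact_image_bound K (e : R) : 0 < e -> exists2 d : R, 0 < d &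
  image_bound (grad h) K x ((f x / evalS g 1%:M) `^ (n%:R / N%:R) + e) d.
Proof.
move=> e0; have [dA|dA] := eqVneq (\det A) 0.
  have [d d0 H] := image_bound_singular K contact_sym contact_psd dA dG e0.
  by exists d => //; apply: image_bound_le H; rewrite lerDr powR_ge0.
have pA := psd_posdef contact_sym contact_psd dA.
have [d d0 H] := image_bound_posdef K pA dG e0.
by exists d => //; apply: image_bound_le H; rewrite lerD2r contact_det.
Qed.

End Point.
End Contact.

(** * Euclidean balls, real powers and integrals *)

Section Euclidean.
Context {R : realType} {n : nat}.
Local Notation V := 'rV[R]_n.

Lemma cauchy_schwarz (x y : V) : dotp x y <= enorm x * enorm y.
Proof.
rewrite /enorm -sqrtrM ?dotp_ge0// (le_trans (ler_norm _))// -sqrtr_sqr ler_wsqrtr//.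
have [y0|y0] := eqVneq (dotp y y) 0.
  by rewrite y0 mulr0 (dotp_eq0 y0) /dotp big1 ?expr0n// => i _; rewrite mxE mulr0.
have yp : 0 < dotp y y by rewrite lt_neqAle eq_sym y0 dotp_ge0.
have := dotp_ge0 (dotp y y *: x - dotp x y *: y).
rewrite dotpDl dotpNl !dotpZl !dotpDr !dotpNr !dotpZr (dotpC y x).
have -> : dotp y y * (dotp y y * dotp x x - dotp x y * dotp x y) -
    dotp x y * (dotp y y * dotp x y - dotp x y * dotp y y) =
    dotp y y * (dotp x x * dotp y y - dotp x y ^+ 2) by ring.
by rewrite pmulr_rge0// subr_ge0.
Qed.

Lemma enorm_sqr (x : V) : enorm x ^+ 2 = dotp x x.
Proof. by rewrite sqr_sqrtr// dotp_ge0. Qed.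

Lemma enormZ (a : R) (x : V) : enorm (a *: x) = `|a| * enorm x.
Proof. by rewrite /enorm dotpZl dotpZr mulrA -expr2 sqrtrM ?sqr_ge0// sqrtr_sqr. Qed.

Lemma continuous_enorm (x0 : V) : continuous (fun x : V => enorm (x - x0)).
Proof.
move=> x; rewrite /enorm.
have c1 : {for x, continuous (fun y : V => dotp (y - x0) (y - x0))}.
  apply: differentiable_continuous.
  rewrite (_ : (fun _ => _) = quadratic x0 0 0 (2%:M)); last first.
    apply/funext => z; rewrite /quadratic quadfE mul_mx_scalar dotpZl.
    by rewrite [dotp 0 _]big1 ?add0r => [|i _]; [field|rewrite mxE mul0r].
  by apply: differentiable_quadratic; exact: tr_scalar_mx.
exact: (continuous_comp c1 (@sqrt_continuous R _)).
Qed.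

Lemma open_eball (r : R) : open [set x : V | enorm x < r].
Proof.
rewrite (_ : [set _ | _] = (fun x : V => enorm (x - 0)) @^-1` [set t | t < r]).
  by apply: open_comp => [x _|]; [exact: continuous_enorm|exact: open_lt].
by apply/seteqP; split => x /=; rewrite subr0.
Qed.

Lemma continuous_at_dotp (u w : V -> V) (x : V) :
  (forall j, {for x, continuous (fun y : V => u y ord0 j)}) ->
  (forall j, {for x, continuous (fun y : V => w y ord0 j)}) ->
  {for x, continuous (fun y : V => dotp (u y) (w y))}.
Proof.
move=> cu cw; have FF : Filter (nbhs x) by exact: nbhs_filter.
rewrite /dotp; elim: (index_enum _) => [|j s IH].
  rewrite (_ : (fun _ => _) = cst 0); first exact: cvg_cst.
  by apply/funext => y; rewrite big_nil.
rewrite (_ : (fun _ => _) = (fun y => u y ord0 j * w y ord0 j + \sum_(j <- s) u y ord0 j * w y ord0 j)).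
  by apply: cvgD => //; apply: cvgM; [exact: cu|exact: cw].
by apply/funext => y; rewrite big_cons.
Qed.

Lemma unit_ball_fin : exists2 w : R, 0 < w & leb n unit_ball = w%:E.
Proof.
have mU : measurable (unit_ball : set V) by apply: open_measurable_rV; exact: open_eball.
have le1 : (leb n unit_ball <= ((2 * 1) ^+ n)%:E :> \bar R)%E.
  rewrite -(leb_ball (0 : V))//; apply: le_measure; rewrite ?inE//; first exact: measurable_ball_rV.
  move=> x /= x1; rewrite -ball_normE /= sub0r normrN.
  exact: le_lt_trans (norm_le_enorm x) x1.
pose s : R := (n%:R + 1)^-1.
have s0 : 0 < s by rewrite invr_gt0 ltr_wpDl.
have ge1 : (((2 * s) ^+ n)%:E <= leb n unit_ball :> \bar R)%E.
  rewrite -(leb_ball (0 : V))//; apply: le_measure; rewrite ?inE//; first exact: measurable_ball_rV.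
  move=> x; rewrite -ball_normE /= sub0r normrN => xs.
  rewrite /unit_ball/= -[ltRHS]sqrtr1 ltr_sqrt// (le_lt_trans (dotp_le_norm (ltW xs)))//.
  have n1 : 0 < n%:R + 1 :> R by rewrite ltr_wpDl.
  rewrite /s exprVn ltr_pdivrMr ?exprn_gt0// mul1r.
  have : 0 <= n%:R :> R by []. 
  by move: (n%:R : R) => m m0; rewrite expr2; nra.
case: (leb n unit_ball) le1 ge1 => [w _|//|//].
by rewrite lee_fin => sw; exists w => //; apply: lt_le_trans sw; rewrite exprn_gt0// mulr_gt0.
Qed.

Lemma leb_eball (r : R) : 0 < r -> leb n [set x : V | enorm x < r] = ((r ^+ n)%:E * leb n unit_ball)%E.
Proof.
move=> r0; pose A : 'M[R]_n := (r^-1)%:M.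
have pA : posdef A.
  split=> [|v v0]; first exact: tr_scalar_mx.
  rewrite quadfE mul_mx_scalar dotpZl mulr_gt0 ?invr_gt0// lt_neqAle dotp_ge0 andbT eq_sym.
  by apply: contra v0 => /eqP/dotp_eq0/eqP.
have [_ H] := leb_posdef pA.
have mU : measurable (unit_ball : set V) by apply: open_measurable_rV; exact: open_eball.
rewrite -(H _ mU) muleA -EFinM det_scalar exprVn divff ?gt_eqF ?exprn_gt0// mul1e.
congr (leb n _); apply/seteqP; split => x;
  rewrite /= /unit_ball /= mul_mx_scalar enormZ gtr0_norm ?invr_gt0// mulrC.
  by rewrite ltr_pdivrMr// mul1r.
by rewrite ltr_pdivrMr// mul1r.
Qed.

End Euclidean.

Lemma continuous_powR_ge0 {R : realType} (T : topologicalType) (u : T -> R) (p : R) : 0 < p ->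
  (forall x, 0 <= u x) -> continuous u -> continuous (fun x => u x `^ p).
Proof.
move=> p0 u0 cu x; have [ux|ux] := eqVneq (u x) 0.
  rewrite /continuous_at ux powR0 ?gt_eqF//; apply/cvgrPdist_le => e e0.
  have e1 : 0 < e `^ p^-1 by rewrite powR_gt0.
  have /cvgrPdist_lt /(_ _ e1) := cu x; apply: filterS => y; rewrite ux sub0r normrN ger0_norm// => uy.
  rewrite sub0r normrN ger0_norm ?powR_ge0//.
  have -> : e = (e `^ p^-1) `^ p by rewrite -powRrM mulVf ?gt_eqF// powRr1// ltW.
  by apply: ge0_ler_powR; rewrite ?nnegrE ?powR_ge0// ltW.
have up : 0 < u x by rewrite lt_neqAle eq_sym ux u0.
have c1 : {for u x, continuous (fun a : R => a `^ p)}.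
  apply: differentiable_continuous; apply/derivable1_diffP.
  by apply: derivable_powR; rewrite in_itv /= up.
exact: (continuous_comp (cu x) c1).
Qed.

(** The integral of a nonnegative function, measurable or not, is the supremum of
    those of the simple functions below it. *)
Lemma le_integralT d (T : measurableType d) {R : realType} (mu : {measure set T -> \bar R})
  (f1 f2 : T -> \bar R) : (forall x, 0 <= f1 x)%E -> (forall x, f1 x <= f2 x)%E ->
  (\int[mu]_x f1 x <= \int[mu]_x f2 x)%E.
Proof.
move=> f10 f12; rewrite !ge0_integralTE// => [|x]; last exact: le_trans (f10 x) (f12 x).
apply: le_ereal_sup => y /= [u uf1 uy]; exists u => // x.
exact: le_trans (uf1 x) (f12 x).
Qed.

(** The constraints are lower semicontinuous relative to A. *)
Lemma closed_constraint {R : realType} (T : topologicalType) (I : Type) (P : I -> Prop)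
    (A : set T) (psi : I -> T -> R) : closed A ->
  (forall i x, A x -> 0 < psi i x -> \forall y \near x, A y -> 0 < psi i y) ->
  closed [set x | A x /\ forall i, P i -> psi i x <= 0].
Proof.
move=> cA H x clx; have Ax : A x by apply: cA; apply: closureS clx => y [].
split=> // i Pi; rewrite leNgt; apply/negP => /(H _ _ Ax) nx.
have [y [[Ay Hy] ny]] := clx _ nx.
by have := Hy i Pi; rewrite leNgt ny.
Qed.

(** * The contact set and its image under the gradient *)

Section ContactSet.
Context {R : realType} {n N : nat}.
Local Notation V := 'rV[R]_n.
Variables (g : mpoly.mpoly (n * n) R) (f : V -> R) (Omega : set V) (h : V -> R).
Hypotheses (n0 : (0 < n)%N) (gGD : central_GD N g).
Hypotheses (f_cont : continuous f) (f_ge0 : forall x, 0 <= f x).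
Hypotheses (oO : open Omega) (bO : bounded_set Omega) (hC11 : C11 Omega h).
Hypotheses (ch : {within closure Omega, continuous h}) (sol : admissible_solution g f Omega h).
Local Notation C := (closure Omega).
Local Notation p := (n%:R / N%:R : R).
Local Notation G := (grad h).

Lemma interior_minimum (q x : V) : Omega x ->
  (forall y, Omega y -> h x + dotp q (y - x) <= h y) -> G x = q.
Proof.
move=> Ox qmin; apply/rowP => i; rewrite -!dotp_delta1; set v := delta_mx _ _.
have [r r0 rO] := open_ball_sub oO Ox.
pose s := r / (`|v| + 1).
have s0 : 0 < s by rewrite divr_gt0// ltr_wpDl.
pose u (t : R) := h (x + t *: v) - t * dotp q v.
have inO (t : R) : t \in `]- s, s[ -> Omega (x + t *: v).
  rewrite in_itv /= -ltr_norml => ts; apply: rO.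
  rewrite -ball_normE /= opprD addrA subrr sub0r normrN normrZ.
  rewrite (@le_lt_trans _ _ (`|t| * (`|v| + 1)))//; first by rewrite ler_wpM2l// lerDl.
  by rewrite -ltr_pdivlMr// ltr_wpDl.
have du (t : R) : t \in `]- s, s[ -> is_derive t 1 u (dotp (G (x + t *: v)) v - dotp q v).
  move=> ts; apply: is_deriveB; first exact: is_derive_line (hC11.1 _ (inO t ts)).
  rewrite (_ : (fun _ => _) = horner (dotp q v *: 'X)); last first.
    by apply/funext => t'; rewrite !hornerE mulrC.
  have := is_derive_poly (dotp q v *: 'X) t.
  by rewrite derivZ derivX hornerZ hornerC mulr1.
have s00 : (0 : R) \in `]- s, s[ by rewrite in_itv /= oppr_lt0 s0.
have min0 : is_derive (0 : R) 1 u 0.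
  apply: (@derive1_at_min _ u (- s) s 0) => //.
  - by rewrite ge0_cp// ltW.
  - by move=> t ts; have [] := du t ts.
  move=> t ts; rewrite /u scale0r addr0 mul0r subr0 lerBrDr.
  by have := qmin _ (inO t ts); rewrite [x + _ - x]addrAC subrr add0r dotpZr.
have := @derive_val _ _ _ _ _ _ _ (du 0 s00).
rewrite (@derive_val _ _ _ _ _ _ _ min0) scale0r addr0 => /esym/eqP.
by rewrite subr_eq0 => /eqP.
Qed.

Lemma within_near (x : V) (a : R) : C x -> a < h x -> \forall y \near x, C y -> a < h y.
Proof.
move=> Cx ax.
have : \forall y \near within C (nbhs x), a < h y.
  rewrite (nbhs_subspace_in Cx).
  have cx : h @ (nbhs (x : subspace C)) --> h x by apply: ch.
  exact: (cvgr_gt (h x) cx).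
exact.
Qed.

Section Slopes.
Variables (x0 : V) (m D r : R).
Hypotheses (Ox0 : Omega x0) (hm : forall z, bdry Omega z -> m <= h z).
Hypotheses (xD : forall y, C y -> enorm (y - x0) <= D) (r0 : 0 <= r) (rD : h x0 + r * D < m).

(** The bound on h keeps these points away from the boundary. *)
Definition contact_set : set V := [set x | (C x /\ h x <= h x0 + r * D) /\
  (enorm (G x) <= r /\ forall y, C y -> h x + dotp (G x) (y - x) <= h y)].

Let c := h x0 + r * D.
Let K := contact_set.

(** x minimizes h - q . (y - x0); it is interior because on the boundary this
    function is at least m - r D > h x0, its value at x0. *)
Lemma slope_attained (q : V) : enorm q <= r -> exists2 x, K x & G x = q.
Proof.
move=> qr.
have qD y : C y -> dotp q (y - x0) <= r * D.
  move=> Cy; rewrite (le_trans (cauchy_schwarz _ _))//.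
  by rewrite ler_pM ?sqrtr_ge0// xD.
have cw : {within C, continuous (fun y : V => h y + dotp (- q) (y - x0))}.
  have cs : {within C, continuous (fun y : V => dotp (- q) (y - x0))}.
    by apply: continuous_subspaceT => y; exact: continuous_dotp.
  by move=> y; apply: cvgD; [exact: ch|exact: (cs y)].
have Cx0 : C x0 by exact: subset_closure.
have [|x1] := @compact_EVT_min _ R _ C _ (compact_closure_bounded bO) cw; first by exists x0.
rewrite inE => Cx1 xmin.
have {}xmin y : C y -> h x1 + dotp q (y - x1) <= h y.
  move=> Cy; have Cy' : y \in C by rewrite inE.
  have := xmin y Cy'; rewrite !dotpNl.
  have -> : y - x1 = (y - x0) - (x1 - x0) by rewrite opprB addrA subrK.
  by rewrite [dotp q (_ - (_ - _))]dotpDr dotpNr; lra.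
have hx1 : h x1 <= c.
  have := xmin x0 Cx0; have := qD x1 Cx1; rewrite /c.
  have -> : x0 - x1 = - (x1 - x0) by rewrite opprB.
  by rewrite [dotp q (- _)]dotpNr; lra.
have Ox1 : Omega x1.
  apply: (open_bdry oO Cx1) => bx1; have := hm bx1; rewrite leNgt => /negP; apply.
  exact: le_lt_trans hx1 rD.
have Gq : G x1 = q.
  by apply: interior_minimum => // y Oy; apply: xmin; exact: subset_closure.
by exists x1 => //; split; rewrite ?Gq.
Qed.

Let C0 : set V := [set y | C y /\ h y <= c].

Lemma sublevel_sub : C0 `<=` Omega.
Proof.
move=> x [Cx hx]; apply: (open_bdry oO Cx) => bx; have := hm bx.
by rewrite leNgt => /negP; apply; exact: le_lt_trans hx rD.
Qed.

Lemma contact_set_sub : K `<=` Omega. Proof. by move=> x [/sublevel_sub]. Qed.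

Lemma compact_contact_set : compact K.
Proof.
have cC0 : closed C0.
  have -> : C0 = [set x | C x /\ forall i : unit, True -> h x - c <= 0].
    apply/seteqP; split=> x [Cx H]; split=> //.
      by move=> _ _; rewrite subr_le0.
    by have := H tt I; rewrite subr_le0.
  apply: closed_constraint; first exact: closed_closure.
  move=> _ x Cx; rewrite subr_gt0 => hx.
  apply: (@filterS _ (nbhs x) (nbhs_filter x) _ _ _ (within_near Cx hx)) => y H Cy.
  by rewrite subr_gt0; exact: H.
pose psi (i : option V) (x : V) : R :=
  if i is Some y then h x + dotp (G x) (y - x) - h y else dotp (G x) (G x) - r ^+ 2.
pose P (i : option V) := if i is Some y then C y else True.
have KE : K = [set x | C0 x /\ forall i, P i -> psi i x <= 0].
  apply/seteqP; split=> x [C0x H]; split=> //.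
    have [H1 H2] := H => -[y|_] /=; first by move=> Cy; rewrite subr_le0; exact: H2.
    rewrite subr_le0 -enorm_sqr lerXn2r ?nnegrE ?sqrtr_ge0//.
  split; last by move=> y Cy; have := H (Some y) Cy; rewrite /= subr_le0.
  have := H None I; rewrite /= subr_le0 -enorm_sqr => H1.
  by rewrite -(@ler_pXn2r _ 2)// ?nnegrE ?sqrtr_ge0.
apply: (@subclosed_compact _ _ C) => //; last 2 first.
- exact: compact_closure_bounded.
- by move=> x [[]].
rewrite KE; apply: closed_constraint => // i x C0x psi0.
have Ox := sublevel_sub C0x.
have FF : Filter (nbhs x) by exact: nbhs_filter.
have ch' : {for x, continuous h} by apply: sol.1; rewrite inE.
have cG := continuous_grad oO hC11 Ox.
have cGi j : {for x, continuous (fun y : V => G y ord0 j)}.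
  exact: (continuous_comp cG (@coord_continuous _ _ _ _ _ _)).
have cpsi : {for x, continuous (psi i)}.
  case: i {psi0} => [y|] /=.
    apply: cvgB; last exact: cvg_cst.
    apply: cvgD => //; apply: continuous_at_dotp => // j.
    rewrite (_ : (fun _ => _) = (fun z : V => y ord0 j - z ord0 j)); last first.
      by apply/funext => z; rewrite !mxE.
    by apply: cvgB; [exact: cvg_cst|exact: coord_continuous].
  by apply: cvgB; [exact: continuous_at_dotp|exact: cvg_cst].
have H : \forall y \near x, 0 < psi i y by exact: (cvgr_gt (psi i x) cpsi).
by apply: filterS H.
Qed.


Let gI := evalS g 1%:M.
Let E : set V := upper_contact_set Omega (fun x => - h x) `&` Diff2 Omega (fun x => - h x).
Hypothesis r_gt0 : 0 < r.

(** The left-hand side is, up to a power of g(I), the measure of a ball of slopes.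
    It is covered by gradients at contact points, and the Jacobian determinant of
    the gradient map is at most (f / g(I))^(n/N) at almost every one of them. *)
Lemma contact_estimate :
  (((r ^+ n) * gI `^ p)%:E * leb n unit_ball <=
   \int[leb n]_x `|((fun x => (f x `^ N%:R^-1)%:E) \_ E) x| `^ n%:R)%E.
Proof.
have [N0 _] := garding_majorization gGD n0 (@posdef1 R n).
have gI0 : 0 < gI := GD_normalized gGD.
have p0 : 0 < p by rewrite divr_gt0 ?ltr0n.
have nz : n%:R != 0 :> R by rewrite pnatr_eq0 -lt0n.
pose J0 (x : V) := (f x / gI) `^ p.
have J0ge x : 0 <= J0 x by exact: powR_ge0.
have cJ0 : continuous J0.
  apply: continuous_powR_ge0 => //; first by move=> x; rewrite divr_ge0// ltW.
  move=> x; have FF : Filter (nbhs x) by exact: nbhs_filter.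
  by apply: cvgM; [exact: f_cont|exact: cvg_cst].
have cK := compact_contact_set.
have [M HM] : exists M : R, forall x, K x -> J0 x <= M.
  have [[x Kx]|/set0P/negP/negPn/eqP K0] := pselect (K !=set0); last by exists 0; rewrite K0.
  have [|y _ H] := @compact_EVT_max _ R J0 K (ex_intro _ x Kx) cK.
    exact: continuous_subspaceT.
  by exists (J0 y) => z Kz; apply: H; rewrite inE.
(* J agrees with J0 on K, and is bounded everywhere *)
pose J (x : V) := Num.min (J0 x) `|M|.
have cJ : continuous J.
  move=> x; apply: continuous_min; first exact: cJ0.
  by apply: cvg_cst; exact: nbhs_filter.
have JK x : K x -> J x = J0 x.
  by move=> Kx; apply: min_l; rewrite (le_trans (HM x Kx))// ler_norm.
have lipO x : Omega x -> exists r L : R, [/\ 0 < r, 0 <= L &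
     forall y z, ball x r y -> ball x r z -> `|G y - G z| <= L * `|y - z|].
  by move=> /(C11_lipschitz oO hC11)[s [L [s0 L0 _ H]]]; exists s, L.
have [Nul [mNul Nul0 NulP]] := ae_derivative_mx lipO.
have derK x : K x -> ~ Nul x -> exists A, derivative_mx G x A.
  move=> Kx nx; apply: contrapT => nA; apply: nx; apply: NulP; split=> //.
  exact: contact_set_sub.
have contactK x : K x -> forall y, Omega y -> h x + dotp (G x) (y - x) <= h y.
  by move=> [_ [_ H]] y Oy; apply: H; exact: subset_closure.
have area : (((leb n)^*)%mu (G @` K) <= \int[leb n]_(x in K) (J x)%:E)%E.
  apply: (@area_inequality _ _ G K J `|M|) => //.
  - move=> S cS SK; apply: compact_measurable_rV; apply: continuous_compact => //.
    apply: continuous_in_subspaceT => x; rewrite inE => Sx.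
    by apply: (continuous_grad oO hC11); apply: contact_set_sub; exact: SK.
  - by move=> x; rewrite le_min J0ge normr_ge0/= ge_min lexx orbT.
  - move=> x Kx; have [s [L [s0 L0 H]]] := lipO x (contact_set_sub Kx).
    exists ((2 * (L + 1)) ^+ n), (s / 2); split.
    + by rewrite exprn_ge0// mulr_ge0// addr_ge0.
    + by rewrite divr_gt0.
    + exact: image_bound_lipschitz.
  - exists Nul; split=> // x Kx nx e e0; rewrite JK//.
    have [A dA] := derK x Kx nx.
    exact: (contact_image_bound n0 gGD oO hC11 sol (contact_set_sub Kx) dA (contactK x Kx) K e0).
have ballK : [set q : V | enorm q < r] `<=` G @` K.
  by move=> q /= qr; have [x Kx <-] := slope_attained (ltW qr); exists x.
have mB : measurable [set q : V | enorm q < r] by apply: open_measurable_rV; exact: open_eball.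
have mK : measurable K by exact: compact_measurable_rV.
have step1 : ((r ^+ n)%:E * leb n unit_ball <= \int[leb n]_(x in K) (J x)%:E)%E.
  rewrite -leb_eball//; apply: le_trans area.
  rewrite -[X in (X <= _)%E](@measurable_mu_extE _ _ _ (leb n))//.
  exact: le_mu_ext.
have KE x : K x -> ~ Nul x -> E x.
  move=> Kx nx; have [A dA] := derK x Kx nx; have Ox := contact_set_sub Kx; split.
    split=> //; exists (- G x) => y Oy; rewrite dotpNl lerNl opprD !opprK.
    exact: contactK.
  exact: (Diff2_opp oO hC11 Ox dA).

pose u (x : V) := (gI `^ p * J x)%:E.
have mJ : measurable_fun K (fun x => (J x)%:E).
  apply/measurable_EFinP; apply: measurable_funTS; exact: continuous_measurable_rV.
have step2 : (((r ^+ n) * gI `^ p)%:E * leb n unit_ball <= \int[leb n]_x (u \_ (K `\` Nul)) x)%E.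
  rewrite mulrC EFinM -muleA -integral_mkcond /u.
  under eq_integral do rewrite EFinM.
  rewrite ge0_integralZl_EFin ?powR_ge0//; last 2 first.
  - by move=> x _; rewrite lee_fin le_min J0ge normr_ge0.
  - by apply: measurable_funS mJ => //; exact: subDsetl.
  2: exact: measurableD.
  rewrite lee_wpmul2l ?lee_fin ?powR_ge0//.
  rewrite -(ge0_negligible_integral mNul mK mJ)// => x _.
  by rewrite lee_fin le_min J0ge normr_ge0.
apply: (le_trans step2); apply: le_integralT => x.
  by apply: erestrict_ge0 => y _; rewrite lee_fin mulr_ge0 ?powR_ge0// le_min J0ge normr_ge0.
rewrite patchE; case: ifPn => [|_]; last exact: poweR_ge0.
rewrite inE => -[Kx nx]; have Ex := KE x Kx nx.
rewrite patchE mem_set// /u JK// /J0 /= lee_fin ger0_norm ?powR_ge0//.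
rewrite -powRrM [N%:R^-1 * _]mulrC -powRM ?divr_ge0 ?(ltW gI0)//.
by rewrite [gI * _]mulrC divfK// gt_eqF.
Qed.

End Slopes.

(** Let r tend to (m - h x0) / D in [contact_estimate]. *)
Lemma slope_bound (x0 : V) (m D : R) :
  let E : set V := upper_contact_set Omega (fun x => - h x) `&` Diff2 Omega (fun x => - h x) in
  Omega x0 -> (forall z, bdry Omega z -> m <= h z) ->
  (forall y, C y -> enorm (y - x0) <= D) -> 0 < D -> h x0 < m ->
  ((m - h x0)%:E <=
     (D / (fine (leb n unit_ball) `^ n%:R^-1 * evalS g 1%:M `^ N%:R^-1))%:E *
     'N[leb n]_(n%:R%:E) [(fun x => (f x `^ N%:R^-1)%:E) \_ E])%E.
Proof.
move=> E Ox0 hm xD D0 hx0; set F := _ \_ E.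
have [N0 _] := garding_majorization gGD n0 (@posdef1 R n).
set gI := evalS g 1%:M; have gI0 : 0 < gI := GD_normalized gGD.
have nz : n%:R != 0 :> R by rewrite pnatr_eq0 -lt0n.
have [w w0 wE] := @unit_ball_fin R n; rewrite wE /=.
pose a := w `^ n%:R^-1 * gI `^ N%:R^-1; rewrite -/a.
have a0 : 0 < a by rewrite mulr_gt0// powR_gt0.
have key r : 0 < r -> r * D < m - h x0 -> ((r * a)%:E <= 'N[leb n]_(n%:R%:E) [F])%E.
  move=> r0 rD; have rD' : h x0 + r * D < m by rewrite addrC -ltrBrDr.
  have := contact_estimate Ox0 hm xD (ltW r0) rD' r0.
  rewrite wE -EFinM -/gI -/E -/F unlock => est.
  have -> : r * a = (r ^+ n * gI `^ p * w) `^ n%:R^-1.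
    rewrite !powRM ?mulr_ge0 ?powR_ge0 ?exprn_ge0 ?ltW// -powR_mulrn ?ltW// -!powRrM divff//.
    have -> : n%:R / N%:R / n%:R = N%:R^-1 :> R by rewrite mulrAC divff// mul1r.
    by rewrite powRr1 ?ltW// /a -mulrA; congr (_ * _); rewrite mulrC.
  rewrite -poweR_EFin; apply: gt0_ler_poweR => //; rewrite ?invr_ge0//.
    by rewrite in_itv /= leey andbT lee_fin !mulr_ge0 ?powR_ge0 ?exprn_ge0 ?ltW.
  rewrite in_itv /= leey andbT; apply: integral_ge0 => x _; exact: poweR_ge0.
have L0 : (0 <= 'N[leb n]_(n%:R%:E) [F])%E by exact: Lnorm_ge0.
case: ('N[leb n]_(n%:R%:E) [F])%E L0 key => [l|_ _|//]; last first.
  by rewrite gt0_muley ?leey// lte_fin divr_gt0.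
rewrite lee_fin => l0 key; rewrite -EFinM lee_fin leNgt; apply/negP => lt.
pose r := (l / a + (m - h x0) / D) / 2.
have h1 : l / a < (m - h x0) / D by rewrite ltr_pdivlMr// mulrC mulrCA mulrC.
have r1 : l / a < r by rewrite /r; lra.
have r2 : r < (m - h x0) / D by rewrite /r; lra.
have r0 : 0 < r by apply: le_lt_trans r1; rewrite divr_ge0// ltW.
have := key r r0; rewrite -ltr_pdivlMr// => /(_ r2); rewrite lee_fin leNgt.
by rewrite -ltr_pdivrMr// r1.
Qed.

End ContactSet.

(** * Bounded open domains and the theorem *)

Section Domain.
Context {R : realType} {n : nat}.
Local Notation V := 'rV[R]_n.
Variable Omega : set V.
Hypotheses (n0 : (0 < n)%N) (oO : open Omega) (bO : bounded_set Omega).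

Lemma open_shift (x : V) (i : 'I_n) : Omega x ->
  exists2 s : R, 0 < s & Omega (x + s *: delta_mx ord0 i).
Proof.
move=> Ox; have [r r0 rO] := open_ball_sub oO Ox.
exists (r / 2); first by rewrite divr_gt0.
apply: rO; rewrite -ball_normE /= opprD addrA subrr sub0r normrN.
rewrite normrZ gtr0_norm ?divr_gt0// (@le_lt_trans _ _ (r / 2 * 1))//; last first.
  by rewrite mulr1 ltr_pdivrMr// mulr_natr mulr2n ltrDl.
rewrite ler_wpM2l ?divr_ge0 ?(ltW r0)//; apply/norm_rV_le => // j.
by rewrite mxE normr_nat -[1]/(1%:R) ler_nat; case: (_ && _).
Qed.

(** A point of the closure that is highest in a coordinate direction is not
    interior. *)
Lemma bdry_nonempty : Omega !=set0 -> bdry Omega !=set0.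
Proof.
move=> [x0 Ox0]; pose i := Ordinal n0.
have cf : {within closure Omega, continuous (fun y : V => y ord0 i)}.
  by apply: continuous_subspaceT => y; exact: coord_continuous.
have [|x1] := @compact_EVT_max _ R _ _ _ (compact_closure_bounded bO) cf.
  by exists x0; exact: subset_closure.
rewrite inE => Cx1 xmax; exists x1; apply: contrapT => nb.
have [s s0 Os] := open_shift i (open_bdry oO Cx1 nb).
have Cs : x1 + s *: delta_mx ord0 i \in closure Omega by rewrite inE; exact: subset_closure.
by have := xmax _ Cs; rewrite !mxE !eqxx mulr1 gerDl leNgt s0.
Qed.

Lemma diam_ub (x y : V) : Omega x -> closure Omega y -> enorm (y - x) <= diam Omega.
Proof.
move=> Ox Cy; have [M [_ MO]] := bO.
have M1 : M < `|M| + 1 by rewrite (le_lt_trans (ler_norm M))// ltrDl.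
have hs : has_sup [set enorm (u - v) | u in Omega & v in Omega].
  split; first by exists (enorm (x - x)), x => //; exists x.
  exists (Num.sqrt (n%:R * (2 * (`|M| + 1)) ^+ 2)) => _ [u Ou [v Ov <-]].
  rewrite ler_wsqrtr// dotp_le_norm// (le_trans (ler_normB _ _))//.
  by have := MO _ M1 u Ou; have := MO _ M1 v Ov; rewrite /=; lra.
have clD : closed [set z : V | enorm (z - x) <= diam Omega].
  rewrite (_ : [set _ | _] = (fun z : V => enorm (z - x)) @^-1` [set t | t <= diam Omega])//.
  by apply: closed_comp => [z _|]; [exact: continuous_enorm|exact: closed_le].
apply: clD; apply: closureS Cy => z Oz.
by apply: sup_upper_bound hs _ _; exists z => //; exists x.
Qed.

Lemma diam_gt0 (x : V) : Omega x -> 0 < diam Omega.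
Proof.
move=> Ox; have [s s0 Os] := open_shift (Ordinal n0) Ox.
apply: lt_le_trans (diam_ub Ox (subset_closure Os)).
rewrite addrAC subrr add0r enormZ mulr_gt0 ?normr_gt0 ?gt_eqF//.
by rewrite /enorm dotp_delta1 mxE !eqxx sqrtr1.
Qed.

Lemma bounded_values (h : V -> R) : {within closure Omega, continuous h} ->
  exists B : R, forall y, closure Omega y -> `|h y| <= B.
Proof.
move=> ch; have /compact_bounded[M [_ HM]] := continuous_compact ch (compact_closure_bounded bO).
exists (`|M| + 1) => y Cy; apply: (HM (`|M| + 1)); last by exists y.
by rewrite (le_lt_trans (ler_norm M))// ltrDl.
Qed.

End Domain.

Theorem mainTheorem2 (R : realType) (n N : nat) (g : mpoly.mpoly (n * n) R)
    (f : 'rV[R]_n -> R) (Omega : set 'rV[R]_n) (h : 'rV[R]_n -> R)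
    (n_gt0 : (0 < n)%N)
    (g_central : central_GD N g)
    (f_cont : continuous f) (f_ge0 : forall x, 0 <= f x)
    (Omega_open : open Omega) (Omega_bounded : bounded_set Omega)
    (h_C11 : C11 Omega h) (h_cont : {within closure Omega, continuous h})
    (h_sol : admissible_solution g f Omega h) :
  let E : set 'rV[R]_n :=
    upper_contact_set Omega (fun x => - h x) `&` Diff2 Omega (fun x => - h x) in
  ((osc Omega h)%:E <=
     (osc (bdry Omega) h)%:E +
     (diam Omega / (fine (leb n unit_ball) `^ n%:R^-1
                      * evalS g 1%:M `^ N%:R^-1))%:E *
     'N[leb n]_(n%:R%:E) [(fun x => (f x `^ N%:R^-1)%:E) \_ E])%E.
Proof.
lazy zeta.
have [x0|/set0P/negP/negPn/eqP O0] := pselect (Omega !=set0); last first.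
  (* suprema and infima over the empty set are 0 *)
  rewrite O0 /osc /bdry closure0 set0D !image_set0 /inf image_set0 sup0 oppr0 subrr add0e.
  have -> : diam (set0 : set 'rV[R]_n) = 0.
    by rewrite /diam (_ : [set _ | _ in _ & _ in _] = set0) ?sup0// -subset0 => t [].
  by rewrite mul0r mul0e.
have [N0 _] := garding_majorization g_central n_gt0 (@posdef1 R n).
have bdry0 := bdry_nonempty n_gt0 Omega_open Omega_bounded x0.
have [B HB] := bounded_values Omega_bounded h_cont.
set m := inf (h @` bdry Omega); set M := sup (h @` bdry Omega).
have hM z : bdry Omega z -> h z <= M.
  move=> bz; apply: sup_upper_bound; last by exists z.
  split; first exact: image_nonempty.
  exists B => _ [y by_ <-]; rewrite (le_trans (ler_norm _))// HB//; exact: bdry_closure.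
have hm z : bdry Omega z -> m <= h z.
  move=> bz; apply: ge_inf; last by exists z.
  exists (- B) => _ [y by_ <-]; rewrite lerNl (le_trans (ler_norm _))// normrN HB//.
  exact: bdry_closure.
have supM : sup (h @` Omega) <= M.
  apply: ge_sup; first exact: image_nonempty.
  by move=> _ [x Ox <-]; exact: (maximum_principle g_central N0 Omega_open Omega_bounded h_cont h_sol hM).
set c := (_ / _)%R; set L := Lnorm _ _ _.
have c0 : 0 <= c.
  rewrite divr_ge0 ?mulr_ge0 ?powR_ge0//.
  by have [x Ox] := x0; rewrite ltW// (diam_gt0 n_gt0 Omega_open Omega_bounded Ox).
have L0 : (0 <= L)%E by exact: Lnorm_ge0.
have low x : Omega x -> ((m - h x)%:E <= c%:E * L)%E.
  move=> Ox; have [hx|hx] := ltP (h x) m; last first.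
    by rewrite (@le_trans _ _ 0%E)// ?lee_fin ?subr_le0// mule_ge0.
  apply: (slope_bound n_gt0 g_central f_cont f_ge0 Omega_open Omega_bounded h_C11 h_cont h_sol) => //.
    by move=> y; exact: diam_ub.
  exact: (diam_gt0 n_gt0 Omega_open Omega_bounded Ox).
have cL0 : (0 <= c%:E * L)%E by rewrite mule_ge0.
case: (c%:E * L)%E cL0 low => [l|_ _|//]; last by rewrite addey// leey.
move=> _ low; rewrite -EFinD lee_fin /osc -/m -/M.
have : m - l <= inf (h @` Omega).
  apply: lb_le_inf; first exact: image_nonempty.
  by move=> _ [x /low + <-]; rewrite lee_fin; lra.
by move: supM; lra.
Qed.
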